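(* Let $N\ge 1$, $0<s<1$, $2<q\le p<\infty$ with $N>sp$, and put $p_s^*=\frac{Np}{N-sp}$. Let $\theta>\frac{N}{sp}$, let $f\in L^{\frac{p_s^*}{p_s^*-1}}(\mathbb{R}^N)\cap L^{\theta}(\mathbb{R}^N)$, and let $u\in\mathcal{W}=D^{s,p}(\mathbb{R}^N)\cap D^{s,q}(\mathbb{R}^N)$ be a weak solution of $$(-\Delta_p)^s u+(-\Delta_q)^s u=f\ \text{ in }\mathbb{R}^N,\qquad u(x)\ge 0,\ x\in\mathbb{R}^N.$$ Then $u\in L^\infty(\mathbb{R}^N)$. Moreover, if $f\in L^\infty_{loc}(\mathbb{R}^N)$, then $u$ is locally Hölder continuous: $u\in C^{\alpha}_{loc}(\mathbb{R}^N)$ for some $\alpha\in\left(0,\frac{s(p-q)}{p-1}\right)$.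
   Context: For $1<m<N/s$ let $m_s^*=\frac{Nm}{N-sm}$, $\|u\|_{s,m}=\left(\int_{\mathbb{R}^N}\int_{\mathbb{R}^N}\frac{|u(x)-u(y)|^m}{|x-y|^{N+sm}}\,dx\,dy\right)^{1/m}$ and $D^{s,m}(\mathbb{R}^N)=\{u\in L^{m_s^*}(\mathbb{R}^N):\|u\|_{s,m}<\infty\}$. Write $J_m(t)=|t|^{m-2}t$. A function $u\in\mathcal{W}$ with $u\ge0$ is a weak solution of the problem if for all $\varphi\in\mathcal{W}$ $$\sum_{m=p,q}\int_{\mathbb{R}^N}\int_{\mathbb{R}^N}\frac{J_m(u(x)-u(y))(\varphi(x)-\varphi(y))}{|x-y|^{N+sm}}\,dx\,dy=\int_{\mathbb{R}^N}f\varphi\,dx$$ (the sum over $m=p,q$ always has two terms, one for $p$ and one for $q$). $u\in C^\alpha_{loc}(\mathbb{R}^N)$ means that (a representative of) $u$ is bounded with $\sup_{x\ne y\in\Omega}|u(x)-u(y)|/|x-y|^\alpha<\infty$ on every compact $\Omega\subset\mathbb{R}^N$.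
   Formalization: For q = p the interval (0, s(p-q)/(p-1)) is empty, so the claim fails (u = f = 0); the formal theorem asserts some α in (0,1) for all q ≤ p, with α < s(p-q)/(p-1) required only when q < p. *)

(* Defs.v *)
From HB Require Import structures.
From mathcomp Require Import all_boot all_order all_algebra.
From mathcomp Require Import all_classical all_reals all_analysis.
Import Order.TTheory GRing.Theory Num.Theory.
Import numFieldNormedType.Exports.

Set Implicit Arguments.
Unset Strict Implicit.
Unset Printing Implicit Defensive.

Local Open Scope classical_set_scope.
Local Open Scope ring_scope.

Section measurable_rV.
Context (R : realType) (n : nat).

(* The product sigma-algebra, generated by the n coordinates; since R is second
   countable it is the Borel sigma-algebra of R^n. *)
Definition rV_coord (i : 'I_n) (x : 'rV[R]_n) : R := x ord0 i.

Let rV_set0 : g_sigma_preimage rV_coord set0.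
Proof. exact: sigma_algebra0. Qed.

Let rV_setC A : g_sigma_preimage rV_coord A -> g_sigma_preimage rV_coord (~` A).
Proof. exact: sigma_algebraC. Qed.

Let rV_bigcup (F : (set 'rV[R]_n)^nat) :
  (forall i, g_sigma_preimage rV_coord (F i)) ->
  g_sigma_preimage rV_coord (\bigcup_i (F i)).
Proof. exact: sigma_algebra_bigcup. Qed.

HB.instance Definition _ := @isMeasurable.Build default_measure_display
  'rV[R]_n (g_sigma_preimage rV_coord) rV_set0 rV_setC rV_bigcup.

End measurable_rV.

Section measurability.
Context (R : realType).

Lemma measurable_rV_coord n (i : 'I_n) :
  measurable_fun [set: 'rV[R]_n] (@rV_coord R n i).
Proof.
move=> _ Y mY; rewrite setTI; apply: sub_sigma_algebra => /=.
rewrite -bigcup_seq/=; exists i => /=; first by rewrite mem_index_enum.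
by exists Y => //; rewrite setTI.
Qed.

Lemma measurable_fun_rVP d (T : measurableType d) n (f : T -> 'rV[R]_n) :
  (forall i, measurable_fun [set: T] (@rV_coord R n i \o f)) ->
  measurable_fun [set: T] f.
Proof.
move=> mf _ A mA; rewrite setTI.
have mB : (preimage_set_system [set: T] f
    (g_sigma_preimage (@rV_coord R n))) `<=` measurable.
  rewrite -g_sigma_preimage_comp; apply: smallest_sub.
    exact: sigma_algebra_measurable.
  case: n f mf A mA => [|n] f mf A mA; first by rewrite big_ord0.
  rewrite -bigcup_mkord_ord; apply: bigcup_sub => i Ii.
  by move=> B [C mC <-]; exact: mf.
by apply: mB; exists A => //; rewrite setTI.
Qed.

Definition rV_cons n (z : measurableTypeR R * 'rV[R]_n) : 'rV[R]_n.+1 :=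
  \row_(i < n.+1) oapp (fun j => z.2 ord0 j) z.1 (unlift ord0 i).

Lemma rV_cons0 n (z : measurableTypeR R * 'rV[R]_n) :
  rV_cons z ord0 ord0 = z.1.
Proof. by rewrite mxE unlift_none. Qed.

Lemma rV_consS n (z : measurableTypeR R * 'rV[R]_n) (i : 'I_n) :
  rV_cons z ord0 (lift ord0 i) = z.2 ord0 i.
Proof. by rewrite mxE liftK. Qed.

Lemma measurable_rV_cons n : measurable_fun [set: _] (@rV_cons n).
Proof.
apply: measurable_fun_rVP => i.
case: (unliftP ord0 i) => [j|] ->.
- rewrite (_ : _ \o _ = @rV_coord R n j \o snd); last first.
    by apply/funext => z /=; rewrite /rV_coord rV_consS.
  exact: measurableT_comp (measurable_rV_coord j) measurable_snd.
- rewrite (_ : _ \o _ = (fst : _ -> measurableTypeR R)); last first.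
    by apply/funext => z /=; rewrite /rV_coord rV_cons0.
  exact: measurable_fst.
Qed.

End measurability.

Section lebesgue_rV.
Local Open Scope ereal_scope.
Context (R : realType).

Section step.
Context (n : nat) (mu : {sigma_finite_measure set 'rV[R]_n -> \bar R}).

Definition lebesgue_rV_step : set 'rV[R]_n.+1 -> \bar R :=
  pushforward (@lebesgue_measure R \x mu) (@rV_cons R n).

Let step0 : lebesgue_rV_step set0 = 0.
Proof. by rewrite /lebesgue_rV_step /pushforward preimage_set0 measure0. Qed.

Let step_ge0 A : 0 <= lebesgue_rV_step A.
Proof. by rewrite /lebesgue_rV_step /pushforward measure_ge0. Qed.

Let step_sigma_additive : semi_sigma_additive lebesgue_rV_step.
Proof.
have mc (A : set 'rV[R]_n.+1) : measurable A ->
    measurable (@rV_cons R n @^-1` A).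
  by move=> mA; rewrite -[X in measurable X]setTI; exact: measurable_rV_cons.
move=> F mF tF mUF; rewrite /lebesgue_rV_step /pushforward preimage_bigcup.
apply: measure_semi_sigma_additive.
- by move=> k; exact: mc.
- apply/trivIsetP => /= i j _ _ ij; rewrite -preimage_setI.
  by move/trivIsetP : tF => /(_ _ _ _ _ ij) ->//; rewrite preimage_set0.
- by rewrite -preimage_bigcup; exact: mc.
Qed.

HB.instance Definition _ := isMeasure.Build _ _ _
  lebesgue_rV_step step0 step_ge0 step_sigma_additive.

Lemma lebesgue_rV_stepE (A : set R) (B : set 'rV[R]_n) :
  measurable A -> measurable B ->
  lebesgue_rV_step
    [set x | A (x ord0 ord0) /\ B (\row_i x ord0 (lift ord0 i))] =
  lebesgue_measure A * mu B.
Proof.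
move=> mA mB; rewrite /lebesgue_rV_step /pushforward -product_measure1E//.
congr (_ _); apply/funext => z; apply/propext; rewrite /= rV_cons0.
suff -> : \row_i rV_cons z ord0 (lift ord0 i) = z.2 by [].
by apply/rowP => i; rewrite mxE rV_consS.
Qed.

Let measurable_box (A : set R) (B : set 'rV[R]_n) :
  measurable A -> measurable B ->
  measurable [set x : 'rV[R]_n.+1 |
    A (x ord0 ord0) /\ B (\row_i x ord0 (lift ord0 i))].
Proof.
move=> mA mB; apply: measurableI.
- have := @measurable_rV_coord R n.+1 ord0 measurableT A mA.
  by rewrite setTI.
- have mt : measurable_fun [set: 'rV[R]_n.+1]
      (fun x => \row_(i < n) x ord0 (lift ord0 i)).
    apply: measurable_fun_rVP => i.
    rewrite (_ : _ \o _ = @rV_coord R n.+1 (lift ord0 i)).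
      exact: measurable_rV_coord.
    by apply/funext => x /=; rewrite /rV_coord mxE.
  by have := mt measurableT B mB; rewrite setTI.
Qed.

Let step_sigma_finite : sigma_finite setT lebesgue_rV_step.
Proof.
have /sigma_finiteP[F [TF ndF Foo]] := sigma_finiteT (@lebesgue_measure R).
have /sigma_finiteP[G [TG ndG Goo]] := sigma_finiteT mu.
exists (fun k => [set x : 'rV[R]_n.+1 |
    F k (x ord0 ord0) /\ G k (\row_i x ord0 (lift ord0 i))]).
  rewrite predeqE => x; split=> // _.
  have [k _ Fk] : (\bigcup_i F i) (x ord0 ord0) by rewrite -TF.
  have [l _ Gl] : (\bigcup_i G i) (\row_i x ord0 (lift ord0 i)) by rewrite -TG.
  exists (maxn k l) => //; split.
  - by move: Fk; exact/subsetPset/ndF/leq_maxl.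
  - by move: Gl; exact/subsetPset/ndG/leq_maxr.
move=> k; have [? ?] := Foo k; have [? ?] := Goo k.
split; first exact: measurable_box.
by rewrite lebesgue_rV_stepE// lte_mul_pinfty// ge0_fin_numE.
Qed.

HB.instance Definition _ := @Measure_isSigmaFinite.Build _ _ _
  lebesgue_rV_step step_sigma_finite.

End step.

(* Lebesgue measure on R^n (the n-fold product of lebesgue_measure), with the
   point mass on the one-point space R^0. *)
Fixpoint lebesgue_rV (n : nat) : {sigma_finite_measure set 'rV[R]_n -> \bar R} :=
  if n is k.+1 then lebesgue_rV_step (lebesgue_rV k) else \d_(0%R : 'rV[R]_0).

Lemma lebesgue_rV_box n (A : 'I_n -> set R) : (forall i, measurable (A i)) ->
  measurable [set x : 'rV[R]_n | forall i, A i (x ord0 i)] /\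
  lebesgue_rV n [set x | forall i, A i (x ord0 i)] =
  \prod_(i < n) lebesgue_measure (A i).
Proof.
elim: n A => [|n IH] A mA.
  split; last by rewrite big_ord0 /= diracE mem_set// => -[].
  rewrite (_ : [set _ | _] = setT); first exact: measurableT.
  by apply/seteqP; split=> // x _ [].
have [mB IHB] := IH (fun i => A (lift ord0 i)) (fun i => mA _).
split.
  rewrite (_ : [set _ | _] =
      \bigcap_(i in [set: 'I_n.+1]) (@rV_coord R n.+1 i @^-1` A i)).
    apply: fin_bigcap_measurable => // i _.
    by rewrite -[X in measurable X]setTI; exact: measurable_rV_coord.
  by apply/seteqP; split=> x Ax i => [_|]; exact: Ax.
rewrite big_ord_recl -IHB -lebesgue_rV_stepE//=; congr (lebesgue_rV_step _ _).
apply/seteqP; split=> x /=.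
  by move=> Ax; split=> [|i]; rewrite ?mxE; exact: Ax.
move=> [A0 AS] i; case: (unliftP ord0 i) => [j|] -> //.
by have := AS j; rewrite mxE.
Qed.

End lebesgue_rV.

Section fractional_pq.
Context (R : realType) (N : nat).
Implicit Types (s m alpha : R) (u v f phi : 'rV[R]_N -> R).

Local Notation leb := (lebesgue_rV R N).

(* The library norm on 'rV[R]_N is the sup norm. *)
Definition enorm (x : 'rV[R]_N) : R := Num.sqrt (\sum_i x ord0 i ^+ 2).

Definition critical_exponent s m : R := N%:R * m / (N%:R - s * m).

(* In the integrals below the integrand takes the value 0 on the diagonal
   z.1 = z.2, a null set. *)
Definition gagliardo s m u : \bar R :=
  (\int[leb \x leb]_z
    (`|u z.1 - u z.2| `^ m / enorm (z.1 - z.2) `^ (N%:R + s * m))%:E)%E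
  `^ m^-1.

Definition spaceD s m : set ('rV[R]_N -> R) :=
  [set u | u \in Lfun leb (critical_exponent s m)%:E /\
           (gagliardo s m u < +oo)%E].

Definition Jfun m (t : R) : R := `|t| `^ (m - 2) * t.

Definition weak_form s m u phi : \bar R :=
  (\int[leb \x leb]_z
    (Jfun m (u z.1 - u z.2) * (phi z.1 - phi z.2) /
     enorm (z.1 - z.2) `^ (N%:R + s * m))%:E)%E.

Definition spaceW s p q := spaceD s p `&` spaceD s q.

Definition weak_solution s p q f u : Prop :=
  [/\ spaceW s p q u,
      {ae leb, forall x, 0 <= u x} &
      forall phi, spaceW s p q phi ->
        (weak_form s p u phi + weak_form s q u phi)%E =
        (\int[leb]_x (f x * phi x)%:E)%E].

Definition Linfty_loc : set ('rV[R]_N -> R) :=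
  [set f | forall K : set 'rV[R]_N, compact K -> f \* \1_K \in Lfun leb +oo%E].

Definition holder_loc alpha : set ('rV[R]_N -> R) :=
  [set u | exists2 v : 'rV[R]_N -> R, {ae leb, forall x, u x = v x} &
     forall K : set 'rV[R]_N, compact K ->
       (exists M : R, forall x, K x -> `|v x| <= M) /\
       (exists C : R, forall x y, K x -> K y -> x != y ->
          `|v x - v y| / enorm (x - y) `^ alpha <= C)].

End fractional_pq.

(* Main.v *)
(* Boundedness: testing the equation with min((u-l)+, h-l), 0 < l < h, and
   bounding the form below by the interaction of {u > h} with the complement of
   {u > l}, where the kernel integrates to at least c |{u > l}|^(-sp/N), gives
     (h-l)^(p-1) |{u > h}| <= C |{u > l}|^(1 + sp/N - 1/theta).
   The exponent exceeds 1 because theta > N/(sp), so |{u > h}| vanishes for some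
   finite h by Stampacchia's iteration.

   Hölder regularity: let v solve the equation with a small right-hand side, lie
   below S on a ball around x0 and be at most S - om/2 on half of an annulus Q.
   Test with (v - P)+, where P = S - g + g |x - x0|^2 / r^2 with g a small multiple
   of om.  At short range v may be replaced by P by monotonicity of J_m, and
   pairing the points y and 2x - y cancels the singular part of the kernel since
   q > 2; at long range the half of Q where v is small contributes a positive
   multiple of om^(m-1), which dominates all other terms.  Hence (v - P)+ = 0, so
   the supremum drops by a fixed fraction of om near x0.  At every scale u or -u
   is in this situation, so oscillations decay geometrically. *)

Require Import Defs.
From mathcomp Require Import all_boot all_order all_algebra.
From mathcomp Require Import all_classical all_reals all_analysis.
From mathcomp Require Import measurable_realfun ess_sup_inf ring lra.
Import Order.TTheory GRing.Theory Num.Theory.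
Import numFieldNormedType.Exports.
Set Implicit Arguments.
Unset Strict Implicit.
Unset Printing Implicit Defensive.
Local Open Scope classical_set_scope.
Local Open Scope ring_scope.

(** * Geometry of the sup norm and of the Euclidean norm *)

Section geometry.
Context (R : realType) (N : nat).
Local Notation X := 'rV[R]_N.
Local Notation leb := (lebesgue_rV R N).
Implicit Types (x y c : X) (r : R).

(** The two operators scale differently, so the equation has no invariant rescaling. The q-form,
    tested with the same function, has a nonnegative lower bound and is dropped, in the level-set
    estimate as well as in the growth lemma, so only the p-form is played against [f]. For the
    Hölder part q constrains just the tail exponent, by eta (p - 1) <= s q / 2, and the smallness of
    the factor ga in g = ga om.

    The pairing of y with 2x - y is forced: J_m of a Lipschitz increment times the kernel is of size
    |x - y|^(m - 1 - sm - N), which is not integrable when s >= 1 - 1/m. The pairing gains one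
    power, and m - sm > 0 then suffices.

    Two norms coexist. Balls are taken in the sup norm, where their measure is an explicit product;
    the kernel and the parabola use the Euclidean norm, whose parallelogram law makes the second
    difference of P depend on |x - y| alone.

    Solutions are known only almost everywhere, so null sets are corrected before a pointwise lemma
    is applied, and the continuous representative is rebuilt from the oscillation estimates. *)

Lemma rV_norm_ltP x r : 0 < r -> reflect (forall i, `|x ord0 i| < r) (`|x| < r).
Proof.
move=> r0; rewrite -[`|x|]/(mx_norm x) mx_normrE; apply: (iffP idP) => [/bigmax_ltP[_ h] i|h].
  exact: (h (ord0, i)).
by apply/bigmax_ltP; split=> // -[i j] _ /=; rewrite (ord1 i).
Qed.

Lemma rV_norm_coord x i : `|x ord0 i| <= `|x|.
Proof.
rewrite leNgt; apply/negP => h.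
have := rV_norm_ltP x (le_lt_trans (normr_ge0 _) h).
by move/elimT => /(_ h i); rewrite ltxx.
Qed.

Lemma rV_ballE c r : 0 < r ->
  [set y : X | `|y - c| < r] =
  [set y : X | forall i, `]c ord0 i - r, c ord0 i + r[%classic (y ord0 i)].
Proof.
move=> r0; apply/seteqP; split=> y /= h.
  by move=> i; move/(rV_norm_ltP _ r0): h => /(_ i); rewrite !mxE ltr_distl in_itv.
by apply/(rV_norm_ltP _ r0) => i; rewrite !mxE ltr_distl; have := h i; rewrite in_itv.
Qed.

Lemma rV_ball0 c r : r <= 0 -> [set y : X | `|y - c| < r] = set0.
Proof.
move=> r0; apply/seteqP; split=> y //= h.
by move: (lt_le_trans h r0); rewrite normr_lt0.
Qed.

Lemma measurable_rV_ball c r : measurable [set y : X | `|y - c| < r].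
Proof.
have [r0|r0] := leP r 0; first by rewrite rV_ball0.
rewrite (rV_ballE _ r0).
exact: (lebesgue_rV_box (fun i => measurable_itv `]c ord0 i - r, c ord0 i + r[)).1.
Qed.

Lemma lebesgue_rV_ball c r : 0 < r ->
  leb [set y : X | `|y - c| < r] = ((r *+ 2) ^+ N)%:E.
Proof.
move=> r0; rewrite (rV_ballE _ r0).
rewrite (lebesgue_rV_box (fun i => measurable_itv `]c ord0 i - r, c ord0 i + r[)).2.
rewrite -[in RHS](card_ord N) -prodr_const -prodEFin; apply: eq_bigr => i _.
rewrite lebesgue_measure_itv/= lte_fin ltrD2l -subr_gt0 opprK addr_gt0//.
by rewrite -EFinB; congr EFin; rewrite mulr2n; ring.
Qed.

Lemma enorm_ge0 x : 0 <= enorm x. Proof. exact: sqrtr_ge0. Qed.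

Lemma enorm_sqr x : enorm x ^+ 2 = \sum_i x ord0 i ^+ 2.
Proof. by rewrite sqr_sqrtr// sumr_ge0// => i _; exact: sqr_ge0. Qed.

Lemma enormN x : enorm (- x) = enorm x.
Proof. by congr Num.sqrt; apply: eq_bigr => i _; rewrite mxE sqrrN. Qed.

Lemma enorm_le x : enorm x <= N%:R * `|x|.
Proof.
rewrite -(@ler_pXn2r _ 2)// ?nnegrE ?enorm_ge0 ?mulr_ge0// enorm_sqr.
have -> : (N%:R * `|x|) ^+ 2 = \sum_(i < N) (N%:R * `|x| ^+ 2) :> R.
  by rewrite sumr_const card_ord -[RHS]mulr_natl; ring.
apply: ler_sum => i _; rewrite -real_normK ?num_real//.
have N1 : (1 <= N)%N by case: N i {x} => [[]|].
have h : `|x ord0 i| ^+ 2 <= `|x| ^+ 2.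
  by rewrite ler_pXn2r ?nnegrE//; exact: rV_norm_coord.
by rewrite (le_trans h)// ler_peMl ?sqr_ge0// ler1n.
Qed.

Lemma le_enorm x : `|x| <= enorm x.
Proof.
rewrite leNgt; apply/negP => h; have x0 := le_lt_trans (enorm_ge0 x) h.
have [|[i j] /= e] := @mx_norm_neq0 _ _ _ x; first by rewrite gt_eqF.
suff : `|x| <= enorm x by rewrite leNgt h.
rewrite [leLHS]e (ord1 i) -sqrtr_sqr ler_wsqrtr// (bigD1 j)//= lerDl sumr_ge0// => k _.
exact: sqr_ge0.
Qed.

Lemma measurable_coordB d (T : measurableType d) (f g : T -> X) i :
  measurable_fun [set: T] f -> measurable_fun [set: T] g ->
  measurable_fun [set: T] (fun z => (f z - g z) ord0 i).
Proof.
move=> mf mg.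
rewrite (_ : (fun _ => _) = (@rV_coord R N i \o f) \- (@rV_coord R N i \o g)); last first.
  by apply/funext => z; rewrite /rV_coord /= !mxE.
by apply: measurable_funB; apply: measurableT_comp => //; exact: measurable_rV_coord.
Qed.

Lemma measurable_rVB d (T : measurableType d) (f g : T -> X) :
  measurable_fun [set: T] f -> measurable_fun [set: T] g ->
  measurable_fun [set: T] (fun z => f z - g z).
Proof. by move=> mf mg; apply: measurable_fun_rVP => i; exact: measurable_coordB. Qed.

Lemma measurable_enorm : measurable_fun [set: X] (@enorm R N).
Proof.
rewrite /enorm.
apply: (@measurableT_comp _ _ _ _ _ _ (@Num.sqrt R)).
  by apply: continuous_measurable_fun; exact: sqrt_continuous.
apply: measurable_sum => i; apply: measurable_funX; exact: measurable_rV_coord.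
Qed.

Lemma measurable_rV_norm : measurable_fun [set: X] (fun x => `|x| : R).
Proof.
apply: (measurability _ (RGenInftyO.measurableE R)) => _ [_ [r ->] <-].
rewrite setTI (_ : _ @^-1` _ = [set y : X | `|y - 0| < r]); last first.
  by apply/seteqP; split=> y /=; rewrite in_itv/= subr0.
exact: measurable_rV_ball.
Qed.

Lemma measurable_rV_dist : measurable_fun [set: X * X] (fun z => `|z.1 - z.2| : R).
Proof.
apply: (measurableT_comp measurable_rV_norm).
exact: measurable_rVB.
Qed.

Lemma measurable_rV_edist : measurable_fun [set: X * X] (fun z => enorm (z.1 - z.2)).
Proof.
apply: (measurableT_comp measurable_enorm).
exact: measurable_rVB.
Qed.

End geometry.

(** * Reflections of Lebesgue measure *)

Lemma lebesgue_measure_reflect (R : realType) (a : R) (A : set R) : measurable A ->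
  lebesgue_measure ((fun t : R => a - t) @^-1` A) = lebesgue_measure A.
Proof.
have ma : measurable_fun setT ((fun t : R => a - t) : _ -> measurableTypeR R).
  by apply: measurable_realfun.measurable_funB.
move=> mA; apply/esym.
rewrite -[RHS]/(pushforward lebesgue_measure ((fun t : R => a - t) : _ -> measurableTypeR R) A).
apply: lebesgue_measure_unique => //= _ [[b c]] _ <-.
rewrite /pushforward/= (_ : _ @^-1` _ = `[a - c, a - b[%classic); last first.
  by apply/seteqP; split=> t /=; rewrite !in_itv/= => /andP[? ?]; apply/andP; split; lra.
rewrite !lebesgue_measure_itv/= !lte_fin ltrD2l ltrN2; case: ifP => // _.
by rewrite -!EFinB; congr EFin; ring.
Qed.

Section reflection.
Context (R : realType) (N : nat).
Local Notation X := 'rV[R]_N.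
Local Notation leb := (lebesgue_rV R N).

Lemma measurable_reflect (c : X) : measurable_fun [set: X] (fun y => c - y).
Proof. by apply: measurable_rVB => //; exact: measurable_cst. Qed.

Let boxes := [set B : set X | exists2 A : 'I_N -> set R,
  forall i, measurable (A i) & B = [set x | forall i, A i (x ord0 i)]].

Let boxes_measurable : boxes `<=` measurable.
Proof. by move=> _ [A mA ->]; have [] := lebesgue_rV_box mA. Qed.

Let measurable_boxes : @measurable _ X `<=` <<s boxes >>.
Proof.
apply: smallest_sub; first exact: smallest_sigma_algebra.
apply: (@subset_trans _ boxes); last exact: sub_sigma_algebra.
rewrite -bigcup_seq/=; apply: bigcup_sub => i _ _ [B mB <-].
exists (fun j => if j == i then B else setT).
  by move=> j; case: ifP.
rewrite setTI; apply/seteqP; split=> x /=.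
  by move=> Bx j; case: ifPn => // /eqP ->.
by move/(_ i); rewrite eqxx.
Qed.

(** Boxes form an intersection-stable generating class on which the measure factors, so the
    one-dimensional reflection suffices; the centred balls [g] give the exhaustion by sets of finite
    measure. *)
Lemma lebesgue_reflect (c : X) A : measurable A ->
  leb ((fun y => c - y) @^-1` A) = leb A.
Proof.
move=> mA; rewrite -[LHS]/(pushforward leb (fun y => c - y) A).
pose g (n : nat) := [set y : X | `|y - 0| < n.+1%:R :> R].
apply: (@g_sigma_algebra_measure_unique _ _ _ boxes _ g) => //.
- by move=> n; exists (fun i => `](0 : X) ord0 i - n.+1%:R, (0 : X) ord0 i + n.+1%:R[%classic) => //; rewrite /g rV_ballE.
- apply/seteqP; split=> // x _; exists (Num.truncn `|x|) => //.
  by rewrite /g /= subr0 Num.Theory.truncnS_gt.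
- exact: measurable_reflect.
- move=> _ _ [A1 mA1 ->] [A2 mA2 ->]; exists (fun i => A1 i `&` A2 i).
    by move=> i; exact: measurableI.
  apply/seteqP; split=> x /=; first by move=> [h1 h2] i.
  by move=> h; split=> i; have [] := h i.
- move=> ? _ [B mB ->].
  transitivity (leb [set x | forall i, ((fun t => c ord0 i - t) @^-1` B i) (x ord0 i)]).
    apply: (congr1 leb).
    by apply/seteqP; split=> x /= h i; have := h i; rewrite !mxE.
  have mB' i : measurable ((fun t => c ord0 i - t) @^-1` B i).
    rewrite -[X in measurable X]setTI.
    by apply: measurable_funB => //.
  apply: etrans (lebesgue_rV_box mB').2 _.
  apply: etrans (esym (lebesgue_rV_box mB).2).
  by apply: eq_bigr => i _; exact: lebesgue_measure_reflect.
- move=> ? k; apply: (@le_lt_trans _ _ (leb [set y : X | `|y - c| < k.+1%:R])).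
    rewrite le_eqVlt; apply/orP; left; apply/eqP; apply: (congr1 leb).
    by apply/seteqP; split=> y; rewrite /g/= subr0 distrC.
  by rewrite lebesgue_rV_ball// ltry.
- exact: measurable_boxes.
Qed.

Local Open Scope ereal_scope.

(** Stated for signed integrable functions because it is applied, with [c = x + x], to the
    short-range interaction, which has no sign. *)
Lemma integral_reflect (c : X) (f : X -> \bar R) : leb.-integrable [set: X] f ->
  leb.-integrable [set: X] (f \o (fun y => c - y)%R) /\
  \int[leb]_y f (c - y)%R = \int[leb]_y f y.
Proof.
move=> /integrableP[mf intf].
have E (g : X -> \bar R) : measurable_fun setT g -> (forall x, 0 <= g x) ->
    \int[leb]_y g (c - y)%R = \int[leb]_y g y.
  move=> mg g0; rewrite -[LHS]/(\int[leb]_(y in (fun y => c - y)%R @^-1` setT) (g \o (fun y => c - y)%R) y).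
  rewrite -ge0_integral_pushforward//; last exact: measurable_reflect.
  apply: eq_measure_integral => //; first exact: measurable_reflect.
  by move=> ? A mA _; exact: lebesgue_reflect.
have int2 : leb.-integrable [set: X] (f \o (fun y => c - y)%R).
  apply/integrableP; split; first exact: (measurableT_comp mf (measurable_reflect c)).
  by rewrite (E (fun y => `|f y|))//; exact: measurableT_comp.
split=> //.
rewrite [LHS]integralE [RHS]integralE.
under [X in X - _ = _]eq_integral do rewrite funepos_comp/=.
under [X in _ - X = _]eq_integral do rewrite funeneg_comp/=.
congr (_ - _); apply: (E _) => //; [exact: measurable_funepos|exact: measurable_funeneg].
Qed.
End reflection.

(** * Integrals over dyadic shells *)

Section shells.
Context (R : realType) (N : nat).
Local Notation X := 'rV[R]_N.
Local Notation leb := (lebesgue_rV R N).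

Lemma measurable_rV_distr (c : X) : measurable_fun [set: X] (fun y => `|c - y| : R).
Proof. by apply: (measurableT_comp (@measurable_rV_norm R N)); apply: measurable_rVB. Qed.

(** The function is dominated by the sum over k of [b k] times the indicator of the ball of radius
    [rho k]. The balls may overlap, since only a geometric upper bound is wanted. *)
Lemma integral_shells (c : X) (f : X -> R) (rho b : nat -> R) (A th : R) :
  measurable_fun setT f -> (forall y, 0 <= f y) -> (forall k, 0 < rho k) ->
  (forall k, 0 <= b k) -> 0 <= A -> 0 < th < 1 ->
  (forall y, f y = 0 \/ exists k, `|c - y| < rho k /\ f y <= b k) ->
  (forall k, b k * (rho k *+ 2) ^+ N <= A * th ^+ k) ->
  (\int[leb]_y (f y)%:E <= (A / (1 - th))%:E)%E.
Proof.
move=> mf f0 rho0 b0 A0 /andP[th0 th1] hf hb.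
pose B k := [set y : X | `|y - c| < rho k].
have mB k : measurable (B k) by exact: measurable_rV_ball.
have g0 k y : (0%:E <= (b k * \1_(B k) y)%:E)%E.
  by rewrite lee_fin mulr_ge0.
have mg k : measurable_fun setT (fun y => (b k * \1_(B k) y)%:E).
  by apply/measurable_EFinP; apply: measurable_funM => //; exact: measurable_indic.
apply: (@le_trans _ _ (\int[leb]_y \sum_(0 <= k <oo) (b k * \1_(B k) y)%:E)%E).
  apply: ge0_le_integral => //.
  - by move=> y _; rewrite lee_fin.
  - exact/measurable_EFinP.
  - by apply: ge0_emeasurable_sum => // k y _ _; exact: g0.
  move=> y _; have [->|[k [yk fk]]] := hf y; first exact: nneseries_ge0.
  apply: (@le_trans _ _ (\sum_(0 <= i < k.+1) (b i * \1_(B i) y)%:E)%E); last first.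
    by apply: nneseries_lim_ge.
  rewrite big_nat_recr//= -[leLHS]add0e leeD//; first by apply: sume_ge0.
  by rewrite lee_fin indicE mem_set ?mulr1//= /B/= distrC.
rewrite integral_nneseries//.
apply: (@le_trans _ _ (\sum_(0 <= k <oo) (A * th ^+ k)%:E)%E).
  apply: lee_nneseries => [k _ _|k _]; first exact: integral_ge0.
  under eq_integral do rewrite EFinM.
  rewrite ge0_integralZl_EFin//; last first.
    by apply/measurable_EFinP; exact: measurable_indic.
  rewrite integral_indic// setIT.
  rewrite [X in (_ * X)%E](_ : _ = ((rho k *+ 2) ^+ N)%:E); last exact: lebesgue_rV_ball.
  by rewrite -EFinM lee_fin.
apply: lime_le; first by apply: is_cvg_nneseries => k _ _; rewrite lee_fin mulr_ge0// exprn_ge0// ltW.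
apply: nearW => n; rewrite sumEFin lee_fin.
have := @geometric_le_lim R n A th A0 th0; rewrite ger0_norm ?(ltW th0)// => /(_ th1).
by rewrite /series/=.
Qed.

Lemma dyadic_bracket (t : R) : 1 <= t -> exists k, 2 ^+ k <= t < 2 ^+ k.+1.
Proof.
move=> t1.
have ex : exists n, t < 2 ^+ n.
  exists (Num.truncn t).+1; apply: lt_le_trans (truncnS_gt t) _.
  by rewrite -natrX ler_nat ltnW// ltn_expl.
case: (ex_minnP ex) => -[|n] tn nmin; first by move: tn; rewrite expr0 ltNge t1.
exists n; rewrite tn andbT leNgt; apply/negP => /nmin; by rewrite ltnn.
Qed.

Lemma powR_exprn (x a : R) k : 0 <= x -> (x ^+ k) `^ a = (x `^ a) ^+ k.
Proof.
move=> x0; rewrite -(powR_mulrn k x0) -(powR_mulrn k (powR_ge0 x a)).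
by rewrite -2!powRrM mulrC.
Qed.

Lemma pow2N_lt1 (a : R) : 0 < a -> 0 < (2 : R) `^ (- a) < 1.
Proof.
move=> a0; rewrite powR_gt0//= powRN invf_lt1 ?powR_gt0//.
have e : 1 `^ a = 1 :> R by rewrite powR1.
by rewrite -[ltLHS]e gt0_ltr_powR ?nnegrE ?ltr1n.
Qed.

Lemma measurable_natb d (T : measurableType d) (b : T -> bool) :
  measurable_fun setT b -> measurable_fun setT (fun x => (b x)%:R : R).
Proof.
move=> mb; rewrite (_ : (fun _ => _) = (fun x => if b x then 1 else 0 : R)).
  by apply: measurable_fun_ifT.
by apply/funext => x; case: (b x).
Qed.

Lemma measurable_powR_comp d (T : measurableType d) (f : T -> R) (p : R) :
  measurable_fun setT f -> measurable_fun setT (fun x => f x `^ p).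
Proof. by move=> mf; exact: (measurableT_comp (measurable_powR p) mf). Qed.

(** On the shell of inner radius 2^k rho the enclosing cube has side 4 times that radius, whence the
    factor 4^N and the ratio 2^(-a). *)
Lemma integral_far (a rho : R) (c : X) : 0 < a -> 0 < rho ->
  (\int[leb]_y ((rho <= `|c - y|)%R%:R * `|c - y| `^ (- (N%:R + a)))%:E
    <= (4 ^+ N * rho `^ (- a) / (1 - 2 `^ (- a)))%:E)%E.
Proof.
move=> a0 r0.
have s0 k : 0 < 2 ^+ k * rho by rewrite mulr_gt0// exprn_gt0.
apply: (@integral_shells c _ (fun k => 2 ^+ k.+1 * rho)
   (fun k => (2 ^+ k * rho) `^ (- (N%:R + a)))) => //.
- apply: measurable_funM.
    by apply: measurable_natb; apply: measurable_fun_ler => //; exact: measurable_rV_distr.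
  by apply: measurable_powR_comp; exact: measurable_rV_distr.
- by move=> k; exact: powR_ge0.
- by rewrite mulr_ge0 ?powR_ge0// exprn_ge0.
- exact: pow2N_lt1.
- move=> y; have [h|h] := leP rho `|c - y|; last by left; rewrite mul0r.
  right; have [|k /andP[k1 k2]] := @dyadic_bracket (`|c - y| / rho).
    by rewrite ler_pdivlMr ?mul1r.
  rewrite ler_pdivlMr// in k1; rewrite ltr_pdivrMr// in k2; exists k; split => //.
  rewrite mul1r !powRN lef_pV2 ?posrE ?powR_gt0 ?(lt_le_trans (s0 k) k1)//.
  by rewrite ge0_ler_powR ?nnegrE ?addr_ge0 ?(ltW a0)// ltW.
- move=> k; rewrite opprD powRD; last by rewrite (gt_eqF (s0 k)) implybT.
  rewrite [X in X * _ * _]powRN powR_mulrn ?(ltW (s0 k))// powRM ?exprn_ge0 ?(ltW r0)// powR_exprn//.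
  have -> : 2 ^+ k.+1 * rho *+ 2 = 4 * (2 ^+ k * rho) by rewrite exprS -mulr_natr; ring.
  rewrite [in (4 * _) ^+ N]exprMn le_eqVlt; apply/orP; left; apply/eqP.
  have : (2 ^+ k * rho) ^+ N != 0 by rewrite expf_neq0// gt_eqF.
  move: ((_ * _) ^+ N) => t t0; move: (_ ^+ k) (4 ^+ N) => e f.
  by field.
Qed.

(** The shells now shrink towards [c]. The enclosing ball gets twice the outer radius to make the
    inclusion strict, so its side is 8 times the inner radius, whence 8^N. *)
Lemma integral_near (a rho : R) (c : X) : 0 < a -> 0 < rho ->
  (\int[leb]_y ((`|c - y| < rho)%R%:R * (`|c - y| `^ a * `|c - y| `^ (- N%:R)))%:E
    <= (8 ^+ N * rho `^ a / (1 - 2 `^ (- a)))%:E)%E.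
Proof.
move=> a0 r0.
have s0 k : 0 < 2 ^- k * rho by rewrite mulr_gt0// invr_gt0 exprn_gt0.
apply: (@integral_shells c _ (fun k => 2 ^- k * rho * 2)
   (fun k => (2 ^- k * rho) `^ a * (2 ^- k.+1 * rho) ^- N)) => //.
- apply: measurable_funM.
    by apply: measurable_natb; apply: measurable_fun_ltr => //; exact: measurable_rV_distr.
  by apply: measurable_funM; apply: measurable_powR_comp; exact: measurable_rV_distr.
- by move=> k; rewrite mulr_gt0.
- by move=> k; rewrite mulr_ge0 ?powR_ge0// invr_ge0 exprn_ge0// ltW.
- by rewrite mulr_ge0 ?powR_ge0// exprn_ge0.
- exact: pow2N_lt1.
- move=> y; have [h|h] := ltP `|c - y| rho; last by left; rewrite mul0r.
  (* At [y = c] the integrand is 0, because [powR] sends 0 to 0 at the nonzero exponent [a]. *)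
  have [e|e] := eqVneq `|c - y| 0; first by left; rewrite e powR0 ?gt_eqF// mul0r mulr0.
  have d0 : 0 < `|c - y| by rewrite lt_neqAle eq_sym e normr_ge0.
  right; have [|k /andP[k1 k2]] := @dyadic_bracket (rho / `|c - y|).
    by rewrite ler_pdivlMr ?mul1r// ltW.
  rewrite ler_pdivlMr// in k1; rewrite ltr_pdivrMr// in k2.
  have k1' : `|c - y| <= 2 ^- k * rho.
    by rewrite mulrC ler_pdivlMr ?exprn_gt0// mulrC.
  have k2' : 2 ^- k.+1 * rho < `|c - y|.
    by rewrite mulrC ltr_pdivrMr ?exprn_gt0// mulrC.
  exists k; split; first by rewrite (le_lt_trans k1')// ltr_pMr// ltr1n.
  rewrite mul1r ler_pM ?powR_ge0// ?ge0_ler_powR ?nnegrE ?(ltW a0) ?(ltW (s0 _))//.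
  rewrite powRN powR_mulrn// lef_pV2 ?posrE ?exprn_gt0//.
  by rewrite lerXn2r ?nnegrE// ltW.
- move=> k; rewrite powRM ?invr_ge0 ?exprn_ge0 ?(ltW r0)//.
  have -> : (2 ^- k) `^ a = (2 `^ (- a)) ^+ k :> R.
    by rewrite -powR_exprn// -powR_inv1 ?exprn_ge0// -powRrM mulN1r.
  have -> : 2 ^- k * rho * 2 *+ 2 = 8 * (2 ^- k.+1 * rho).
    by rewrite exprS invfM -mulr_natr; field; rewrite expf_neq0.
  rewrite [in (8 * _) ^+ N]exprMn le_eqVlt; apply/orP; left; apply/eqP.
  have : (2 ^- k.+1 * rho) ^+ N != 0 by rewrite expf_neq0// gt_eqF.
  move: ((_ * _) ^+ N) => t t0; move: (_ ^+ k) (8 ^+ N) => e f.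
  by field.
Qed.
End shells.

(** * Fractional spaces *)

Section spaces.
Context (R : realType) (N : nat).
Local Notation X := 'rV[R]_N.
Local Notation leb := (lebesgue_rV R N).
Implicit Types (a m s : R) (u v phi : X -> R).

(** The parameter [a] stands for [s * m]. With a nonzero exponent [powR] gives 0 at the origin,
    which agrees with the convention on the diagonal. *)
Definition kern a (x : X) : R := enorm x `^ (- (N%:R + a)).

(** At [a = s * m] this is the m-th power of the Gagliardo seminorm. *)
Definition energy a m u : \bar R :=
  (\int[leb \x leb]_z (`|u z.1 - u z.2| `^ m * kern a (z.1 - z.2))%:E)%E.

Lemma kern_ge0 a x : 0 <= kern a x. Proof. exact: powR_ge0. Qed.

Lemma kernN a x : kern a (- x) = kern a x.
Proof. by rewrite /kern enormN. Qed.

Lemma kernC a x y : kern a (x - y) = kern a (y - x).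
Proof. by rewrite -kernN opprB. Qed.

Lemma measurable_kern a : measurable_fun [set: X * X] (fun z => kern a (z.1 - z.2)).
Proof. by apply: measurable_powR_comp; exact: measurable_rV_edist. Qed.

Lemma kern_le a x : 0 < a -> kern a x <= `|x| `^ (- (N%:R + a)).
Proof.
move=> a0; have [->|x0] := eqVneq x 0.
  rewrite /kern (_ : enorm 0 = 0) ?normr0//.
  rewrite /enorm (eq_bigr (fun=> 0)) ?big1 ?sqrtr0// => i _.
  by rewrite mxE expr0n.
have n0 : 0 < `|x| by rewrite normr_gt0.
have e0 := lt_le_trans n0 (le_enorm x).
rewrite /kern !powRN lef_pV2 ?posrE ?powR_gt0//.
by rewrite ge0_ler_powR ?nnegrE ?addr_ge0 ?(ltW a0) ?(ltW n0) ?(ltW e0) ?le_enorm.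
Qed.

Lemma kern_ge a x (D : R) : 0 < a -> 0 < `|x| -> `|x| <= D ->
  (N%:R * D) `^ (- (N%:R + a)) <= kern a x.
Proof.
move=> a0 n0 xD; have e0 := lt_le_trans n0 (le_enorm x).
have eD : enorm x <= N%:R * D by rewrite (le_trans (enorm_le x))// ler_wpM2l.
rewrite /kern !powRN lef_pV2 ?posrE ?powR_gt0// ?(lt_le_trans e0)//.
by rewrite ge0_ler_powR ?nnegrE ?addr_ge0 ?(ltW a0) ?(ltW e0) ?(le_trans (ltW e0) eD).
Qed.

Lemma crit_gt0 s m : 0 < s -> 0 < m -> s * m < N%:R -> 0 < critical_exponent N s m.
Proof.
move=> s0 m0 smN; rewrite /critical_exponent divr_gt0 ?subr_gt0// mulr_gt0//.
by rewrite (lt_trans _ smN) ?mulr_gt0.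
Qed.

Lemma LfunrP (p : R) u : 0 < p ->
  (u \in Lfun leb p%:E) <->
  (measurable_fun setT u /\ (\int[leb]_x (`|u x| `^ p)%:E < +oo)%E).
Proof.
move=> p0; split.
  move=> /andP[]; rewrite !inE/= => mu; rewrite /finite_norm unlock/= => h.
  split=> //; apply: (@lty_poweRy _ _ p^-1); first by rewrite invr_neq0// gt_eqF.
  exact: h.
move=> [mu hu]; apply/andP; rewrite !inE; split=> //=.
by rewrite /finite_norm unlock/=; apply: poweR_lty.
Qed.

Lemma spaceDP s m u : 0 < s -> 0 < m -> s * m < N%:R ->
  spaceD s m u <->
  [/\ measurable_fun setT u,
     (\int[leb]_x (`|u x| `^ critical_exponent N s m)%:E < +oo)%E &
     (energy (s * m) m u < +oo)%E].
Proof.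
move=> s0 m0 smN; have c0 := crit_gt0 s0 m0 smN.
have E : gagliardo s m u = (energy (s * m) m u `^ m^-1)%E.
  rewrite /gagliardo /energy; congr (_ `^ _)%E; apply: eq_integral => z _.
  by rewrite /kern powRN.
split.
  move=> [/(LfunrP _ c0)[mu hu]]; rewrite E => h; split=> //.
  by apply: lty_poweRy h; rewrite invr_neq0// gt_eqF.
move=> [mu hu eu]; split; first exact/(LfunrP _ c0).
by rewrite E; exact: poweR_lty.
Qed.

Lemma measurable_fst_comp u : measurable_fun setT u ->
  measurable_fun [set: X * X] (fun z => u z.1).
Proof. by move=> mu; exact: (measurableT_comp mu measurable_fst). Qed.

Lemma measurable_snd_comp u : measurable_fun setT u ->
  measurable_fun [set: X * X] (fun z => u z.2).
Proof. by move=> mu; exact: (measurableT_comp mu measurable_snd). Qed.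

Lemma measurable_diff u : measurable_fun setT u ->
  measurable_fun [set: X * X] (fun z => u z.1 - u z.2).
Proof.
move=> mu; apply: measurable_funB; first exact: measurable_fst_comp.
exact: measurable_snd_comp.
Qed.

Lemma measurable_energy a m u : measurable_fun setT u ->
  measurable_fun [set: X * X] (fun z => `|u z.1 - u z.2| `^ m * kern a (z.1 - z.2)).
Proof.
move=> mu; apply: measurable_funM; last exact: measurable_kern.
apply: measurable_powR_comp; apply: measurableT_comp => //; exact: measurable_diff.
Qed.

(** Makes truncations and sign changes of a solution admissible as test functions. *)
Lemma spaceD_contraction s m u v : 0 < s -> 0 < m -> s * m < N%:R ->
  spaceD s m u -> measurable_fun setT v ->
  (forall x, `|v x| <= `|u x|) -> (forall x y, `|v x - v y| <= `|u x - u y|) ->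
  spaceD s m v.
Proof.
move=> s0 m0 smN /(spaceDP _ s0 m0 smN)[mu hu eu] mv vu dvu.
have c0 := crit_gt0 s0 m0 smN; apply/(spaceDP _ s0 m0 smN); split; [exact: mv| |].
  apply: le_lt_trans hu; apply: ge0_le_integral => //.
  - by apply/measurable_EFinP; apply: measurable_powR_comp; exact: measurableT_comp.
  - by apply/measurable_EFinP; apply: measurable_powR_comp; exact: measurableT_comp.
  - by move=> x _; rewrite lee_fin ge0_ler_powR ?nnegrE// ltW.
apply: le_lt_trans eu; apply: ge0_le_integral => //.
- by move=> z _; rewrite lee_fin mulr_ge0 ?powR_ge0.
- by apply/measurable_EFinP; exact: measurable_energy.
- by apply/measurable_EFinP; exact: measurable_energy.
- move=> z _; rewrite lee_fin ler_wpM2r ?kern_ge0// ge0_ler_powR ?nnegrE//.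
  exact: ltW.
Qed.

(** By Tonelli a bound on the kernel that is uniform in the centre controls the double integral.
    Both placements of the weight occur, since a test function enters through [phi z.1] and through
    [phi z.2]. *)
Lemma integral_convolution (b : X -> R) (h : R -> R) (K L : R) :
  measurable_fun setT b -> measurable_fun setT h ->
  (forall x, 0 <= b x) -> (forall t, 0 <= h t) -> 0 <= K ->
  (forall c : X, (\int[leb]_y (h `|c - y|)%:E <= K%:E)%E) ->
  (\int[leb]_x (b x)%:E <= L%:E)%E ->
  (\int[leb \x leb]_z (b z.1 * h `|z.1 - z.2|)%:E <= (L * K)%:E)%E /\
  (\int[leb \x leb]_z (b z.2 * h `|z.1 - z.2|)%:E <= (L * K)%:E)%E.
Proof.
move=> mb mh b0 h0 K0 hK bL.
have mhd : measurable_fun [set: X * X] (fun z => h `|z.1 - z.2|).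
  exact: (measurableT_comp mh (@measurable_rV_dist R N)).
have mhc c : measurable_fun [set: X] (fun y => h `|c - y|).
  exact: (measurableT_comp mh (@measurable_rV_distr R N c)).
have main : (\int[leb]_x \int[leb]_y (b x * h `|x - y|)%:E <= (L * K)%:E)%E.
  apply: (@le_trans _ _ (\int[leb]_x (K%:E * (b x)%:E))%E).
    apply: ge0_le_integral => //.
    - by move=> x _; apply: integral_ge0 => y _; rewrite lee_fin mulr_ge0.
    - apply: (@measurable_fun_fubini_tonelli_F _ _ _ _ _ leb (fun z => (b z.1 * h `|z.1 - z.2|)%:E)).
        apply/measurable_EFinP; apply: measurable_funM => //; exact: measurable_fst_comp.
      by move=> z; rewrite lee_fin mulr_ge0.
    - by apply/measurable_EFinP; apply: measurable_funM.
    - move=> x _; under eq_integral do rewrite EFinM.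
      rewrite ge0_integralZl_EFin//; [|by move=> y _; rewrite lee_fin|exact/measurable_EFinP].
      by rewrite muleC lee_wpmul2r// lee_fin.
  rewrite ge0_integralZl_EFin//; [|by move=> y _; rewrite lee_fin|exact/measurable_EFinP].
  by rewrite EFinM muleC lee_wpmul2r// lee_fin.
split.
  rewrite fubini_tonelli1//.
    apply/measurable_EFinP; apply: measurable_funM => //; exact: measurable_fst_comp.
  by move=> z; rewrite lee_fin mulr_ge0.
rewrite fubini_tonelli2; [|
  by apply/measurable_EFinP; apply: measurable_funM => //; exact: measurable_snd_comp|
  by move=> z; rewrite lee_fin mulr_ge0].
rewrite (_ : (\int[leb]_y fubini_G leb (fun z : X * X => (b z.2 * h `|z.1 - z.2|)%:E) y)%E =
  (\int[leb]_x \int[leb]_y (b x * h `|x - y|)%:E)%E); first exact: main.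
apply: eq_integral => y _; rewrite /fubini_G/=; apply: eq_integral => x _.
by rewrite distrC.
Qed.

End spaces.

(** * The map J_m *)

Section power_map.
Context (R : realType).
Implicit Types (m p a b e t x y A : R).

Lemma powR_add_le m a b : 0 < m -> 0 <= a -> 0 <= b ->
  (a + b) `^ m <= 2 `^ m * (a `^ m + b `^ m).
Proof.
move=> m0 a0 b0.
have H c d : 0 <= c -> c <= d -> (c + d) `^ m <= 2 `^ m * d `^ m.
  move=> c0 cd; have d0 := le_trans c0 cd.
  by rewrite -powRM// ge0_ler_powR ?nnegrE ?addr_ge0 ?mulr_ge0 ?(ltW m0)//; lra.
have [ab|/ltW ba] := leP a b.
  by rewrite (le_trans (H _ _ a0 ab))// ler_wpM2l ?powR_ge0// lerDr powR_ge0.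
by rewrite addrC (le_trans (H _ _ b0 ba))// ler_wpM2l ?powR_ge0// lerDl powR_ge0.
Qed.

(** A mean value bound obtained without differentiating: with t = x / y <= 1 the exponent [p] may be
    raised to the next integer n, and Bernoulli's inequality gives 1 - t^n <= n (1 - t). *)
Lemma powR_sub_le p x y : 1 <= p -> 0 <= x -> x <= y ->
  y `^ p - x `^ p <= (Num.truncn p).+1%:R * y `^ (p - 1) * (y - x).
Proof.
move=> p1 x0 xy; have p0 : 0 < p by lra.
have [y0|y0] := eqVneq y 0.
  have -> : x = 0 by lra.
  by rewrite y0 !subrr mulr0.
have yp : 0 < y by lra.
pose t := x / y; have t0 : 0 <= t by rewrite divr_ge0// ltW.
have t1 : t <= 1 by rewrite ler_pdivrMr ?mul1r.
have xE : x = t * y by rewrite divfK.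
have bern n : 1 - t ^+ n <= n%:R * (1 - t).
  elim: n => [|n IH]; first by rewrite expr0 subrr mul0r.
  have tn : t ^+ n <= 1 by rewrite exprn_ile1.
  have tn0 : 0 <= t ^+ n by rewrite exprn_ge0.
  by rewrite exprSr -natr1; nra.
have tp : t ^+ (Num.truncn p).+1 <= t `^ p.
  have [->|tn0] := eqVneq t 0; first by rewrite expr0n/= powR_ge0.
  rewrite -powR_mulrn// ger_powR// ?t1 ?andbT ?lt_neqAle 1?eq_sym ?tn0//.
  exact/ltW/truncnS_gt.
have yE : y `^ p = y `^ (p - 1) * y by rewrite mulrC mulr_powRB1// ltW.
have -> : y `^ p - x `^ p = (1 - t `^ p) * (y `^ (p - 1) * y).
  by rewrite -yE xE powRM ?(ltW yp)//; ring.
have := bern (Num.truncn p).+1; set n := _.+1 => bn.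
have z0 : 0 <= y `^ (p - 1) * y by rewrite mulr_ge0 ?powR_ge0// ltW.
have -> : n%:R * y `^ (p - 1) * (y - x) = n%:R * (1 - t) * (y `^ (p - 1) * y).
  by rewrite xE; ring.
by rewrite ler_wpM2r//; move: tp; rewrite -/n; lra.
Qed.

Lemma JfunN m t : Jfun m (- t) = - Jfun m t.
Proof. by rewrite /Jfun normrN mulrN. Qed.

Lemma Jfun_ge0E m t : 1 < m -> 0 <= t -> Jfun m t = t `^ (m - 1).
Proof.
move=> m2 t0; rewrite /Jfun ger0_norm// mulrC.
have -> : m - 2 = (m - 1) - 1 by ring.
by rewrite mulr_powRB1//; lra.
Qed.

Lemma Jfun_norm m t : 1 < m -> `|Jfun m t| = `|t| `^ (m - 1).
Proof.
move=> m2; rewrite -(Jfun_ge0E m2 (normr_ge0 t)) /Jfun normr_id normrM.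
by rewrite ger0_norm ?powR_ge0.
Qed.

Lemma Jfun_ge0 m t : 0 <= t -> 0 <= Jfun m t.
Proof. by move=> t0; rewrite mulr_ge0 ?powR_ge0. Qed.

Lemma Jfun_le m a b : 1 < m -> a <= b -> Jfun m a <= Jfun m b.
Proof.
move=> m2 ab.
have H x y : 0 <= x -> x <= y -> Jfun m x <= Jfun m y.
  move=> x0 xy; rewrite !Jfun_ge0E//; last lra.
  by rewrite ge0_ler_powR ?nnegrE//; lra.
have [a0|a0] := leP 0 a; first exact: H.
have [b0|b0] := leP 0 b.
  rewrite (@le_trans _ _ 0)// ?Jfun_ge0// -oppr_ge0 -JfunN Jfun_ge0//; lra.
by rewrite -lerN2 -!JfunN H//; lra.
Qed.

(** Coercivity for truncations: [b] will be the increment of a truncated function and [a] that of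
    the function itself, so [b] has the sign of [a] and is no larger. *)
Lemma Jfun_mul_ge m a b : 1 < m -> `|b| <= `|a| -> 0 <= a * b ->
  `|b| `^ m <= Jfun m a * b.
Proof.
move=> m2 ba ab.
have [->|b0] := eqVneq b 0; first by rewrite normr0 powR0 ?gt_eqF ?mulr0//; lra.
have bp : 0 < `|b| by rewrite normr_gt0.
have -> : Jfun m a * b = `|a| `^ (m - 1) * `|b|.
  rewrite -(Jfun_norm a m2) -normrM ger0_norm// /Jfun -mulrA mulr_ge0 ?powR_ge0//.
rewrite mulrC -(@mulr_powRB1 _ `|b|)//; last lra.
by rewrite ler_wpM2l// ge0_ler_powR ?nnegrE//; lra.
Qed.

(** The derivative of J_m is of order |t|^(m - 2), which for [2 <= m] is largest at the largest |t|.
    An increment that crosses 0 is split there; the negative side follows by oddness. *)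
Lemma Jfun_sub_le m A a e : 2 <= m -> 0 <= e -> `|a| <= A -> `|a + e| <= A ->
  Jfun m (a + e) - Jfun m a <= (Num.truncn (m - 1)).+1%:R * A `^ (m - 2) * e.
Proof.
move=> m2 e0 aA aeA; have m1 : 1 < m by lra.
have A0 : 0 <= A by exact: le_trans (normr_ge0 a) aA.
set n := _%:R; have n1 : 1 <= n by rewrite /n ler1n.
have mE : m - 2 = m - 1 - 1 by ring.
have H x y : 0 <= x -> x <= y -> y <= A -> Jfun m y - Jfun m x <= n * A `^ (m - 2) * (y - x).
  move=> x0 xy yA; rewrite !Jfun_ge0E//; last lra.
  rewrite (le_trans (powR_sub_le _ x0 xy))//; first lra.
  rewrite -/n mE ler_wpM2r ?subr_ge0// ler_wpM2l//.
  by rewrite ge0_ler_powR ?nnegrE//; lra.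
have [a0|a0] := leP 0 a.
  have aeA' : a + e <= A by move: aeA; rewrite ger0_norm//; lra.
  by have := H _ _ a0 (_ : a <= a + e) aeA'; rewrite addrAC subrr add0r; apply; lra.
have [ae0|ae0] := leP 0 (a + e).
  rewrite Jfun_ge0E// -(opprK (Jfun m a)) -JfunN Jfun_ge0E//; last lra.
  rewrite ltr0_norm// in aA; rewrite ger0_norm// in aeA.
  have B x : 0 <= x -> x <= A -> x `^ (m - 1) <= n * A `^ (m - 2) * x.
    move=> x0 xA; rewrite -(@mulr_powRB1 _ x)//; last lra.
    rewrite mulrC ler_wpM2r// -mE (@le_trans _ _ (A `^ (m - 2)))//.
      by rewrite ge0_ler_powR ?nnegrE//; lra.
    by rewrite ler_peMl ?powR_ge0.
  have -> : e = (a + e) + (- a) by ring.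
  rewrite (_ : a + (a + e - a) = a + e); last ring.
  by rewrite mulrDr opprK lerD// B//; lra.
have := H (- (a + e)) (- a); rewrite !JfunN => h.
rewrite ltr0_norm// in aA.
have -> : e = - a - (- (a + e)) by ring.
rewrite {1}(_ : a + (- a - - (a + e)) = a + e); last ring.
by rewrite (le_trans _ (h _ _ _))//; lra.
Qed.

Lemma measurable_Jfun d (T : measurableType d) m (f : T -> R) :
  measurable_fun setT f -> measurable_fun setT (fun z => Jfun m (f z)).
Proof.
move=> mf; apply: measurable_funM => //.
by apply: measurable_powR_comp; exact: measurableT_comp.
Qed.

Lemma young_powR m a b : 1 < m -> 0 <= a -> 0 <= b ->
  a `^ (m - 1) * b <= a `^ m + b `^ m.
Proof.
move=> m1 a0 b0.
have E x : 0 <= x -> x `^ m = x `^ (m - 1) * x.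
  by move=> x0; rewrite mulrC mulr_powRB1//; lra.
have [ab|/ltW ba] := leP a b.
  rewrite (@le_trans _ _ (b `^ m))//; last by rewrite lerDr powR_ge0.
  by rewrite E// ler_wpM2r// ge0_ler_powR ?nnegrE//; lra.
rewrite (@le_trans _ _ (a `^ m))//; last by rewrite lerDl powR_ge0.
by rewrite E// ler_wpM2l// powR_ge0.
Qed.

End power_map.

(** * Test functions and the weak form *)

Section real_integrals.
Context d (T : measurableType d) (R : realType) (mu : {measure set T -> \bar R}).
Implicit Types (f g : T -> R) (k : R).
Local Open Scope ereal_scope.

Lemma ge0_integral_scale k f : (0 <= k)%R -> (forall x, 0 <= f x)%R ->
  measurable_fun setT f ->
  \int[mu]_x (k * f x)%:E = k%:E * \int[mu]_x (f x)%:E.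
Proof.
move=> k0 f0 mf; under eq_integral do rewrite EFinM.
by rewrite ge0_integralZl_EFin//; [move=> x _; rewrite lee_fin|exact/measurable_EFinP].
Qed.

Lemma ge0_integral_add f g : (forall x, 0 <= f x)%R -> (forall x, 0 <= g x)%R ->
  measurable_fun setT f -> measurable_fun setT g ->
  \int[mu]_x (f x + g x)%:E = \int[mu]_x (f x)%:E + \int[mu]_x (g x)%:E.
Proof.
move=> f0 g0 mf mg; under eq_integral do rewrite EFinD.
by rewrite ge0_integralD//; [move=> x _; rewrite lee_fin|exact/measurable_EFinP|
  move=> x _; rewrite lee_fin|exact/measurable_EFinP].
Qed.

Lemma ge0_integral_le f g : (forall x, 0 <= f x)%R -> (forall x, f x <= g x)%R ->
  measurable_fun setT f -> measurable_fun setT g ->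
  \int[mu]_x (f x)%:E <= \int[mu]_x (g x)%:E.
Proof.
move=> f0 fg mf mg; apply: ge0_le_integral => //.
- by move=> x _; rewrite lee_fin.
- exact/measurable_EFinP.
- exact/measurable_EFinP.
- by move=> x _; rewrite lee_fin.
Qed.

End real_integrals.

Section spaces2.
Context (R : realType) (N : nat).
Local Notation X := 'rV[R]_N.
Local Notation leb := (lebesgue_rV R N).
Implicit Types (a m s : R) (u v phi : X -> R).

(** A pair contributes only if one of its points lies in the ball. For |x - y| < 1 the Lipschitz
    part leaves |x - y|^(m - sm - N), integrable because s < 1; for |x - y| >= 1 the bound [M]
    against the kernel suffices. The functions [h1] and [h2] collect the two regimes. *)
Lemma spaceD_bump s m v phi (x0 : X) (r M L : R) :
  0 < s < 1 -> 0 < m -> s * m < N%:R -> spaceD s m v ->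
  measurable_fun setT phi -> 0 < r -> 0 <= M -> 0 <= L ->
  (forall x, `|phi x| <= M * (`|x - x0| < r)%R%:R) ->
  (forall x y, `|x - x0| < r -> `|phi x - phi y| <= `|v x - v y| + L * `|x - y|) ->
  spaceD s m phi.
Proof.
move=> /andP[s0 s1] m0 smN /(spaceDP _ s0 m0 smN)[mv hv ev] mphi r0 M0 L0 hphi dphi.
have c0 := crit_gt0 s0 m0 smN.
pose B := [set y : X | `|y - x0| < r].
have mB : measurable B by exact: measurable_rV_ball.
have mb : measurable_fun setT (fun x : X => (`|x - x0| < r)%R%:R : R).
  apply: measurable_natb; apply: measurable_fun_ltr => //.
  by under eq_fun do rewrite distrC; exact: measurable_rV_distr.
have iB : (\int[leb]_x ((`|x - x0| < r)%R%:R)%:E <= ((r *+ 2) ^+ N)%:E)%E.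
  rewrite [leLHS](_ : _ = \int[leb]_x (\1_B x)%:E)%E; last first.
    apply: eq_integral => x _; rewrite indicE; congr EFin.
    have [h|h] := boolP (`|x - x0| < r); first by rewrite mem_set.
    by rewrite memNset//; exact/negP.
  rewrite integral_indic// setIT [leLHS](_ : _ = ((r *+ 2) ^+ N)%:E)//.
  exact: lebesgue_rV_ball.
apply/(spaceDP _ s0 m0 smN); split; [exact: mphi| |].
  apply: (@le_lt_trans _ _ (\int[leb]_x (M `^ critical_exponent N s m * (`|x - x0| < r)%R%:R)%:E)%E).
    apply: ge0_integral_le.
    - by move=> x; exact: powR_ge0.
    - move=> x; have := hphi x.
      case: ltP => h; last first.
        by rewrite !mulr0 normr_le0 => /eqP ->; rewrite normr0 powR0// gt_eqF.
      by rewrite !mulr1 => h'; rewrite ge0_ler_powR ?nnegrE// ltW.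
    - by apply: measurable_powR_comp; exact: measurableT_comp.
    - by apply: measurable_funM.
  rewrite ge0_integral_scale ?powR_ge0//.
  by rewrite lte_mul_pinfty ?lee_fin ?powR_ge0// (le_lt_trans iB)// ltry.
pose a := s * m.
have a0 : 0 < a by rewrite mulr_gt0.
have ma0 : 0 < m - a by rewrite subr_gt0 /a; nra.
pose h1 (t : R) := (t < 1)%R%:R * (t `^ (m - a) * t `^ (- N%:R)).
pose h2 (t : R) := (1 <= t)%R%:R * t `^ (- (N%:R + a)).
pose C1 := 2 `^ m * L `^ m; pose C2 := (2 * M) `^ m.
pose h t := C1 * h1 t + C2 * h2 t.
have C10 : 0 <= C1 by rewrite mulr_ge0 ?powR_ge0.
have C20 : 0 <= C2 by rewrite powR_ge0.
have h10 t : 0 <= h1 t by rewrite mulr_ge0// mulr_ge0 ?powR_ge0.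
have h20 t : 0 <= h2 t by rewrite mulr_ge0 ?powR_ge0.
have h0 t : 0 <= h t by rewrite addr_ge0// mulr_ge0.
have mh1 : measurable_fun setT h1.
  apply: measurable_funM; last by apply: measurable_funM; exact: measurable_powR.
  by apply: measurable_natb; apply: measurable_fun_ltr.
have mh2 : measurable_fun setT h2.
  apply: measurable_funM; last exact: measurable_powR.
  by apply: measurable_natb; apply: measurable_fun_ler.
have mh : measurable_fun setT h by apply: measurable_funD; apply: measurable_funM.
have [K K0 hK] : exists2 K, 0 <= K & forall c : X, (\int[leb]_y (h `|c - y|)%:E <= K%:E)%E.
  exists (C1 * (8 ^+ N * 1 `^ (m - a) / (1 - 2 `^ (- (m - a)))) +
          C2 * (4 ^+ N * 1 `^ (- a) / (1 - 2 `^ (- a)))).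
    have /andP[_ t1] := pow2N_lt1 ma0; have /andP[_ t2] := pow2N_lt1 a0.
    by rewrite addr_ge0// mulr_ge0// divr_ge0 ?subr_ge0 ?(ltW t1) ?(ltW t2)// mulr_ge0 ?powR_ge0// exprn_ge0.
  move=> c.
  have md i : measurable_fun setT i -> measurable_fun [set: X] (fun y => i `|c - y| : R).
    by move=> mi; exact: (measurableT_comp mi (measurable_rV_distr c)).
  rewrite /h ge0_integral_add; [|by move=> y; rewrite mulr_ge0|by move=> y; rewrite mulr_ge0|
    by apply: measurable_funM => //; exact: md|by apply: measurable_funM => //; exact: md].
  rewrite !ge0_integral_scale//; [|exact: md|exact: md].
  rewrite EFinD !EFinM; apply: leeD; rewrite lee_wpmul2l ?lee_fin//.
    exact: integral_near.
  exact: integral_far.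
pose b x : R := (`|x - x0| < r)%R%:R.
have [k1 k2] := integral_convolution mb mh (fun x => ler0n R _) h0 K0 hK iB.
have mphi2 := measurable_energy a m mphi.
have mv2 := measurable_energy a m mv.
have mhd : measurable_fun [set: X * X] (fun z => h `|z.1 - z.2|).
  exact: (measurableT_comp mh (@measurable_rV_dist R N)).
have mb1 : measurable_fun [set: X * X] (fun z => b z.1 * h `|z.1 - z.2|).
  by apply: measurable_funM => //; exact: (@measurable_fst_comp R N).
have mb2 : measurable_fun [set: X * X] (fun z => b z.2 * h `|z.1 - z.2|).
  by apply: measurable_funM => //; exact: (@measurable_snd_comp R N).
have b0 x : 0 <= b x by rewrite /b.
have e0 (w : X -> R) (z : X * X) : 0 <= `|w z.1 - w z.2| `^ m * kern a (z.1 - z.2).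
  by rewrite mulr_ge0 ?powR_ge0.
apply: (@le_lt_trans _ _ (\int[leb \x leb]_z (2 `^ m * (`|v z.1 - v z.2| `^ m * kern a (z.1 - z.2))
   + (b z.1 * h `|z.1 - z.2| + b z.2 * h `|z.1 - z.2|))%:E)%E).
  apply: ge0_integral_le => //; last first.
    by apply: measurable_funD; [exact: measurable_funM|exact: measurable_funD].
  - move=> [x y] /=; rewrite -mulrDl.
    have P (x' y' : X) : `|x' - x0| < r ->
        `|phi x' - phi y'| `^ m * kern a (x' - y') <=
        2 `^ m * (`|v x' - v y'| `^ m * kern a (x' - y')) + h `|x' - y'|.
      move=> hx; have k0 := kern_ge0 a (x' - y'); have kl := kern_le (x' - y') a0.
      have [d1|d1] := ltP `|x' - y'| 1.
        have -> : h `|x' - y'| = C1 * (`|x' - y'| `^ (m - a) * `|x' - y'| `^ (- N%:R)).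
          by rewrite /h /h1 /h2 d1 leNgt d1/= mul1r mul0r mulr0 addr0.
        have [e|e] := eqVneq (x' - y') 0.
          have -> : x' = y' by apply/eqP; rewrite -subr_eq0 e.
          by rewrite !subrr !normr0 powR0 ?gt_eqF// !mul0r mulr0 add0r powR0 ?gt_eqF// mul0r mulr0.
        have d0 : `|x' - y'| != 0 by rewrite normr_eq0.
        have -> : `|x' - y'| `^ (m - a) * `|x' - y'| `^ (- N%:R) =
                  `|x' - y'| `^ m * `|x' - y'| `^ (- (N%:R + a)).
          by rewrite -!powRD ?d0 ?implybT//; congr (_ `^ _); ring.
        rewrite (@le_trans _ _ (2 `^ m * (`|v x' - v y'| `^ m + (L * `|x' - y'|) `^ m) * kern a (x' - y')))//.
          rewrite ler_wpM2r// (@le_trans _ _ ((`|v x' - v y'| + L * `|x' - y'|) `^ m))//.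
            by rewrite ge0_ler_powR ?nnegrE ?addr_ge0 ?mulr_ge0 ?dphi// ltW.
          by rewrite powR_add_le// mulr_ge0.
        rewrite mulrDr mulrDl -mulrA lerD2l powRM// !mulrA ler_wpM2l//.
        by rewrite !mulr_ge0 ?powR_ge0.
      have -> : h `|x' - y'| = C2 * `|x' - y'| `^ (- (N%:R + a)).
        by rewrite /h /h1 /h2 d1 ltNge d1/= mul1r mul0r mulr0 add0r.
      rewrite -[leLHS]add0r lerD ?mulr_ge0 ?powR_ge0// ler_pM ?powR_ge0//.
      rewrite ge0_ler_powR ?nnegrE ?mulr_ge0 ?(ltW m0)// (le_trans (ler_normB _ _))//.
      have Mx w : `|phi w| <= M by rewrite (le_trans (hphi w))// ler_piMr// lern1 leq_b1.
      by rewrite mulr_natl mulr2n lerD.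
    rewrite /b; have [hx|hx] := ltP `|x - x0| r.
      rewrite (le_trans (P _ _ hx))// lerD2l ler_peMl// lerDl//.
    have [hy|hy] := ltP `|y - x0| r.
      by rewrite add0r mul1r distrC kernC (distrC (v x)) (distrC x); exact: P.
    have Z w : r <= `|w - x0| -> phi w = 0.
      by move=> hw; have := hphi w; rewrite ltNge hw mulr0 normr_le0 => /eqP.
    rewrite !Z// subrr normr0 powR0 ?gt_eqF// mul0r addr0 mul0r addr0.
    by rewrite mulr_ge0 ?mulr_ge0 ?powR_ge0.
have p20 : 0 <= 2 `^ m :> R by exact: powR_ge0.
rewrite ge0_integral_add; [|by move=> z; rewrite mulr_ge0|by move=> z; rewrite addr_ge0// mulr_ge0|
  exact: measurable_funM|exact: measurable_funD].
apply: lte_add_pinfty.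
  by rewrite ge0_integral_scale// lte_mul_pinfty.
rewrite ge0_integral_add//; [|by move=> z; rewrite mulr_ge0|by move=> z; rewrite mulr_ge0].
by apply: lte_add_pinfty; [apply: le_lt_trans k1 _|apply: le_lt_trans k2 _]; rewrite ltry.
Qed.

Lemma weak_formE s m u phi : weak_form s m u phi =
  (\int[leb \x leb]_z (Jfun m (u z.1 - u z.2) * (phi z.1 - phi z.2) *
     kern (s * m) (z.1 - z.2))%:E)%E.
Proof. by apply: eq_integral => z _; rewrite /kern powRN. Qed.

Lemma measurable_weak a m u phi : measurable_fun setT u -> measurable_fun setT phi ->
  measurable_fun [set: X * X] (fun z => Jfun m (u z.1 - u z.2) * (phi z.1 - phi z.2) *
     kern a (z.1 - z.2)).
Proof.
move=> mu mphi; apply: measurable_funM; last exact: measurable_kern.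
by apply: measurable_funM; [apply: measurable_Jfun|]; exact: measurable_diff.
Qed.

Lemma integrable_weak s m u phi : 0 < s -> 1 < m -> s * m < N%:R ->
  spaceD s m u -> spaceD s m phi ->
  (leb \x leb)%E.-integrable [set: X * X]
    (fun z => (Jfun m (u z.1 - u z.2) * (phi z.1 - phi z.2) * kern (s * m) (z.1 - z.2))%:E).
Proof.
move=> s0 m1 smN; have m0 : 0 < m by lra.
move=> /(spaceDP _ s0 m0 smN)[mu _ eu] /(spaceDP _ s0 m0 smN)[mp _ ep].
have mU := measurable_energy (s * m) m mu; have mP := measurable_energy (s * m) m mp.
apply/integrableP; split; first by apply/measurable_EFinP; exact: measurable_weak.
apply: (@le_lt_trans _ _ (energy (s * m) m u + energy (s * m) m phi)%E); last first.
  exact: (lte_add_pinfty eu ep).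
have e0 (w : X -> R) (z : X * X) : 0 <= `|w z.1 - w z.2| `^ m * kern (s * m) (z.1 - z.2).
  by rewrite mulr_ge0 ?powR_ge0.
rewrite /energy -ge0_integral_add//.
apply: ge0_le_integral => //.
- apply: measurableT_comp => //; apply/measurable_EFinP; exact: measurable_weak.
- by apply/measurable_EFinP; exact: measurable_funD.
- move=> z _; rewrite abse_EFin lee_fin -mulrDl normrM (ger0_norm (kern_ge0 _ _)).
  by rewrite ler_wpM2r ?kern_ge0// normrM Jfun_norm// young_powR.
Qed.

End spaces2.

(** * Boundedness *)

Lemma powR_invX (R : realType) (x a : R) n : 0 <= x -> (x ^- n) `^ a = (x `^ a) ^- n.
Proof.
move=> x0; rewrite -powR_inv1; last exact: exprn_ge0.
by rewrite powRAC powR_exprn// powR_inv1// exprn_ge0// powR_ge0.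
Qed.

(** Along levels [l n] with halving gaps, the superlinear power [be] compensates the factors lost in
    the gaps. The levels start at 1 rather than 0, because a superlevel set at 0 may have infinite
    measure. *)
Lemma stampacchia (R : realType) (V : R -> R) (C al be : R) :
  0 <= C -> 0 < al -> 1 < be -> (forall l, 0 <= V l) ->
  (forall l h, 0 < l -> l <= h -> V h <= V l) ->
  (forall l h, 0 < l -> l < h -> V h <= C * (h - l) `^ (- al) * V l `^ be) ->
  exists2 h, 0 < h & V h = 0.
Proof.
move=> C0 al0 be1 V0 Vd Vi.
have be0 : 0 <= be by lra.
have bep : 0 < be by lra.
have be10 : 0 < be - 1 by lra.
(* This choice gives b^(be - 1) = 2^al, so the gain from the exponent [be] exactly cancels the loss
   from a gap of size d 2^(-n-1). *)
pose tau := al / (be - 1); have t0 : 0 < tau by rewrite divr_gt0.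
pose b : R := 2 `^ tau; have b0 : 0 < b by exact: powR_gt0.
have b1 : 1 < b.
  by have /andP[_] := pow2N_lt1 t0; rewrite powRN invf_lt1.
(* [D] absorbs all remaining factors of the induction step; the summand 1 keeps it positive even if
   [C] or [V 1] vanishes. The total height [d] is fixed by d^(-al) = 1/D. *)
pose D := C * 2 `^ al * b * V 1 `^ (be - 1) + 1.
have D1 : 1 <= D by rewrite lerDr !mulr_ge0 ?powR_ge0// ltW.
have D0 : 0 < D by exact: lt_le_trans D1.
pose d := D `^ al^-1; have d0 : 0 < d by exact: powR_gt0.
have dal : d `^ (- al) = D^-1.
  by rewrite powRN /d -powRrM mulVf ?gt_eqF// powRr1// ltW.
pose l n := 1 + d * (1 - 2 ^- n).
have ln0 n : 0 < l n.
  have : 2 ^- n <= 1 :> R by rewrite invf_le1 ?exprn_gt0// exprn_ege1// ler1n.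
  by rewrite /l => h; nra.
have E : 2 `^ al = b `^ (be - 1) :> R.
  by rewrite /b -powRrM /tau divfK// gt_eqF.
have step n : V (l n) <= V 1 * b ^- n.
  elim: n => [|n IH]; first by rewrite /l !expr0 invr1 subrr mulr0 addr0 mulr1.
  have bn0 : 0 < b ^- n by rewrite invr_gt0 exprn_gt0.
  have gap : l n.+1 - l n = d * 2 ^- n.+1.
    by rewrite /l exprS; field; rewrite expf_neq0.
  have lt : l n < l n.+1 by rewrite -subr_gt0 gap mulr_gt0// invr_gt0 exprn_gt0.
  apply: (le_trans (Vi _ _ (ln0 n) lt)).
  apply: (@le_trans _ _ (C * (d * 2 ^- n.+1) `^ (- al) * (V 1 * b ^- n) `^ be)).
    have bV : 0 <= V 1 * b ^- n by rewrite mulr_ge0// ltW.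
    rewrite gap; apply: ler_wpM2l; first by rewrite mulr_ge0 ?powR_ge0.
    by apply: (ge0_ler_powR be0) => //; rewrite nnegrE.
  have -> : (d * 2 ^- n.+1) `^ (- al) = D^-1 * (2 `^ al) ^+ n.+1.
    rewrite powRM; [|exact: ltW|by rewrite invr_ge0; exact: exprn_ge0].
    rewrite dal; congr (_ * _).
    by rewrite powRN powR_invX ?ler0n// invrK.
  have -> : (V 1 * b ^- n) `^ be = V 1 * V 1 `^ (be - 1) * (b ^- n * ((2 `^ al) ^+ n)^-1).
    rewrite powRM; [|exact: V0|exact: ltW].
    rewrite -(mulr_powRB1 (V0 1) bep) -(mulr_powRB1 (ltW bn0) bep).
    by rewrite (powR_invX _ _ (ltW b0)) E.
  have a20 : 0 < 2 `^ al :> R by exact: powR_gt0.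
  have -> : C * (D^-1 * (2 `^ al) ^+ n.+1) * (V 1 * V 1 `^ (be - 1) * (b ^- n * ((2 `^ al) ^+ n)^-1))
     = V 1 * b ^- n.+1 * ((C * 2 `^ al * b * V 1 `^ (be - 1)) / D).
    rewrite !exprS; have alg (V1 C' D' b' w x y z : R) : D' != 0 -> b' != 0 -> x != 0 -> z != 0 ->
        C' * (D'^-1 * (y * z)) * (V1 * w * (x^-1 * z^-1)) = V1 * (b' * x)^-1 * (C' * y * b' * w / D').
      by move=> ? ? ? ?; field; apply/and4P.
    apply: alg; [by rewrite gt_eqF|by rewrite gt_eqF| |]; by rewrite expf_neq0// gt_eqF.
  have f0 : 0 <= V 1 * b ^- n.+1 by rewrite mulr_ge0// invr_ge0 exprn_ge0// ltW.
  apply: ler_piMr => //.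
  by rewrite ler_pdivrMr// mul1r /D lerDl.
exists (1 + d); first exact: addr_gt0.
apply/eqP; rewrite eq_le V0 andbT; apply/ler_addgt0Pr => e e0; rewrite add0r.
have lim : geometric (V 1) b^-1 @ \oo --> (0 : R).
  by apply: cvg_geometric; rewrite gtr0_norm ?invr_gt0// invf_lt1.
have /cvgrPdist_lt /(_ _ e0)[n _ /(_ n (leqnn n))] := lim.
rewrite sub0r normrN ger0_norm; last by rewrite mulr_ge0// exprn_ge0// invr_ge0 ltW.
rewrite /geometric/= exprVn => h; apply/ltW; apply: le_lt_trans h; apply: le_trans (step n).
by apply: (Vd _ _ (ln0 n)); rewrite /l lerD2l ler_piMr// ?(ltW d0)// gerBl invr_ge0 exprn_ge0.
Qed.

(** * Kernel mass outside a set of finite measure *)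

Section kernel_lower.
Context (R : realType) (N : nat).
Local Notation X := 'rV[R]_N.
Local Notation leb := (lebesgue_rV R N).

Lemma measurable_kern1 a (x : X) : measurable_fun [set: X] (fun y => kern a (x - y)).
Proof.
apply: measurable_powR_comp; apply: (measurableT_comp (@measurable_enorm R N)).
exact: measurable_rVB.
Qed.

(** The difference (4r)^N - (2r)^N is at least (2r)^N since 2^N >= 2. *)
Lemma annulus_measure (c : X) (r : R) : (1 <= N)%N -> 0 < r ->
  measurable [set y : X | r <= `|y - c| < r *+ 2] /\
  (((r *+ 2) ^+ N)%:E <= leb [set y : X | (r <= `|y - c| < r *+ 2)%R])%E.
Proof.
move=> N1 r0.
have -> : [set y : X | r <= `|y - c| < r *+ 2] =
   [set y : X | `|y - c| < r *+ 2] `\` [set y : X | `|y - c| < r].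
  apply/seteqP; split=> y /=; first by move=> /andP[h1 h2]; split=> //; rewrite ltNge h1.
  by move=> [h1 /negP h2]; rewrite h1 andbT leNgt.
have m1 := @measurable_rV_ball R N c r; have m2 := @measurable_rV_ball R N c (r *+ 2).
split; first exact: measurableD.
have r20 : 0 < r *+ 2 by rewrite pmulrn_lgt0.
have b1 := lebesgue_rV_ball c r0; have b2 := lebesgue_rV_ball c r20.
rewrite measureD//; last by apply: (@le_lt_trans _ _ ((r *+ 2 *+ 2) ^+ N)%:E); [rewrite -b2|exact: ltry].
rewrite setIidr; last by move=> y /= h; rewrite (lt_trans h)// mulr2n; lra.
rewrite [X in (_ <= X - _)%E](_ : _ = ((r *+ 2 *+ 2) ^+ N)%:E); last exact: b2.
rewrite [X in (_ <= _ - X)%E](_ : _ = ((r *+ 2) ^+ N)%:E); last exact: b1.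
rewrite -EFinB lee_fin.
rewrite -[r *+ 2 *+ 2]mulr_natl exprMn.
have : 0 <= (r *+ 2) ^+ N by rewrite exprn_ge0// ltW.
have : 2 <= 2 ^+ N :> R by rewrite -[leLHS]expr1 ler_weXn2l// ler1n.
by nra.
Qed.

(** Choose rho with rho^N = 2V. The annulus of radii rho/2 and rho around [x] has measure at least
    2V, so at least V of it avoids [A], and there the kernel is at least (N rho)^(-(N + a)). *)
Lemma kernel_outside_lower (a : R) : (1 <= N)%N -> 0 < a ->
  exists2 c : R, 0 < c & forall (A : set X) (V : R) (x : X), measurable A -> 0 < V ->
   leb A = V%:E ->
   ((c * V `^ (- (a / N%:R)))%:E <= \int[leb]_y (\1_(~` A) y * kern a (x - y))%:E)%E.
Proof.
move=> N1 a0; have N0 : 0 < N%:R :> R by rewrite ltr0n.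
exists (N%:R `^ (- (N%:R + a)) * 2 `^ (- (1 + a / N%:R))).
  by rewrite mulr_gt0 ?powR_gt0.
move=> A V x mA V0 AV.
pose rho : R := (2 * V) `^ N%:R^-1.
have V20 : 0 < 2 * V by rewrite mulr_gt0.
have rho0 : 0 < rho by exact: powR_gt0.
have rN : rho ^+ N = 2 * V.
  by rewrite -powR_mulrn ?(ltW rho0)// -powRrM mulVf ?gt_eqF// powRr1// ltW.
pose r := rho / 2; have r0 : 0 < r by rewrite divr_gt0.
have r2 : r *+ 2 = rho by rewrite /r -mulr_natr divfK.
have := annulus_measure x N1 r0; rewrite r2 rN.
set S := [set y | _] => -[mS hS].
have mSA : measurable (S `\` A) by exact: measurableD.
have VSA : (V%:E <= leb (S `\` A))%E.
  have : (leb S <= leb (S `\` A) + leb A)%E.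
    apply: (@le_trans _ _ (leb ((S `\` A) `|` A))); last exact: measureU2.
    apply: le_measure; rewrite ?inE//; first exact: measurableU.
    by move=> y Sy; have [Ay|nAy] := pselect (A y); [right|left].
  rewrite AV => h; have := le_trans hS h.
  by rewrite (_ : 2 * V = V + V) ?EFinD ?leeD2rE//; ring.
pose k := (N%:R * rho) `^ (- (N%:R + a)).
have k0 : 0 <= k by exact: powR_ge0.
apply: (@le_trans _ _ (\int[leb]_y (k * \1_(S `\` A) y)%:E)%E).
  rewrite (ge0_integral_scale _ k0); [|by move=> y; rewrite indicE|exact: measurable_indic].
  rewrite integral_indic// setIT.
  apply: (@le_trans _ _ (k%:E * V%:E)%E); last by rewrite lee_wpmul2l ?lee_fin.
  rewrite -EFinM lee_fin /k powRM ?(ltW N0) ?(ltW rho0)// -!mulrA ler_wpM2l ?powR_ge0//.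
  rewrite /rho -powRrM.
  have -> : N%:R^-1 * - (N%:R + a) = - (1 + a / N%:R) by field; rewrite gt_eqF.
  rewrite powRM ?(ltW V0)// -mulrA ler_wpM2l ?powR_ge0//.
  have -> : - (1 + a / N%:R) = - (a / N%:R) + -1 by ring.
  rewrite powRD ?(gt_eqF V0) ?implybT// powR_inv1 ?(ltW V0)//.
  by rewrite mulfVK ?(gt_eqF V0).
apply: ge0_integral_le.
- by move=> y; rewrite mulr_ge0.
- move=> y; rewrite !indicE; have [h|h] := boolP (y \in S `\` A); last first.
    by rewrite mulr0 mulr_ge0 ?kern_ge0.
  move: h; rewrite inE => -[/= /andP[h1 h2] nA].
  rewrite mulr1 mem_set//= mul1r; apply: kern_ge => //.
    by rewrite distrC (lt_le_trans r0).
  by rewrite distrC ltW.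
- by apply: measurable_funM => //; exact: measurable_indic.
- by apply: measurable_funM; [exact/measurable_indic/measurableC|exact: measurable_kern1].
Qed.
End kernel_lower.

(** * Truncation between two levels *)

Section truncation.
Context (R : realType).
Implicit Types (l h t x y : R).

Definition slice l h t : R := Num.min (Num.max (t - l) 0) (h - l).

Lemma slice_spec l h t : l <= h ->
  [\/ t <= l /\ slice l h t = 0, l <= t <= h /\ slice l h t = t - l
    | h <= t /\ slice l h t = h - l].
Proof.
move=> lh; rewrite /slice.
have [tl|lt] := leP t l.
  by apply: Or31; split=> //; rewrite max_r ?min_l//; lra.
have [th|ht] := leP t h.
  by apply: Or32; split; [lra|rewrite max_l ?min_l//; lra].
by apply: Or33; split; [lra|rewrite max_l ?min_r//; lra].
Qed.

Lemma slice_lip l h x y : l <= h -> `|slice l h x - slice l h y| <= `|x - y| /\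
  0 <= (x - y) * (slice l h x - slice l h y).
Proof.
move=> lh; wlog xy : x y / y <= x.
  move=> H; have [/H//|/ltW/H[h1 h2]] := leP y x.
  by rewrite distrC (distrC x) -mulrNN !opprB.
rewrite (ger0_norm (_ : 0 <= x - y)); last lra.
case: (slice_spec x lh) => -[hx ->]; case: (slice_spec y lh) => -[hy ->];
  by rewrite ger0_norm; first (by split; [lra|nra]); lra.
Qed.

Lemma slice_bounds l h t : 0 <= l -> l <= h ->
  [/\ 0 <= slice l h t, slice l h t <= h - l & `|slice l h t| <= `|t|].
Proof.
move=> l0 lh; case: (slice_spec t lh) => -[ht ->]; split; rewrite ?normr0//; try lra.
- by rewrite !ger0_norm; lra.
- by rewrite !ger0_norm; lra.
Qed.

Lemma measurable_slice d (T : measurableType d) l h (f : T -> R) :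
  measurable_fun setT f -> measurable_fun setT (fun z => slice l h (f z)).
Proof.
move=> mf; apply: measurable_minr => //; apply: measurable_maxr => //.
exact: measurable_funB.
Qed.
End truncation.

(** * Level-set inequalities *)

Section boundedness.
Context (R : realType) (N : nat).
Local Notation X := 'rV[R]_N.
Local Notation leb := (lebesgue_rV R N).
Implicit Types (a m s p q : R) (u v phi f : X -> R).

Lemma weak_form_ge0 s m u phi : 1 < m -> 0 < s ->
  (forall x y, `|phi x - phi y| <= `|u x - u y|) ->
  (forall x y, 0 <= (u x - u y) * (phi x - phi y)) ->
  (0 <= weak_form s m u phi)%E.
Proof.
move=> m1 s0 h1 h2; rewrite weak_formE; apply: integral_ge0 => z _.
rewrite lee_fin mulr_ge0 ?kern_ge0//.
by apply: le_trans (Jfun_mul_ge m1 (h1 _ _) (h2 _ _)); exact: powR_ge0.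
Qed.

Lemma measurable_superlevel u l : measurable_fun setT u -> measurable [set x | l < u x].
Proof.
move=> mu; rewrite (_ : [set x | _] = setT `&` u @^-1` `]l, +oo[%classic); first exact: mu.
by apply/seteqP; split=> x /=; rewrite in_itv/= andbT; [|case].
Qed.

(** Only the ordered pairs with [h < u x] and [u y <= l] are kept: there the slice jumps by exactly
    [h - l]. All other pairs contribute nonnegatively by [Jfun_mul_ge]. *)
Lemma weak_form_slice_ge s m u l h (c V : R) : 0 < s -> 1 < m -> l < h ->
  measurable_fun setT u -> 0 <= c ->
  (forall x : X, (c%:E <= \int[leb]_y (\1_(~` [set x | (l < u x)%R]) y * kern (s * m) (x - y))%:E)%E) ->
  leb [set x | h < u x] = V%:E ->
  (((h - l) `^ m * (c * V))%:E <= weak_form s m u (fun x => slice l h (u x)))%E.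
Proof.
move=> s0 m1 lh mu c0 hc hV.
have mh := measurable_superlevel h mu; have ml := measurable_superlevel l mu.
have mi (A : set X) : measurable A -> measurable_fun setT (\1_A : X -> R).
  by move=> mA; exact: measurable_indic.
have m1' : measurable_fun [set: X * X] (fun z => \1_[set x | h < u x] z.1 : R).
  exact: (measurable_fst_comp (mi _ mh)).
have m2' : measurable_fun [set: X * X] (fun z => \1_(~` [set x | l < u x]) z.2 : R).
  exact: (measurable_snd_comp (mi _ (measurableC ml))).
have mk := @measurable_kern R N (s * m).
pose F (z : X * X) : R := \1_[set x | h < u x] z.1 * (\1_(~` [set x | l < u x]) z.2 * kern (s * m) (z.1 - z.2)).
have mF : measurable_fun setT F by apply: measurable_funM => //; exact: measurable_funM.
have F0 z : 0 <= F z by rewrite /F !indicE mulr_ge0// mulr_ge0// kern_ge0.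
have hl0 : 0 <= (h - l) `^ m by exact: powR_ge0.
rewrite weak_formE; apply: (@le_trans _ _ (\int[leb \x leb]_z ((h - l) `^ m * F z)%:E)%E); last first.
  apply: ge0_integral_le.
  - by move=> z; rewrite mulr_ge0.
  - move=> [x y] /=; rewrite /F/= !indicE !mulrA ler_wpM2r ?kern_ge0//.
    have [d1 d2] := slice_lip (u x) (u y) (ltW lh).
    apply: le_trans (Jfun_mul_ge m1 d1 d2).
    have [hx|hx] := boolP (x \in _); last by rewrite !mulr0 mul0r powR_ge0.
    have [hy|hy] := boolP (y \in _); last by rewrite !mulr0 powR_ge0.
    rewrite !mulr1; rewrite inE/= in hx; move: hy; rewrite inE/= => /negP; rewrite -leNgt => hy.
    apply: ge0_ler_powR; rewrite ?nnegrE//; try lra.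
    case: (slice_spec (u x) (ltW lh)) => -[h1 ->]; try lra.
    by case: (slice_spec (u y) (ltW lh)) => -[h2 ->]; rewrite (le_trans _ (ler_norm _))//; lra.
  - by apply: measurable_funM => //; exact: measurable_cst.
  - exact: (@measurable_weak R N (s * m) m u (fun x => slice l h (u x)) mu (measurable_slice l h mu)).
rewrite ge0_integral_scale// EFinM lee_wpmul2l ?lee_fin//.
rewrite fubini_tonelli1; [|exact/measurable_EFinP|by move=> z; rewrite lee_fin].
apply: (@le_trans _ _ (\int[leb]_x (c * \1_[set x | h < u x] x)%:E)%E).
  rewrite (ge0_integral_scale _ c0); [|by move=> y; rewrite indicE|exact: mi].
  by rewrite integral_indic// setIT EFinM lee_wpmul2l ?lee_fin// -hV.
apply: ge0_le_integral => //.
- by move=> x _; rewrite lee_fin indicE mulr_ge0.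
- by apply/measurable_EFinP; apply: measurable_funM => //; exact: mi.
- by apply: measurable_fun_fubini_tonelli_F; [exact/measurable_EFinP|move=> z; rewrite lee_fin].
- move=> x _; rewrite /fubini_F /F/=.
  rewrite (@ge0_integral_scale _ _ _ leb (\1_[set x0 | h < u x0] x)).
  + by rewrite mulrC EFinM lee_wpmul2l// lee_fin indicE.
  + by rewrite indicE.
  + by move=> y; rewrite indicE mulr_ge0// kern_ge0.
  + by apply: measurable_funM; [exact: (mi _ (measurableC ml))|exact: measurable_kern1].
Qed.

(** Hölder's inequality between [f] and the indicator of [A], whose norm for the exponent [th']
    conjugate to [theta] is V^(1 - 1/theta). *)
Lemma Lfun_level_integral f theta (A : set X) (w : X -> R) (K V : R) :
  1 < theta -> f \in Lfun leb theta%:E -> measurable A -> leb A = V%:E ->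
  measurable_fun setT w -> 0 <= K -> (forall x, `|w x| <= K * \1_A x) ->
  (\int[leb]_x (f x * w x)%:E <=
    K%:E * ('N[leb]_(theta%:E)[EFin \o f] * (V `^ (1 - theta^-1))%:E))%E.
Proof.
move=> th1 fL mA AV mw K0 wK; have th0 : 0 < theta by lra.
have [mf _] := (LfunrP f th0).1 fL.
have mi : measurable_fun setT (\1_A : X -> R) by exact: measurable_indic.
have mfw : measurable_fun setT (fun x => f x * w x) by exact: measurable_funM.
have V0 : 0 <= V by rewrite -lee_fin -AV.
pose th' := theta / (theta - 1).
have th'0 : 0 < th' by rewrite divr_gt0//; lra.
have conj : theta^-1 + th'^-1 = 1.
  by rewrite /th' invf_div; field; rewrite gt_eqF.
have th'E : th'^-1 = 1 - theta^-1 by rewrite -conj addrAC subrr add0r.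
apply: (le_trans (lee_abs _)).
apply: (le_trans (le_abse_integral _ measurableT _)); first exact/measurable_EFinP.
apply: (@le_trans _ _ (\int[leb]_x (K * `|(f \* \1_A) x|)%:E)%E).
  apply: ge0_integral_le.
  - by move=> x.
  - move=> x /=; rewrite normrM (le_trans (ler_wpM2l _ (wK x)))//.
    by rewrite normrM (ger0_norm (_ : 0 <= \1_A x)) ?indicE// mulrCA.
  - exact: measurableT_comp.
  - by apply: measurable_funM => //; apply: measurableT_comp => //; exact: measurable_funM.
rewrite ge0_integral_scale//; last by apply: measurableT_comp => //; exact: measurable_funM.
rewrite lee_wpmul2l ?lee_fin//.
have := hoelder leb mf mi th0 th'0 conj.
rewrite Lnorm1 => h; apply: (le_trans h); rewrite lee_wpmul2l ?Lnorm_ge0//.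
rewrite unlock/= -th'E.
under eq_integral => x _.
  rewrite (_ : `|\1_A x| `^ th' = \1_A x :> R); last first.
    by rewrite indicE; case: (x \in A); rewrite ?normr1 ?powR1// normr0 powR0// gt_eqF.
  over.
rewrite integral_indic// setIT [X in (X `^ _)%E](_ : _ = V%:E)//.
Qed.
End boundedness.

(** * The global upper bound *)

Section global_bound.
Context (R : realType) (N : nat).
Local Notation X := 'rV[R]_N.
Local Notation leb := (lebesgue_rV R N).
Implicit Types (a m s p q : R) (u v phi f : X -> R).

Lemma superlevel_finite (e : R) u l : 0 < e -> 0 < l -> measurable_fun setT u ->
  (\int[leb]_x (`|u x| `^ e)%:E < +oo)%E -> (leb [set x | (l < u x)%R] < +oo)%E.
Proof.
move=> e0 l0 mu iu; have ml := measurable_superlevel l mu.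
have le0 : 0 < l `^ e by exact: powR_gt0.
have : ((l `^ e)%:E * leb [set x | l < u x]%R < +oo)%E.
  apply: le_lt_trans iu; rewrite -(setIT [set x | _]) -integral_indic//.
  rewrite -(ge0_integral_scale _ (ltW le0)); [|by move=> x; rewrite indicE|exact: measurable_indic].
  apply: ge0_integral_le.
  - by move=> x; rewrite mulr_ge0 ?powR_ge0// indicE.
  - move=> x; rewrite indicE; have [h|h] := boolP (x \in _); last by rewrite mulr0 powR_ge0.
    rewrite mulr1; rewrite inE/= in h; rewrite ge0_ler_powR ?nnegrE// ?ltW//.
    by rewrite (lt_le_trans h) ?ler_norm.
  - by apply: measurable_funM => //; exact: measurable_indic.
  - by apply: measurable_powR_comp; exact: measurableT_comp.
have := measure_ge0 leb [set x | l < u x]%R.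
by case: (leb _) => [r| |] // _; [rewrite !ltry|rewrite gt0_muley ?lte_fin].
Qed.

Lemma weak_solution_bounded s p q theta f u :
  (1 <= N)%N -> 0 < s -> 2 < q -> q <= p -> s * p < N%:R ->
  N%:R / (s * p) < theta -> f \in Lfun leb theta%:E ->
  weak_solution s p q f u ->
  exists2 M : R, 0 < M & {ae leb, forall x, 0 <= u x <= M}.
Proof.
move=> N1 s0 q2 qp spN thN fL [[uDp uDq] upos uweak].
have p2 : 2 < p by exact: lt_le_trans qp.
have [p0 q0 p1 q1] : [/\ 0 < p, 0 < q, 1 < p & 1 < q] by split; lra.
have sqN : s * q < N%:R by apply: le_lt_trans spN; rewrite ler_wpM2l// ltW.
have N0 : 0 < N%:R :> R by rewrite ltr0n.
have sp0 : 0 < s * p by rewrite mulr_gt0.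
have th1 : 1 < theta by apply: lt_trans thN; rewrite ltr_pdivlMr// mul1r.
have th0 : 0 < theta by lra.
have [mu pu _] := (spaceDP u s0 p0 spN).1 uDp.
have cr0 := crit_gt0 s0 p0 spN.
pose V l : R := fine (leb [set x | l < u x]).
have VE l : 0 < l -> leb [set x | l < u x] = (V l)%:E.
  move=> l0; rewrite /V fineK// ge0_fin_numE//; exact: superlevel_finite cr0 l0 mu pu.
have V0 l : 0 <= V l by rewrite fine_ge0.
have [c c0 hc] := kernel_outside_lower N1 sp0.
pose F : R := fine ('N[leb]_(theta%:E)[EFin \o f])%E.
have FE : ('N[leb]_(theta%:E)[EFin \o f] = F%:E)%E.
  by move: fL => /andP[_]; rewrite inE => h; rewrite /F fineK// ge0_fin_numE ?Lnorm_ge0.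
have F0 : 0 <= F by rewrite fine_ge0 ?Lnorm_ge0.
have Vd l h : 0 < l -> l <= h -> V h <= V l.
  move=> l0 lh; rewrite -lee_fin -!VE//; last exact: lt_le_trans lh.
  apply: le_measure; rewrite ?inE; [exact: measurable_superlevel..|].
  by move=> x /=; exact: le_lt_trans.
have Vi l h : 0 < l -> l < h ->
    V h <= F / c * (h - l) `^ (- (p - 1)) * V l `^ (1 + s * p / N%:R - theta^-1).
  move=> l0 lh; have h0 := lt_trans l0 lh.
  (* The kernel bound needs a set of positive measure; if [V l = 0], monotonicity of [V] is
     enough. *)
  have [Vl0|Vl0] := eqVneq (V l) 0.
    by rewrite (le_trans (Vd _ _ l0 (ltW lh)))// Vl0 !mulr_ge0 ?powR_ge0 ?invr_ge0// ltW.
  have Vl : 0 < V l by rewrite lt_neqAle eq_sym Vl0 V0.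
  pose w x := slice l h (u x).
  have wS m : 0 < m -> s * m < N%:R -> spaceD s m u -> spaceD s m w.
    move=> m0 smN uD; apply: (spaceD_contraction s0 m0 smN uD).
    - exact: measurable_slice.
    - by move=> x; have [] := slice_bounds (u x) (ltW l0) (ltW lh).
    - by move=> x y; have [] := slice_lip (u x) (u y) (ltW lh).
  have wW : spaceW s p q w by split; exact: wS.
  have low := weak_form_slice_ge s0 p1 lh mu (_ : 0 <= c * V l `^ (- (s * p / N%:R)))
    (fun x => hc _ _ x (measurable_superlevel l mu) Vl (VE _ l0)) (VE _ h0).
  have := uweak w wW => E.
  (* Nonnegativity is all that is used of the q-form. *)
  have qge : (0 <= weak_form s q u w)%E.
    by apply: weak_form_ge0 => // x y; have [] := slice_lip (u x) (u y) (ltW lh).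
  have up := @Lfun_level_integral R N f theta _ w (h - l) (V l) th1 fL
     (measurable_superlevel l mu) (VE _ l0) (measurable_slice l h mu).
  have : (((h - l) `^ p * (c * V l `^ (- (s * p / N%:R)) * V h))%:E <=
     (h - l)%:E * (F%:E * (V l `^ (1 - theta^-1))%:E))%E.
    apply: (le_trans (low _)); first by rewrite mulr_ge0 ?powR_ge0// ltW.
    apply: (@le_trans _ _ (weak_form s p u w + weak_form s q u w)%E).
      by rewrite leeDl.
    rewrite E -FE; apply: up; first by rewrite subr_ge0 ltW.
    move=> x; have [b1 b2 b3] := slice_bounds (u x) (ltW l0) (ltW lh).
    rewrite indicE; have [hx|hx] := boolP (x \in _).
      by rewrite mulr1 ger0_norm.
    have {}hx : u x <= l by rewrite leNgt; apply/negP => h'; move/negP: hx; apply; exact: mem_set.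
    rewrite mulr0 normr_le0 /w.
    by apply/eqP; case: (slice_spec (u x) (ltW lh)) => -[H ->] //; clear -hx H lh; lra.
  rewrite -!EFinM lee_fin.
  have hl : 0 < h - l by rewrite subr_gt0.
  have Vs : 0 < V l `^ (s * p / N%:R) by exact: powR_gt0.
  have hs : 0 < (h - l) `^ (p - 1) by exact: powR_gt0.
  have -> : V l `^ (1 + s * p / N%:R - theta^-1) = V l `^ (1 - theta^-1) * V l `^ (s * p / N%:R).
    by rewrite -powRD ?Vl0 ?implybT//; congr (_ `^ _); ring.
  (* One factor [h - l] is split off to cancel the height of the test function on the right; this
     leaves the exponent [p - 1]. *)
  rewrite -(mulr_powRB1 (ltW hl) p0) !powRN.
  move: (V l `^ (1 - _)) (V l `^ (s * p / _)) ((h - l) `^ _) Vs hs => A B D Vs hs K.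
  have {}K : D * (c * B^-1 * V h) <= F * A by rewrite -(ler_pM2l hl) (mulrA _ D).
  have -> : V h = (D * (c * B^-1 * V h)) * (B / (c * D)).
    by field; rewrite !gt_eqF.
  have -> : F / c * D^-1 * (A * B) = (F * A) * (B / (c * D)).
    by field; rewrite !gt_eqF.
  by rewrite ler_wpM2r// divr_ge0 ?mulr_ge0// ltW.
have be1 : 1 < 1 + s * p / N%:R - theta^-1.
  suff : theta^-1 < s * p / N%:R by lra.
  rewrite -[ltRHS]invrK invf_div ltf_pV2 ?posrE// divr_gt0//.
have p10 : 0 < p - 1 by rewrite subr_gt0.
have [M M0 VM] := stampacchia (divr_ge0 F0 (ltW c0)) p10 be1 V0 Vd Vi.
exists M => //.
have ae2 : {ae leb, forall x, u x <= M}.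
  exists [set x | M < u x]; split; first exact: measurable_superlevel.
    by have := VE _ M0; rewrite VM.
  by move=> x /= /negP; rewrite -ltNge.
by apply: filterS2 upos ae2 => x -> ->.
Qed.
End global_bound.

(** * Almost-everywhere modifications of solutions *)

Section ae_product.
Context (R : realType) (N : nat).
Local Notation X := 'rV[R]_N.
Local Notation leb := (lebesgue_rV R N).
Implicit Types (a m s p q : R) (u v phi f g : X -> R).

Lemma ae_product (P : X -> Prop) : {ae leb, forall x, P x} ->
  {ae (leb \x leb)%E, forall z, P z.1 /\ P z.2}.
Proof.
move=> [A [mA A0 hA]].
exists (A `*` setT `|` setT `*` A); split.
- by apply: measurableU; exact: measurableX.
- have e1 : (leb \x leb)%E (A `*` setT) = 0%E.
    by apply: etrans (product_measure1E _ _ mA measurableT) _; rewrite [X in (X * _)%E]A0 mul0e.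
  have e2 : (leb \x leb)%E (setT `*` A) = 0%E.
    by apply: etrans (product_measure1E _ _ measurableT mA) _; rewrite [X in (_ * X)%E]A0 mule0.
  apply/eqP; rewrite -measure_le0; apply: (le_trans (measureU2 _ _ _)); try exact: measurableX.
  by rewrite [X in (X + _)%E]e1 [X in (_ + X)%E]e2 adde0.
- move=> z /= hz; apply: contrapT => nz; apply: hz.
  split; apply: contrapT => nP; apply: nz; [left|right]; split=> //; exact: hA.
Qed.

Lemma energy_ae a m u v : measurable_fun setT u -> measurable_fun setT v ->
  {ae leb, forall x, u x = v x} -> energy a m u = energy a m v.
Proof.
move=> mu mv uv; apply: ae_eq_integral => //.
- by apply/measurable_EFinP; exact: measurable_energy.
- by apply/measurable_EFinP; exact: measurable_energy.
- by apply: filterS (ae_product uv) => z [e1 e2] _; rewrite e1 e2.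
Qed.

Lemma spaceD_ae s m u v : 0 < s -> 0 < m -> s * m < N%:R ->
  measurable_fun setT v -> {ae leb, forall x, u x = v x} -> spaceD s m u -> spaceD s m v.
Proof.
move=> s0 m0 smN mv uv /(spaceDP _ s0 m0 smN)[mu hu eu].
apply/(spaceDP _ s0 m0 smN); split; [exact: mv| |by rewrite -(energy_ae _ _ mu mv uv)].
apply: le_lt_trans hu; rewrite le_eqVlt; apply/orP; left; apply/eqP; apply/esym.
apply: ae_eq_integral => //.
- by apply/measurable_EFinP; apply: measurable_powR_comp; exact: measurableT_comp.
- by apply/measurable_EFinP; apply: measurable_powR_comp; exact: measurableT_comp.
- by apply: filterS uv => x e _; rewrite e.
Qed.

Lemma weak_form_ae s m u v phi : measurable_fun setT u -> measurable_fun setT v ->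
  measurable_fun setT phi -> {ae leb, forall x, u x = v x} ->
  weak_form s m u phi = weak_form s m v phi.
Proof.
move=> mu mv mphi uv; rewrite !weak_formE; apply: ae_eq_integral => //.
- by apply/measurable_EFinP; exact: measurable_weak.
- by apply/measurable_EFinP; exact: measurable_weak.
- by apply: filterS (ae_product uv) => z [e1 e2] _; rewrite e1 e2.
Qed.

(** The equation without the sign condition, so that it can be passed to - v: a gain on the infimum
    of u is a gain on the supremum of - u. *)
Definition weak_eq s p q g v : Prop := spaceW s p q v /\
  forall phi, spaceW s p q phi ->
    (weak_form s p v phi + weak_form s q v phi)%E = (\int[leb]_x (g x * phi x)%:E)%E.

Lemma spaceD_opp s m u : 0 < s -> 0 < m -> s * m < N%:R ->
  spaceD s m u -> spaceD s m (fun x => - u x).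
Proof.
move=> s0 m0 smN uD; have [mu _ _] := (spaceDP u s0 m0 smN).1 uD.
apply: (spaceD_contraction s0 m0 smN uD).
- exact: measurableT_comp.
- by move=> x; rewrite normrN.
- by move=> x y; rewrite -opprD normrN.
Qed.

Lemma weak_form_opp s m v phi :
  weak_form s m (fun x => - v x) phi = weak_form s m v (fun x => - phi x).
Proof.
rewrite !weak_formE; apply: eq_integral => z _; congr (_ * _)%:E.
have -> : - v z.1 - - v z.2 = - (v z.1 - v z.2) by ring.
by rewrite JfunN; ring.
Qed.

Section weak_equation.
Context (s p q : R).
Hypotheses (s0 : 0 < s) (p0 : 0 < p) (q0 : 0 < q).
Hypotheses (spN : s * p < N%:R) (sqN : s * q < N%:R).

Lemma spaceW_opp u : spaceW s p q u -> spaceW s p q (fun x => - u x).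
Proof. by move=> [u1 u2]; split; exact: spaceD_opp. Qed.

Lemma weak_eq_opp g v : weak_eq s p q g v ->
  weak_eq s p q (fun x => - g x) (fun x => - v x).
Proof.
move=> [vW hv]; split; first exact: spaceW_opp.
move=> phi phiW; rewrite !weak_form_opp hv; last exact: spaceW_opp.
by apply: eq_integral => x _; rewrite mulNr mulrN.
Qed.

Lemma weak_eq_ae g u v : measurable_fun setT v -> {ae leb, forall x, u x = v x} ->
  weak_eq s p q g u -> weak_eq s p q g v.
Proof.
move=> mv uv [[u1 u2] hu].
have [mu _ _] := (spaceDP u s0 p0 spN).1 u1.
split; first by split; [exact: spaceD_ae u1|exact: spaceD_ae u2].
move=> phi phiW; have [phi1 _] := phiW.
have [mphi _ _] := (spaceDP phi s0 p0 spN).1 phi1.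
by rewrite -(weak_form_ae s p mu mv mphi uv) -(weak_form_ae s q mu mv mphi uv) hu.
Qed.

End weak_equation.
End ae_product.

(** * Barrier estimates *)

Lemma integrable_bound d (T : measurableType d) (R : realType)
    (mu : {measure set T -> \bar R}) (f g : T -> R) (K : R) :
  measurable_fun setT f -> measurable_fun setT g -> (forall x, `|f x| <= g x) ->
  (\int[mu]_x (g x)%:E <= K%:E)%E -> mu.-integrable setT (fun x => (f x)%:E).
Proof.
move=> mf mg fg gK; apply/integrableP; split; first exact/measurable_EFinP.
apply: (@le_lt_trans _ _ (\int[mu]_x (g x)%:E)%E); last by rewrite (le_lt_trans gK)// ltry.
apply: ge0_le_integral => //.
- by apply: measurableT_comp => //; exact/measurable_EFinP.
- exact/measurable_EFinP.
- by move=> x _; rewrite abse_EFin lee_fin.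
Qed.

Section antisymmetric.
Context (R : realType) (N : nat).
Local Notation X := 'rV[R]_N.
Local Notation leb := (lebesgue_rV R N).

(** By antisymmetry the double integral equals twice the integral of phi(x) times the slice integral
    of H(x, .), so a lower bound on slices over the support of [phi] suffices. The bound by [h]
    provides the absolute convergence that Fubini requires. *)
Lemma antisymmetric_form (H : X * X -> R) (h : R -> R) (phi : X -> R) (kappa K L : R) :
  measurable_fun setT H -> measurable_fun setT phi -> measurable_fun setT h ->
  (forall x, 0 <= phi x) -> (forall t, 0 <= h t) -> 0 <= K ->
  (forall x y, H (y, x) = - H (x, y)) ->
  (forall x y, phi x != 0 -> `|H (x, y)| <= h `|x - y|) ->
  (forall c : X, (\int[leb]_y (h `|c - y|)%:E <= K%:E)%E) ->
  (\int[leb]_x (phi x)%:E = L%:E)%E ->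
  (forall x, phi x != 0 -> (kappa%:E <= \int[leb]_y (H (x, y))%:E)%E) ->
  (leb \x leb)%E.-integrable setT (fun z => (H z * (phi z.1 - phi z.2))%:E) /\
  ((2 * kappa * L)%:E <= \int[leb \x leb]_z (H z * (phi z.1 - phi z.2))%:E)%E.
Proof.
move=> mH mphi mh phi0 h0 K0 Hanti Hh hK phiL Hk.
have mh2 : measurable_fun [set: X * X] (fun z => h `|z.1 - z.2|).
  exact: (measurableT_comp mh (@measurable_rV_dist R N)).
have mhc c : measurable_fun [set: X] (fun y => h `|c - y|).
  exact: (measurableT_comp mh (@measurable_rV_distr R N c)).
have mp1 := measurable_fst_comp mphi; have mp2 := measurable_snd_comp mphi.
have mHx x : measurable_fun [set: X] (fun y => H (x, y)).
  exact: (measurableT_comp mH (pair1_measurable x)).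
pose G z := H z * phi z.1; pose G' z := H z * phi z.2.
have mG : measurable_fun setT G by exact: measurable_funM.
have mG' : measurable_fun setT G' by exact: measurable_funM.
have phiL' : (\int[leb]_x (phi x)%:E <= L%:E)%E by rewrite phiL.
have [c1 c2] := integral_convolution mphi mh phi0 h0 K0 hK phiL'.
have iH x : phi x != 0 -> leb.-integrable setT (fun y => (H (x, y))%:E).
  by move=> px; apply: (integrable_bound (mHx x) (mhc x) _ (hK x)) => y; exact: Hh.
have iG : (leb \x leb)%E.-integrable setT (fun z => (G z)%:E).
  apply: (integrable_bound mG _ _ c1).
  - exact: measurable_funM.
  - move=> [x y]; rewrite /G/= normrM (ger0_norm (phi0 x)) mulrC.
    have [->|px] := eqVneq (phi x) 0; first by rewrite !mul0r.
    by rewrite ler_wpM2l// Hh.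
have iG' : (leb \x leb)%E.-integrable setT (fun z => (G' z)%:E).
  apply: (integrable_bound mG' _ _ c2).
  - exact: measurable_funM.
  - move=> [x y]; rewrite /G'/= normrM (ger0_norm (phi0 y)) mulrC.
    have [->|py] := eqVneq (phi y) 0; first by rewrite !mul0r.
    by rewrite ler_wpM2l// Hanti normrN distrC Hh.
have iphi k : leb.-integrable setT (fun x => (k * phi x)%:E).
  apply: (@integrable_bound _ _ _ leb _ (fun x => `|k| * phi x) (`|k| * L)).
  - exact: measurable_funM.
  - exact: measurable_funM.
  - by move=> x; rewrite normrM (ger0_norm (phi0 x)).
  - by rewrite ge0_integral_scale// phiL.
have Iphi k : (\int[leb]_x (k * phi x)%:E = (k * L)%:E)%E.
  have := iphi 1; under [X in _.-integrable _ X]eq_fun do rewrite mul1r.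
  move=> i1; under eq_integral do rewrite EFinM.
  by rewrite integralZl// phiL.
have inner x k : phi x != 0 ->
    (\int[leb]_y (k * H (x, y))%:E = k%:E * \int[leb]_y (H (x, y))%:E)%E.
  by move=> px; under eq_integral do rewrite EFinM; rewrite integralZl//; exact: iH.
have IG : ((kappa * L)%:E <= \int[leb \x leb]_z (G z)%:E)%E.
  rewrite -integral12_prod_meas1// -Iphi; apply: le_integral => //.
    exact: integrable_fubini_F.
  move=> x _; rewrite /fubini_F /G/=.
  have [p0|px] := eqVneq (phi x) 0.
    by rewrite p0 mulr0; under eq_integral do rewrite mulr0; rewrite integral0.
  under eq_integral do rewrite mulrC.
  by rewrite inner// mulrC EFinM lee_wpmul2l ?lee_fin// Hk.
have IG' : (\int[leb \x leb]_z (G' z)%:E <= (- kappa * L)%:E)%E.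
  rewrite -integral21_prod_meas1// -Iphi; apply: le_integral => //.
    apply: (le_integrable measurableT _ _ (iphi K)).
      exact: (measurable_fubini_G iG').
    move=> y _; rewrite /fubini_G /G'/= (ger0_norm (mulr_ge0 K0 (phi0 y))).
    apply: (le_trans (le_abse_integral _ measurableT _)).
      by apply/measurable_EFinP; apply: measurable_funM => //; exact: (measurableT_comp mH (pair2_measurable y)).
    apply: (@le_trans _ _ (\int[leb]_x (phi y * h `|y - x|)%:E)%E).
      apply: ge0_integral_le => //.
      - move=> x; rewrite normrM (ger0_norm (phi0 y)) mulrC.
        have [->|py] := eqVneq (phi y) 0; first by rewrite !mul0r.
        by rewrite ler_wpM2l// Hanti normrN Hh.
      - apply: measurableT_comp => //; apply: measurable_funM => //.
        exact: (measurableT_comp mH (pair2_measurable y)).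
      - exact: measurable_funM.
    by rewrite ge0_integral_scale// mulrC EFinM lee_wpmul2l// lee_fin.
  move=> y _; rewrite /fubini_G /G'/=.
  have [p0|py] := eqVneq (phi y) 0.
    by rewrite p0 mulr0; under eq_integral do rewrite mulr0; rewrite integral0.
  under eq_integral => x _ do rewrite Hanti mulrC mulrN -mulNr.
  rewrite inner//.
  have -> : (- kappa * phi y)%:E = ((- phi y)%:E * kappa%:E)%E by rewrite -EFinM; congr EFin; ring.
  rewrite !EFinN !mulNe leeN2 lee_wpmul2l ?lee_fin//.
  by rewrite Hk.
have E : (fun z => (H z * (phi z.1 - phi z.2))%:E) = (fun z => (G z)%:E - (G' z)%:E)%E.
  by apply/funext => z; rewrite -EFinB /G /G' mulrBr.
rewrite E; split; first exact: integrableB.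
rewrite integralB//.
have -> : (2 * kappa * L)%:E = ((kappa * L)%:E - (- kappa * L)%:E)%E.
  by rewrite -EFinB; congr EFin; ring.
exact: leeB.
Qed.
End antisymmetric.

(** * The parabolic barrier and short-range interactions *)

Section parabola.
Context (R : realType) (N : nat).
Local Notation X := 'rV[R]_N.
Local Notation leb := (lebesgue_rV R N).
Implicit Types (x y : X) (S g r : R).

(** Lies above [S] off the sup-norm ball of radius [r], because the Euclidean norm dominates the sup
    norm. *)
Definition parab S g r (x0 : X) x : R := S - g + g / r ^+ 2 * enorm (x - x0) ^+ 2.

Lemma measurable_parab S g r x0 : measurable_fun setT (parab S g r x0).
Proof.
apply: measurable_funD => //; apply: measurable_funM => //; apply: measurable_funX.
by apply: (measurableT_comp (@measurable_enorm R N)); apply: measurable_rVB.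
Qed.

Lemma parab_lip S g r x0 x y : 0 <= g ->
  `|parab S g r x0 x - parab S g r x0 y| <=
    g / r ^+ 2 * (N%:R * `|x - y| * (`|x - x0| + `|y - x0|)).
Proof.
move=> g0.
have -> : parab S g r x0 x - parab S g r x0 y =
   g / r ^+ 2 * (enorm (x - x0) ^+ 2 - enorm (y - x0) ^+ 2) by rewrite /parab; ring.
have b0 : 0 <= g / r ^+ 2 by rewrite divr_ge0// sqr_ge0.
rewrite normrM ger0_norm// ler_wpM2l// !enorm_sqr -sumrB.
apply: (le_trans (ler_norm_sum _ _ _)).
have -> : N%:R * `|x - y| * (`|x - x0| + `|y - x0|) =
   \sum_(i < N) (`|x - y| * (`|x - x0| + `|y - x0|)).
  by rewrite sumr_const card_ord -[RHS]mulr_natl mulrA.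
apply: ler_sum => i _.
have -> : (x - x0) ord0 i ^+ 2 - (y - x0) ord0 i ^+ 2 =
   (x - y) ord0 i * ((x - x0) ord0 i + (y - x0) ord0 i) by rewrite !mxE; ring.
rewrite normrM ler_pM ?rV_norm_coord// (le_trans (ler_normD _ _))//.
by rewrite lerD ?rV_norm_coord.
Qed.

(** The parallelogram law: reflecting y in x reverses the increment of the parabola up to a
    quadratic error. *)
Lemma parab_reflect S g r x0 x y :
  parab S g r x0 x - parab S g r x0 (x + x - y) =
  - ((parab S g r x0 x - parab S g r x0 y) + 2 * (g / r ^+ 2) * enorm (x - y) ^+ 2).
Proof.
rewrite /parab !enorm_sqr.
suff E : \sum_i (x + x - y - x0) ord0 i ^+ 2 + \sum_i (y - x0) ord0 i ^+ 2 =
   2 * \sum_i (x - x0) ord0 i ^+ 2 + 2 * \sum_i (x - y) ord0 i ^+ 2.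
  have -> : \sum_i (x + x - y - x0) ord0 i ^+ 2 = 2 * \sum_i (x - x0) ord0 i ^+ 2
    + 2 * \sum_i (x - y) ord0 i ^+ 2 - \sum_i (y - x0) ord0 i ^+ 2.
    by rewrite -E addrK.
  by ring.
by rewrite !mulr_sumr -!big_split/=; apply: eq_bigr => i _; rewrite !mxE; ring.
Qed.

Lemma parab_ge S g r x0 x : 0 <= g -> S - g <= parab S g r x0 x.
Proof. by move=> g0; rewrite lerDl mulr_ge0 ?divr_ge0// ?sqr_ge0. Qed.

Lemma parab_ge_outside S g r x0 x : 0 <= g -> 0 < r -> r <= `|x - x0| ->
  S <= parab S g r x0 x.
Proof.
move=> g0 r0 h; rewrite /parab -addrA lerDl addrC subr_ge0.
rewrite -[leLHS](divfK (_ : r ^+ 2 != 0)) ?expf_neq0 ?gt_eqF//.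
rewrite ler_wpM2l ?divr_ge0 ?sqr_ge0//.
have h2 : r <= enorm (x - x0) by rewrite (le_trans h)// le_enorm.
by rewrite ler_pXn2r ?nnegrE ?(ltW r0)// (le_trans (ltW r0)).
Qed.

Lemma parab_le_inside S g r x0 x : 0 <= g -> 0 < r -> N%:R * `|x - x0| <= r / 2 ->
  parab S g r x0 x <= S - g / 2.
Proof.
move=> g0 r0 h.
have h1 : enorm (x - x0) <= r / 2 by rewrite (le_trans (enorm_le _)).
have h2 : enorm (x - x0) ^+ 2 <= (r / 2) ^+ 2.
  by rewrite ler_pXn2r ?nnegrE ?enorm_ge0// divr_ge0// ltW.
have h3 : g / r ^+ 2 * enorm (x - x0) ^+ 2 <= g / r ^+ 2 * (r / 2) ^+ 2.
  by rewrite ler_wpM2l ?divr_ge0 ?sqr_ge0.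
have h4 : g / r ^+ 2 * (r / 2) ^+ 2 = g / 4 by field; rewrite gt_eqF.
by rewrite /parab; lra.
Qed.

Lemma parab_near S g r x0 x y : 0 <= g -> 0 < r -> `|x - x0| < r -> `|x - y| < r *+ 2 ->
  `|parab S g r x0 x - parab S g r x0 y| <= 4 * N%:R * g / r * `|x - y|.
Proof.
move=> g0 r0 xr d; apply: (le_trans (parab_lip _ _ _ _ _ g0)).
have y3 : `|y - x0| <= 3 * r.
  have -> : y - x0 = (y - x) + (x - x0) by rewrite addrA subrK.
  by rewrite (le_trans (ler_normD _ _))// distrC; move: d xr; rewrite mulr2n; lra.
have xy4 : `|x - x0| + `|y - x0| <= 4 * r by lra.
have b0 : 0 <= g / r ^+ 2 * (N%:R * `|x - y|).
  by rewrite mulr_ge0 ?divr_ge0 ?sqr_ge0// mulr_ge0.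
have := ler_wpM2l b0 xy4; rewrite -!mulrA => h; apply: (le_trans h).
by rewrite le_eqVlt; apply/orP; left; apply/eqP; field; rewrite gt_eqF.
Qed.

(** With A = P(x) - P(y) and B = P(x) - P(2x - y) = -(A + e), the sum J(A) + J(B) is J(A) - J(A +
    e). It is linear in the quadratic error e, so for Am of order d it is of order d^m, where J(A)
    alone would only be of order d^(m - 1). *)
Lemma Jfun_pair_lower (m A B Am e n d r : R) : 2 <= m -> 0 <= e -> 0 <= Am ->
  `|A| <= Am -> `|A + e| <= Am -> e <= Am * (n * d / (2 * r)) -> B = - (A + e) ->
  - ((Num.truncn (m - 1)).+1%:R * (Am `^ (m - 1) * (n * d / (2 * r)))) <= Jfun m A + Jfun m B.
Proof.
move=> m2 e0 Am0 A1 A2 eA ->; rewrite JfunN.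
have := Jfun_sub_le m2 e0 A1 A2; set T := _.+1%:R => J.
have T0 : 0 <= T by rewrite ler0n.
suff : T * Am `^ (m - 2) * e <= T * (Am `^ (m - 1) * (n * d / (2 * r))) by lra.
rewrite -mulrA ler_wpM2l// (le_trans (ler_wpM2l (powR_ge0 _ _) eA))//.
have m1 : 0 < m - 1 by lra.
have -> : m - 2 = m - 1 - 1 by ring.
by rewrite -[in leRHS](mulr_powRB1 Am0 m1) le_eqVlt; apply/orP; left; apply/eqP; ring.
Qed.

Lemma parab_pair_lower (m a : R) S g r x0 x y : 2 <= m -> 0 < a -> 0 <= g -> 0 < r ->
  `|x - x0| < r -> 0 < `|x - y| -> `|x - y| < r *+ 2 ->
  - ((Num.truncn (m - 1)).+1%:R * N%:R / (2 * r) * (4 * N%:R * g / r) `^ (m - 1) *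
     (`|x - y| `^ (m - a) * `|x - y| `^ (- N%:R))) <=
  kern a (x - y) * (Jfun m (parab S g r x0 x - parab S g r x0 y) +
    Jfun m (parab S g r x0 x - parab S g r x0 (x + x - y))).
Proof.
move=> m2 a0 g0 r0 xr d0 dr.
have gr0 : 0 <= g / r ^+ 2 by rewrite divr_ge0 ?sqr_ge0.
have gr20 : 0 <= 2 * (g / r ^+ 2) by rewrite mulr_ge0.
have ee0 : 0 <= 2 * (g / r ^+ 2) * enorm (x - y) ^+ 2 by apply: mulr_ge0 gr20 _; exact: sqr_ge0.
have A1 := parab_near S g0 r0 xr dr.
have xxy : x - (x + x - y) = - (x - y) by rewrite -addrA !opprD opprK !addrA subrr sub0r.
have PB := parab_reflect S g r x0 x y.
have A2 : `|(parab S g r x0 x - parab S g r x0 y) + 2 * (g / r ^+ 2) * enorm (x - y) ^+ 2| <=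
    4 * N%:R * g / r * `|x - y|.
  rewrite -[leLHS]normrN -PB.
  have := @parab_near S g r x0 x (x + x - y) g0 r0 xr.
  by rewrite xxy [`|- (x - y)|]normrN; apply.
have es : enorm (x - y) ^+ 2 <= (N%:R * `|x - y|) ^+ 2.
  have el := enorm_le (x - y).
  by apply: lerXn2r; rewrite ?nnegrE ?enorm_ge0// (le_trans (enorm_ge0 _) el).
have ee2 : 2 * (g / r ^+ 2) * enorm (x - y) ^+ 2 <=
    4 * N%:R * g / r * `|x - y| * (N%:R * `|x - y| / (2 * r)).
  apply: (le_trans (ler_wpM2l gr20 es)).
  by rewrite le_eqVlt; apply/orP; left; apply/eqP; field; rewrite gt_eqF.
have c0 : 0 <= 4 * N%:R * g / r by rewrite divr_ge0 ?(ltW r0)// mulr_ge0.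
have := Jfun_pair_lower m2 ee0 (mulr_ge0 c0 (ltW d0)) A1 A2 ee2 PB.
have m0 : 0 < m by lra.
have -> : (Num.truncn (m - 1)).+1%:R * ((4 * N%:R * g / r * `|x - y|) `^ (m - 1)
    * (N%:R * `|x - y| / (2 * r))) =
   (Num.truncn (m - 1)).+1%:R * N%:R / (2 * r) * (4 * N%:R * g / r) `^ (m - 1) * `|x - y| `^ m :> R.
  rewrite (powRM (m - 1) c0 (ltW d0)) -(mulr_powRB1 (ltW d0) m0).
  by move: (_ `^ _) (`|_| `^ _) => w1 w2; field; rewrite gt_eqF.
have k0 := kern_ge0 a (x - y).
have kd : kern a (x - y) * `|x - y| `^ m <= `|x - y| `^ (m - a) * `|x - y| `^ (- N%:R).
  rewrite -powRD ?(gt_eqF d0) ?implybT//.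
  have -> : m - a - N%:R = - (N%:R + a) + m by ring.
  by rewrite powRD ?(gt_eqF d0) ?implybT// ler_wpM2r ?powR_ge0// kern_le.
have B0 : 0 <= (Num.truncn (m - 1)).+1%:R * N%:R / (2 * r) * (4 * N%:R * g / r) `^ (m - 1).
  apply: mulr_ge0 (powR_ge0 _ _); apply: divr_ge0; first exact: mulr_ge0.
  by rewrite mulr_ge0// ltW.
have kd2 := ler_wpM2l B0 kd => /(ler_wpM2l k0); rewrite mulrN (mulrCA (kern _ _)) => K.
by apply: le_trans K; rewrite lerN2.
Qed.

(** Homogeneity bookkeeping: the short-range loss scales like g^(m - 1) r^(-a), as the long-range
    gain does with om in place of g. *)
Lemma near_constant (m a T k1 k2 n g r : R) : 0 <= n -> 0 <= m - 1 -> 0 <= g -> 0 < r ->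
  T * n / 4 * (4 * n) `^ (m - 1) * 2 `^ (m - a) * (k1 / k2) * g `^ (m - 1) * r `^ (- a) =
  2^-1 * (T * n / (2 * r) * (4 * n * g / r) `^ (m - 1) * (k1 * (r *+ 2) `^ (m - a) / k2)).
Proof.
move=> n0 m1 g0 r0; have ri : 0 <= r^-1 by rewrite invr_ge0 ltW.
have rn : (r == 0) = false by rewrite gt_eqF.
have -> : 4 * n * g / r = 4 * n * (g / r) by rewrite mulrA.
rewrite (powRM _ (mulr_ge0 (ler0n _ 4) n0) (mulr_ge0 g0 ri)) (powRM _ g0 ri).
rewrite -[r *+ 2]mulr_natl (powRM _ (ler0n _ 2) (ltW r0)).
have -> : r `^ (m - a) = r * r `^ (m - 1) * r `^ (- a).
  rewrite -[X in X * _ * _](powRr1 (ltW r0)) -!powRD ?rn ?implybT//.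
  by congr (_ `^ _); ring.
have -> : (r^-1) `^ (m - 1) = (r `^ (m - 1))^-1.
  by rewrite -powR_inv1 ?(ltW r0)// powRAC powR_inv1// powR_ge0.
have : r `^ (m - 1) != 0 by rewrite gt_eqF ?powR_gt0.
move: ((4 * n) `^ _) (2 `^ _) (g `^ _) (r `^ (m - 1)) (r `^ _) => w1 w2 w3 w5 w6 w5n.
rewrite [k1 * _ / k2]mulrAC; move: (k1 / k2) => k.
by field; rewrite w5n rn.
Qed.

(** The constant does not depend on the cutoff [e], although the absolute integral of [n] may blow
    up as e tends to 0. The uniformity comes from averaging [n] with its reflection in [x]. *)
Lemma near_lower (m a : R) : 2 <= m -> 0 < a -> a < m ->
  exists2 C : R, 0 <= C & forall S g r (x0 : X) x (e : R), 0 <= g -> 0 < r -> 0 < e -> `|x - x0| < r ->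
   let n y := (e <= `|x - y| < r *+ 2)%R%:R *
      (kern a (x - y) * Jfun m (parab S g r x0 x - parab S g r x0 y)) in
   leb.-integrable setT (fun y => (n y)%:E) /\
   ((- (C * g `^ (m - 1) * r `^ (- a)))%:E <= \int[leb]_y (n y)%:E)%E.
Proof.
move=> m2 a0 am; have ma0 : 0 < m - a by rewrite subr_gt0.
have m1 : 1 < m by lra.
have m0 : 0 < m by lra.
have m10 : 0 <= m - 1 by lra.
set T : R := (Num.truncn (m - 1)).+1%:R; have T0 : 0 <= T by rewrite /T.
set Kn := 8 ^+ N / (1 - 2 `^ (- (m - a))).
have Kn0 : 0 <= Kn.
  have /andP[_ h] := pow2N_lt1 ma0.
  by rewrite divr_ge0 ?exprn_ge0// subr_ge0 ltW.
exists (T * N%:R / 4 * (4 * N%:R) `^ (m - 1) * 2 `^ (m - a) * Kn).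
  apply: mulr_ge0 Kn0; apply: mulr_ge0 (powR_ge0 _ _); apply: mulr_ge0 (powR_ge0 _ _).
  by rewrite divr_ge0// mulr_ge0.
move=> S g r x0 x e g0 r0 e0 xr n.
have r20 : 0 < r *+ 2 by rewrite pmulrn_lgt0.
have mP := measurable_parab S g r x0.
have md := @measurable_rV_distr R N x.
have mn : measurable_fun setT n.
  apply: measurable_funM.
    apply: measurable_natb; apply: measurable_and.
      by apply: measurable_fun_ler.
    by apply: measurable_fun_ltr.
  apply: measurable_funM; first exact: measurable_kern1.
  by apply: measurable_Jfun; apply: measurable_funB.
have PA y (yr : `|x - y| < r *+ 2) := parab_near S g0 r0 xr yr.
have in1 : leb.-integrable setT (fun y => (n y)%:E).
  pose h y : R := (8 * N%:R * g) `^ (m - 1) * ((e <= `|x - y|)%R%:R * `|x - y| `^ (- (N%:R + a))).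
  have mh : measurable_fun setT h.
    apply: measurable_funM => //; apply: measurable_funM.
      by apply: measurable_natb; apply: measurable_fun_ler.
    by apply: measurable_powR_comp.
  apply: (@integrable_bound _ _ _ leb n h ((8 * N%:R * g) `^ (m - 1) *
     (4 ^+ N * e `^ (- a) / (1 - 2 `^ (- a))))) => //.
    move=> y; rewrite /n /h normrM normr_nat.
    have [h1|h1] /= := leP e `|x - y|; last by rewrite !mul0r mulr0.
    have [h2|h2] /= := ltP `|x - y| (r *+ 2); last first.
      by rewrite mul0r mulr_ge0 ?powR_ge0// mul1r powR_ge0.
    rewrite !mul1r normrM (ger0_norm (kern_ge0 _ _)) mulrC Jfun_norm//.
    rewrite ler_pM ?powR_ge0 ?kern_ge0 ?kern_le// ge0_ler_powR ?nnegrE ?mulr_ge0//.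
    apply: (le_trans (PA _ h2)).
    apply: (@le_trans _ _ (4 * N%:R * g / r * (r *+ 2))).
      by apply: ler_wpM2l (ltW h2); rewrite divr_ge0 ?(ltW r0)// mulr_ge0.
    by rewrite le_eqVlt; apply/orP; left; apply/eqP; rewrite mulr2n; field; rewrite gt_eqF.
  rewrite /h ge0_integral_scale ?powR_ge0//.
  - rewrite EFinM lee_wpmul2l ?lee_fin ?powR_ge0//; exact: integral_far.
  - apply: measurable_funM; last exact: measurable_powR_comp.
    by apply: measurable_natb; apply: measurable_fun_ler.
split=> //.
have [in2 I2] := integral_reflect (x + x) in1.
pose B := T * N%:R / (2 * r) * (4 * N%:R * g / r) `^ (m - 1).
have B0 : 0 <= B.
  apply: mulr_ge0 (powR_ge0 _ _); apply: divr_ge0; first exact: mulr_ge0.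
  by rewrite mulr_ge0// ltW.
pose h y : R := (`|x - y| < r *+ 2)%R%:R * (`|x - y| `^ (m - a) * `|x - y| `^ (- N%:R)).
have h0 y : 0 <= h y by rewrite !mulr_ge0 ?powR_ge0.
have mh : measurable_fun setT h.
  apply: measurable_funM.
    by apply: measurable_natb; apply: measurable_fun_ltr.
  by apply: measurable_funM; exact: measurable_powR_comp.
have Ih := integral_near x ma0 r20; rewrite -/h in Ih.
have point y : - (B * h y) <= n y + n (x + x - y).
  have xxy : x - (x + x - y) = - (x - y) by rewrite -addrA !opprD opprK !addrA subrr sub0r.
  have -> : n (x + x - y) = (e <= `|x - y| < r *+ 2)%R%:R *
      (kern a (x - y) * Jfun m (parab S g r x0 x - parab S g r x0 (x + x - y))).
    by rewrite /n xxy normrN kernN.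
  rewrite /n /h; have [h1|h1] /= := leP e `|x - y|; last first.
    by rewrite !mul0r addr0 oppr_le0 mulr_ge0.
  have [h2|h2] /= := ltP `|x - y| (r *+ 2); last by rewrite !mul0r mulr0 addr0 oppr0.
  rewrite !mul1r -mulrDr; exact: parab_pair_lower (lt_le_trans e0 h1) h2.
have mni : measurable_fun setT (fun y => n (x + x - y)).
  exact: (measurableT_comp mn (measurable_reflect (x + x))).
have iBh : leb.-integrable setT (fun y => (- (B * h y))%:E).
  apply: (@integrable_bound _ _ _ leb _ (fun y => B * h y) (B * (8 ^+ N * (r *+ 2) `^ (m - a) / (1 - 2 `^ (- (m - a)))))).
  - by apply: measurableT_comp => //; exact: measurable_funM.
  - exact: measurable_funM.
  - by move=> y; rewrite normrN ger0_norm// mulr_ge0.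
  - by rewrite ge0_integral_scale// [leRHS]EFinM lee_wpmul2l ?lee_fin.
(* The truncated domain is symmetric about [x], so twice the integral of [n] is the integral of
   [n y + n (x + x - y)], to which the paired bound applies. *)
have twice : (\int[leb]_y (- (B * h y))%:E <= \int[leb]_y (n y)%:E + \int[leb]_y (n y)%:E)%E.
  rewrite -[X in (_ <= _ + X)%E]I2 -integralD//.
  by apply: le_integral => //; [exact: integrableD|move=> y _; rewrite -EFinD lee_fin].
have low : ((- (B * (8 ^+ N * (r *+ 2) `^ (m - a) / (1 - 2 `^ (- (m - a))))))%:E <=
    \int[leb]_y (- (B * h y))%:E)%E.
  have -> : (\int[leb]_y (- (B * h y))%:E = - \int[leb]_y (B * h y)%:E)%E.
    rewrite -integral_ge0N//.
    by move=> y _; rewrite lee_fin mulr_ge0.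
  by rewrite EFinN leeN2 ge0_integral_scale// [leRHS]EFinM lee_wpmul2l ?lee_fin.
have := le_trans low twice.
have fI : (\int[leb]_y (n y)%:E)%E \is a fin_num by exact: integrable_fin_num.
rewrite -(fineK fI) -EFinD !lee_fin => K.
rewrite (near_constant a T (8 ^+ N) (1 - 2 `^ (- (m - a))) (ler0n _ N) m10 g0 r0).
by rewrite -/B -/(8 ^+ N * _ / _); move: K; lra.
Qed.
End parabola.

(** * Long-range interactions *)

Section far.
Context (R : realType) (N : nat).
Local Notation X := 'rV[R]_N.
Local Notation leb := (lebesgue_rV R N).
Implicit Types (x y : X) (S g r : R).

Lemma far_constant1 (m a n om r : R) k : 0 <= n -> 0 <= om -> 0 < r ->
  (n * (7 * r)) `^ (- (k%:R + a)) * (om / 4) `^ (m - 1) * ((6 * r) ^+ k / 2) =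
  6 ^+ k * (n * 7) `^ (- (k%:R + a)) * (4^-1) `^ (m - 1) / 2 * om `^ (m - 1) * r `^ (- a).
Proof.
move=> n0 om0 r0; have rn : (r == 0) = false by rewrite gt_eqF.
rewrite [n * (7 * r)]mulrA (powRM _ (mulr_ge0 n0 (ler0n _ 7)) (ltW r0)).
rewrite (powRM _ om0 (_ : 0 <= 4^-1)) ?invr_ge0// exprMn.
have -> : r `^ (- a) = r `^ (- (k%:R + a)) * r ^+ k.
  by rewrite -powR_mulrn ?(ltW r0)// -powRD ?rn ?implybT//; congr (_ `^ _); ring.
by field.
Qed.

Lemma far_constant2 (m a K ga om r : R) : 0 <= ga -> 0 <= om -> 0 < r ->
  (2 * (ga * om)) `^ (m - 1) * (2 / r) `^ (a / 2) * (K * (r *+ 2) `^ (- (a / 2))) =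
  2 `^ (m - 1) * K * ga `^ (m - 1) * om `^ (m - 1) * r `^ (- a).
Proof.
move=> ga0 om0 r0; have rn : (r == 0) = false by rewrite gt_eqF.
have ri : 0 <= r^-1 by rewrite invr_ge0 ltW.
rewrite (powRM _ (ler0n _ 2) (mulr_ge0 ga0 om0)) (powRM _ ga0 om0) (powRM _ (ler0n _ 2) ri).
rewrite -[r *+ 2]mulr_natl (powRM _ (ler0n _ 2) (ltW r0)).
have -> : r `^ (- a) = r^-1 `^ (a / 2) * r `^ (- (a / 2)).
  rewrite -[r^-1]powR_inv1 ?(ltW r0)// -powRrM -powRD ?rn ?implybT//.
  by congr (_ `^ _); field.
rewrite [2 `^ (- (a / 2))]powRN; have : 2 `^ (a / 2) != 0 :> R by rewrite gt_eqF ?powR_gt0.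
move: (2 `^ (a / 2)) => w wn.
by field.
Qed.

(** The tail may grow like d^eta; since eta (m - 1) <= a / 2, it consumes at most half of the decay
    exponent [a] of the kernel and stays integrable. *)
Lemma far_pointwise (m a S om ga eta r d vx vy : R) : 1 < m -> 0 <= ga -> 0 <= om ->
  0 < r -> r *+ 2 <= d -> 0 <= eta -> eta * (m - 1) <= a / 2 ->
  S - ga * om <= vx -> vy <= S + ga * om * (2 * d / r) `^ eta ->
  - ((2 * (ga * om)) `^ (m - 1) * (2 / r * d) `^ (a / 2)) <= Jfun m (vx - vy).
Proof.
move=> m1 ga0 om0 r0 rd eta0 etam hx hy.
have d0 : 0 < d by apply: lt_le_trans rd; rewrite pmulrn_lgt0.
have E : 2 * d / r = 2 / r * d by rewrite mulrAC.
rewrite E in hy.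
have t1 : 1 <= 2 / r * d.
  by rewrite mulrAC ler_pdivlMr// mul1r; move: rd; rewrite mulr2n; lra.
have go : 0 <= ga * om by exact: mulr_ge0.
have te1 : 1 <= (2 / r * d) `^ eta by rewrite -[leLHS](powRr0 (2 / r * d)) ler_powR.
have low : - (2 * (ga * om) * (2 / r * d) `^ eta) <= vx - vy.
  have : ga * om * 1 <= ga * om * (2 / r * d) `^ eta by rewrite ler_wpM2l.
  lra.
apply: le_trans (Jfun_le m1 low).
have b0 : 0 <= 2 * (ga * om) by rewrite mulr_ge0.
rewrite JfunN lerN2 (Jfun_ge0E m1) ?mulr_ge0 ?powR_ge0//.
rewrite (powRM _ b0 (powR_ge0 _ _)) ler_wpM2l ?powR_ge0// -powRrM.
by rewrite ler_powR.
Qed.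

(** Points of [G] give a gain of order om^(m - 1), and everything else at long range loses at most a
    multiple of (ga om)^(m - 1). The bound [M] only secures integrability; [c] and [C] are chosen
    before it. *)
Lemma far_lower (m a : R) : (1 <= N)%N -> 1 < m -> 0 < a ->
  exists c C : R, [/\ 0 < c, 0 <= C &
   forall (v : X -> R) (x0 x : X) (S om ga eta M r : R),
     measurable_fun setT v -> (forall y, `|v y| <= M) ->
     0 < r -> 0 < om -> 0 <= ga -> ga <= 4^-1 -> 0 <= eta -> eta * (m - 1) <= a / 2 ->
     `|x - x0| < r -> S - ga * om <= v x ->
     (forall y, r *+ 2 <= `|x - y| -> v y <= S + ga * om * (2 * `|x - y| / r) `^ eta) ->
     (((6 * r) ^+ N / 2)%:E <= leb ([set y | (v y <= S - om / 2)%R] `&`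
         [set y | (r * 3 <= `|y - x0| < r * 6)%R]))%E ->
     let f y := (r *+ 2 <= `|x - y|)%R%:R * (kern a (x - y) * Jfun m (v x - v y)) in
     leb.-integrable setT (fun y => (f y)%:E) /\
     (((c - C * ga `^ (m - 1)) * om `^ (m - 1) * r `^ (- a))%:E <= \int[leb]_y (f y)%:E)%E].
Proof.
move=> N1 m1 a0; have a20 : 0 < a / 2 by rewrite divr_gt0.
have N0 : 0 < N%:R :> R by rewrite ltr0n.
set K := 4 ^+ N / (1 - 2 `^ (- (a / 2))).
have K0 : 0 <= K.
  have /andP[_ h] := pow2N_lt1 a20.
  by rewrite divr_ge0 ?exprn_ge0// subr_ge0 ltW.
exists (6 ^+ N * (N%:R * 7) `^ (- (N%:R + a)) * (4^-1) `^ (m - 1) / 2), (2 `^ (m - 1) * K).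
split.
- apply: divr_gt0 => //; apply: mulr_gt0; last by rewrite powR_gt0// invr_gt0.
  by apply: mulr_gt0; [exact: exprn_gt0|rewrite powR_gt0// mulr_gt0].
- by apply: mulr_ge0 K0; exact: powR_ge0.
move=> v x0 x S om ga eta M r mv vM r0 om0 ga0 ga4 eta0 etam xr vx vfar.
set G := _ `&` _ => hG f.
have r20 : 0 < r *+ 2 by rewrite pmulrn_lgt0.
have md := @measurable_rV_distr R N x.
have mb : measurable_fun setT (fun y : X => (r *+ 2 <= `|x - y|)%R%:R : R).
  by apply: measurable_natb; apply: measurable_fun_ler.
have mf : measurable_fun setT f.
  apply: measurable_funM => //; apply: measurable_funM; first exact: measurable_kern1.
  by apply: measurable_Jfun; apply: measurable_funB.
have mG : measurable G.
  apply: measurableI.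
    have -> : [set y | v y <= S - om / 2] = ~` [set y | S - om / 2 < v y].
      by apply/seteqP; split=> y /=; [move=> h; rewrite leNgt in h; exact/negP|move/negP; rewrite -leNgt].
    apply: measurableC.
    rewrite (_ : [set x | _] = setT `&` v @^-1` `]S - om / 2, +oo[%classic); first exact: mv.
    by apply/seteqP; split=> y /=; rewrite in_itv/= andbT; [|case].
  have -> : [set y : X | r * 3 <= `|y - x0| < r * 6] =
     [set y : X | `|y - x0| < r * 6] `\` [set y : X | `|y - x0| < r * 3].
    apply/seteqP; split=> y /=; first by move=> /andP[h1 h2]; split=> //; rewrite ltNge h1.
    by move=> [h1 /negP h2]; rewrite h1 andbT leNgt.
  by apply: measurableD; exact: measurable_rV_ball.
have M0 : 0 <= M := le_trans (normr_ge0 _) (vM x).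
have pl (b C : R) (b0 : 0 < b) (C0 : 0 <= C) :
    (\int[leb]_y (C * ((r *+ 2 <= `|x - y|)%R%:R * `|x - y| `^ (- (N%:R + b))))%:E <=
      (C * (4 ^+ N * (r *+ 2) `^ (- b) / (1 - 2 `^ (- b))))%:E)%E.
  rewrite (ge0_integral_scale _ C0); [|by move=> y; rewrite mulr_ge0 ?powR_ge0|
    by apply: measurable_funM => //; exact: measurable_powR_comp].
  by rewrite EFinM lee_wpmul2l ?lee_fin//; exact: integral_far.
have mh (b C : R) : measurable_fun setT
    (fun y : X => C * ((r *+ 2 <= `|x - y|)%R%:R * `|x - y| `^ (- (N%:R + b))) : R).
  by apply: measurable_funM => //; apply: measurable_funM => //; exact: measurable_powR_comp.
have intf : leb.-integrable setT (fun y => (f y)%:E).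
  apply: (integrable_bound mf (mh a ((2 * M) `^ (m - 1))) _ (pl _ _ a0 (powR_ge0 _ _))).
  move=> y; rewrite /f normrM normr_nat [leRHS]mulrCA ler_wpM2l//.
  rewrite normrM (ger0_norm (kern_ge0 _ _)) mulrC Jfun_norm// ler_pM ?powR_ge0 ?kern_ge0 ?kern_le//.
  apply: ge0_ler_powR; rewrite ?nnegrE ?mulr_ge0//; first by rewrite subr_ge0 ltW.
  by rewrite (le_trans (ler_normB _ _))// mulr_natl mulr2n lerD.
split=> //.
set D := (2 * (ga * om)) `^ (m - 1) * (2 / r) `^ (a / 2).
have D0 : 0 <= D by apply: mulr_ge0; exact: powR_ge0.
pose g2 y : R := D * ((r *+ 2 <= `|x - y|)%R%:R * `|x - y| `^ (- (N%:R + a / 2))).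
have Ig2 := pl _ _ a20 D0; rewrite -/g2 in Ig2.
have mg2 : measurable_fun setT g2 := mh (a / 2) D.
have g20 y : 0 <= g2 y by apply: mulr_ge0 D0 _; rewrite mulr_ge0 ?powR_ge0.
have intg2 : leb.-integrable setT (fun y => (g2 y)%:E).
  by apply: (integrable_bound mg2 mg2 _ Ig2) => y; rewrite ger0_norm.
(* Lower bound for the integrand on [G]: the kernel at distance at most r + 6r = 7r, times J_m of
   om/2 - ga om >= om/4. *)
set c1 := (N%:R * (7 * r)) `^ (- (N%:R + a)) * (om / 4) `^ (m - 1).
have c10 : 0 <= c1 by apply: mulr_ge0; exact: powR_ge0.
have fD y : r *+ 2 <= `|x - y| -> - g2 y <= f y.
  move=> dy; rewrite /g2 /f dy !mul1r.
  have k0 := kern_ge0 a (x - y).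
  have d0 : 0 < `|x - y| := lt_le_trans r20 dy.
  have := @far_pointwise m a S om ga eta r `|x - y| (v x) (v y) m1 ga0 (ltW om0) r0 dy
     eta0 etam vx (vfar y dy).
  move=> /(ler_wpM2l k0); apply: le_trans; rewrite mulrN lerN2 [leLHS]mulrCA /D -[leRHS]mulrA.
  rewrite ler_wpM2l ?powR_ge0// powRM ?divr_ge0 ?(ltW r0)// mulrCA ler_wpM2l ?powR_ge0//.
  have -> : - (N%:R + a / 2) = - (N%:R + a) + a / 2 by field.
  by rewrite powRD ?(gt_eqF d0) ?implybT// ler_wpM2r ?powR_ge0// kern_le.
have point y : c1 * \1_G y <= f y + g2 y.
  have [yG|yG] := boolP (y \in G); last first.
    rewrite indicE (negbTE yG) mulr0.
    have [dy|dy] := leP (r *+ 2) `|x - y|; first by have := fD y dy; lra.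
    by rewrite /f /g2 (leNgt (r *+ 2)) dy/= !mul0r mulr0 addr0.
  rewrite indicE yG mulr1; rewrite inE in yG; have [/= vy /andP[y3 y6]] := yG.
  (* The annulus starts at radius 3r precisely so that [G] lies in the long range of every [x] in
     the ball of radius r. *)
  have dy : r *+ 2 <= `|x - y|.
    have : `|y - x0| <= `|y - x| + `|x - x0| by rewrite -[y - x0](subrKA x) ler_normD.
    by rewrite [`|x - y|]distrC mulr2n; lra.
  have dy7 : `|x - y| <= 7 * r.
    have : `|x - y| <= `|x - x0| + `|x0 - y| by rewrite -[x - y](subrKA x0) ler_normD.
    by rewrite [`|x0 - y|]distrC; lra.
  have : c1 <= f y; last by have := g20 y; lra.
  rewrite /f dy mul1r /c1 ler_pM ?powR_ge0//.
    by apply: kern_ge => //; exact: lt_le_trans dy.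
  have om4 : 0 <= om / 4 by rewrite divr_ge0 ?(ltW om0).
  rewrite -(Jfun_ge0E m1 om4); apply: Jfun_le => //.
  have : ga * om <= 4^-1 * om by rewrite ler_wpM2r// ltW.
  by lra.
have leG : (leb G <= leb [set y : X | (`|y - x0| < r * 6)%R])%E.
  apply: le_measure; rewrite ?inE//; first exact: measurable_rV_ball.
  by move=> y [_ /= /andP[]].
have r60 : 0 < r * 6 by rewrite mulr_gt0.
have intg1 : leb.-integrable setT (fun y => (c1 * \1_G y)%:E).
  have mc1 : measurable_fun setT (fun y => c1 * \1_G y : R).
    by apply: measurable_funM => //; exact: measurable_indic.
  apply: (@integrable_bound _ _ _ leb _ _ (c1 * (r * 6 *+ 2) ^+ N) mc1 mc1).
    by move=> y; rewrite ger0_norm// mulr_ge0// indicE.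
  rewrite (ge0_integral_scale _ c10); [|by move=> y; rewrite indicE|exact: measurable_indic].
  rewrite integral_indic// setIT [leRHS]EFinM lee_wpmul2l ?lee_fin//.
  by apply: (le_trans leG); rewrite le_eqVlt; apply/orP; left; apply/eqP; exact: lebesgue_rV_ball.
have : (\int[leb]_y (c1 * \1_G y)%:E <= \int[leb]_y (f y)%:E + \int[leb]_y (g2 y)%:E)%E.
  rewrite -integralD//; apply: le_integral => //; first exact: integrableD.
  by move=> y _; rewrite -EFinD lee_fin.
have low : ((c1 * ((6 * r) ^+ N / 2))%:E <= \int[leb]_y (c1 * \1_G y)%:E)%E.
  rewrite (ge0_integral_scale _ c10); [|by move=> y; rewrite indicE|exact: measurable_indic].
  by rewrite integral_indic// setIT [leLHS]EFinM lee_wpmul2l ?lee_fin.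
move=> /(le_trans low).
have fI : (\int[leb]_y (f y)%:E)%E \is a fin_num by exact: integrable_fin_num.
have gI : (\int[leb]_y (g2 y)%:E)%E \is a fin_num by exact: integrable_fin_num.
move: Ig2; rewrite -(fineK fI) -(fineK gI) -EFinD !lee_fin.
have -> : 4 ^+ N * (r *+ 2) `^ (- (a / 2)) / (1 - 2 `^ (- (a / 2))) = K * (r *+ 2) `^ (- (a / 2)).
  by rewrite /K mulrAC.
rewrite /D (far_constant2 m a K ga0 (ltW om0) r0) /c1.
rewrite (far_constant1 m a N (ltW N0) (ltW om0) r0).
rewrite mulrBl mulrBl.
move: (fine _) (fine _) (_ * r `^ _) (_ * r `^ _) => w1 w2 w3 w4; lra.
Qed.
End far.

(** * Lower bound for the weak form *)

Section form_lower_bound.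
Context (R : realType) (N : nat).
Local Notation X := 'rV[R]_N.
Local Notation leb := (lebesgue_rV R N).
Implicit Types (x y : X) (S g r : R).

(* The cutoff e <= |x - y| makes the slice integrals converge absolutely; e tends
   to 0 by dominated convergence. *)
Definition split_kernel (m a S g r e : R) (x0 : X) (v : X -> R) (z : X * X) : R :=
  (e <= `|z.1 - z.2|)%R%:R * (kern a (z.1 - z.2) *
    Jfun m (if `|z.1 - z.2| < r *+ 2
            then parab S g r x0 z.1 - parab S g r x0 z.2 else v z.1 - v z.2)).

Lemma measurable_split_kernel (m a S g r e : R) (x0 : X) (v : X -> R) :
  measurable_fun setT v -> measurable_fun setT (split_kernel m a S g r e x0 v).
Proof.
move=> mv; have md := @measurable_rV_dist R N.
apply: measurable_funM.
  by apply: measurable_natb; apply: measurable_fun_ler.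
apply: measurable_funM; first exact: measurable_kern.
apply: measurable_Jfun; apply: measurable_fun_ifT.
- exact: measurable_fun_ltr.
- exact: (measurable_diff (measurable_parab S g r x0)).
- exact: measurable_diff.
Qed.

Lemma split_kernel_anti (m a S g r e : R) (x0 : X) (v : X -> R) x y :
  split_kernel m a S g r e x0 v (y, x) = - split_kernel m a S g r e x0 v (x, y).
Proof.
rewrite /split_kernel/= distrC kernC -mulrN -mulrN -JfunN; congr (_ * (_ * Jfun _ _)).
by case: ifP => _; rewrite opprB.
Qed.

Lemma split_kernel_bound (m a S g r e M : R) (x0 : X) (v : X -> R) x y :
  1 < m -> 0 < a -> 0 <= g -> 0 < r -> (forall y, `|v y| <= M) -> `|x - x0| < r ->
  `|split_kernel m a S g r e x0 v (x, y)| <=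
  ((8 * N%:R * g) `^ (m - 1) + (2 * M) `^ (m - 1)) *
    ((e <= `|x - y|)%R%:R * `|x - y| `^ (- (N%:R + a))).
Proof.
move=> m1 a0 g0 r0 vM xr; rewrite /split_kernel/= normrM normr_nat [leRHS]mulrCA ler_wpM2l//.
rewrite normrM (ger0_norm (kern_ge0 _ _)) mulrC Jfun_norm//.
rewrite ler_pM ?powR_ge0 ?kern_ge0 ?kern_le//.
have M0 : 0 <= M := le_trans (normr_ge0 _) (vM x).
have p0 : 0 <= m - 1 by rewrite subr_ge0 ltW.
case: ltP => h.
  rewrite (@le_trans _ _ ((8 * N%:R * g) `^ (m - 1)))//; last by rewrite lerDl powR_ge0.
  apply: (ge0_ler_powR p0); rewrite ?nnegrE ?mulr_ge0//.
  apply: (le_trans (parab_near S g0 r0 xr h)).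
  apply: (@le_trans _ _ (4 * N%:R * g / r * (r *+ 2))).
    by apply: ler_wpM2l (ltW h); rewrite divr_ge0 ?(ltW r0)// mulr_ge0.
  by rewrite le_eqVlt; apply/orP; left; apply/eqP; rewrite mulr2n; field; rewrite gt_eqF.
rewrite (@le_trans _ _ ((2 * M) `^ (m - 1)))//; last by rewrite lerDr powR_ge0.
apply: (ge0_ler_powR p0); rewrite ?nnegrE ?mulr_ge0//.
by rewrite (le_trans (ler_normB _ _))// mulr_natl mulr2n lerD.
Qed.

Lemma inner_lower (m a : R) : (1 <= N)%N -> 2 <= m -> 0 < a -> a < m ->
  exists c ga0 : R, [/\ 0 < c, 0 < ga0, ga0 <= 4^-1 &
   forall (v : X -> R) (x0 x : X) (S om ga eta M r e : R),
     measurable_fun setT v -> (forall y, `|v y| <= M) ->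
     0 < r -> 0 < om -> 0 <= ga -> ga <= ga0 -> 0 <= eta -> eta * (m - 1) <= a / 2 ->
     0 < e -> e < r *+ 2 ->
     `|x - x0| < r -> S - ga * om <= v x ->
     (forall y, r *+ 2 <= `|x - y| -> v y <= S + ga * om * (2 * `|x - y| / r) `^ eta) ->
     (((6 * r) ^+ N / 2)%:E <= leb ([set y | (v y <= S - om / 2)%R] `&`
         [set y | (r * 3 <= `|y - x0| < r * 6)%R]))%E ->
     ((c * om `^ (m - 1) * r `^ (- a))%:E <=
       \int[leb]_y (split_kernel m a S (ga * om) r e x0 v (x, y))%:E)%E].
Proof.
move=> N1 m2 a0 am; have m1 : 1 < m by lra.
have [C1 C10 near] := near_lower N m2 a0 am.
have [c [C [c0 C0 far]]] := far_lower N1 m1 a0.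
have CC0 : 0 < C + C1 + 1 by lra.
have g1 : 0 < c / (2 * (C + C1 + 1)) by rewrite divr_gt0// mulr_gt0.
(* Since ga <= 1 and m - 1 >= 1, ga^(m - 1) <= ga; the second entry of the minimum then makes the
   short-range and tail losses together at most half of the gain [c]. *)
exists (c / 2), (Num.min 4^-1 (c / (2 * (C + C1 + 1)))); split.
- by rewrite divr_gt0.
- by rewrite lt_min g1 invr_gt0 ltr0n.
- by rewrite ge_min lexx.
move=> v x0 x S om ga eta M r e mv vM r0 om0 ga0; rewrite le_min => /andP[ga4 gac].
move=> eta0 etam e0 er xr vx vfar hG.
have [inf lowf] := far v x0 x S om ga eta M r mv vM r0 om0 ga0 ga4 eta0 etam xr vx vfar hG.
have [inn lown] := near S (ga * om) r x0 x e (mulr_ge0 ga0 (ltW om0)) r0 e0 xr.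
under eq_integral => y _.
  rewrite (_ : split_kernel m a S (ga * om) r e x0 v (x, y) =
    (e <= `|x - y| < r *+ 2)%R%:R *
      (kern a (x - y) * Jfun m (parab S (ga * om) r x0 x - parab S (ga * om) r x0 y)) +
    (r *+ 2 <= `|x - y|)%R%:R * (kern a (x - y) * Jfun m (v x - v y))); last first.
    rewrite /split_kernel/=; case: ltP => h /=.
      by rewrite andbT mul0r addr0.
    by rewrite andbF mul0r add0r (ltW (lt_le_trans er h)).
  rewrite EFinD; over.
rewrite integralD//.
apply: le_trans (leeD lown lowf); rewrite -EFinD lee_fin.
rewrite (powRM _ ga0 (ltW om0)).
have gam : ga `^ (m - 1) <= ga.
  have [->|gan] := eqVneq ga 0; first by rewrite powR0//; lra.
  rewrite -[leRHS](powRr1 ga0) ger_powR//; last lra.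
  by rewrite lt_neqAle eq_sym gan ga0; lra.
have h1 : (C + C1) * ga `^ (m - 1) <= c / 2.
  have h2 : (C + C1) * ga `^ (m - 1) <= (C + C1 + 1) * ga.
    by apply: ler_pM; rewrite ?powR_ge0//; lra.
  apply: (le_trans h2); move: gac; rewrite ler_pdivlMr ?mulr_gt0//; lra.
have W0 : 0 <= om `^ (m - 1) * r `^ (- a) by rewrite mulr_ge0 ?powR_ge0.
have -> : - (C1 * (ga `^ (m - 1) * om `^ (m - 1)) * r `^ (- a)) +
   (c - C * ga `^ (m - 1)) * om `^ (m - 1) * r `^ (- a) =
   (c - (C + C1) * ga `^ (m - 1)) * (om `^ (m - 1) * r `^ (- a)) by ring.
by rewrite -mulrA ler_wpM2r//; lra.
Qed.

(** At short range, the larger value of [phi] decides which increment is larger, that of [v] or that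
    of the parabola; as J_m is increasing, the form dominates the one built from [split_kernel]. The
    latter is antisymmetric, so slice bounds uniform in [e] carry over. *)
Lemma form_lower (m a c : R) (v phi : X -> R) (x0 : X) (S g M r L : R) :
  1 < m -> 0 < a -> 0 < r -> 0 <= g ->
  measurable_fun setT v -> (forall y, `|v y| <= M) ->
  measurable_fun setT phi -> (forall x, 0 <= phi x) ->
  (forall x, phi x != 0 -> `|x - x0| < r) ->
  (forall x y, `|x - y| < r *+ 2 -> phi y < phi x ->
     parab S g r x0 x - parab S g r x0 y <= v x - v y) ->
  (\int[leb]_x (phi x)%:E = L%:E)%E ->
  (leb \x leb)%E.-integrable [set: X * X]
    (fun z => (Jfun m (v z.1 - v z.2) * (phi z.1 - phi z.2) * kern a (z.1 - z.2))%:E) ->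
  (forall e, 0 < e -> e < r *+ 2 -> forall x, phi x != 0 ->
     (c%:E <= \int[leb]_y (split_kernel m a S g r e x0 v (x, y))%:E)%E) ->
  ((2 * c * L)%:E <= \int[leb \x leb]_z
    (Jfun m (v z.1 - v z.2) * (phi z.1 - phi z.2) * kern a (z.1 - z.2))%:E)%E.
Proof.
move=> m1 a0 r0 g0 mv vM mphi phi0 phir mono phiL iW inner.
have M0 : 0 <= M := le_trans (normr_ge0 _) (vM x0).
have r20 : 0 < r *+ 2 by rewrite pmulrn_lgt0.
set W := fun z : X * X => Jfun m (v z.1 - v z.2) * (phi z.1 - phi z.2) * kern a (z.1 - z.2).
have mW : measurable_fun setT W by exact: measurable_weak.
have mtr e : measurable_fun [set: X * X] (fun z => (e <= `|z.1 - z.2|)%R%:R * W z).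
  apply: measurable_funM => //; apply: measurable_natb; apply: measurable_fun_ler => //.
  exact: measurable_rV_dist.
have step e : 0 < e -> e < r *+ 2 ->
    ((2 * c * L)%:E <= \int[leb \x leb]_z ((e <= `|z.1 - z.2|)%R%:R * W z)%:E)%E.
  move=> e0 er.
  set Cst := (8 * N%:R * g) `^ (m - 1) + (2 * M) `^ (m - 1).
  have C0 : 0 <= Cst by rewrite addr_ge0 ?powR_ge0.
  have mh : measurable_fun setT (fun t : R => Cst * ((e <= t)%R%:R * t `^ (- (N%:R + a)))).
    apply: measurable_funM => //; apply: measurable_funM; last exact: measurable_powR.
    by apply: measurable_natb; apply: measurable_fun_ler.
  have h0 (t : R) : 0 <= Cst * ((e <= t)%R%:R * t `^ (- (N%:R + a))).
    by apply: mulr_ge0 C0 _; rewrite mulr_ge0 ?powR_ge0.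
  have Kt : 0 <= 4 ^+ N * e `^ (- a) / (1 - 2 `^ (- a)).
    have /andP[_ h] := pow2N_lt1 a0.
    by rewrite divr_ge0 ?mulr_ge0 ?powR_ge0 ?exprn_ge0// subr_ge0 ltW.
  have hK (cc : X) : (\int[leb]_y (Cst * ((e <= `|cc - y|)%R%:R * `|cc - y| `^ (- (N%:R + a))))%:E
      <= (Cst * (4 ^+ N * e `^ (- a) / (1 - 2 `^ (- a))))%:E)%E.
    have md := @measurable_rV_distr R N cc.
    rewrite (ge0_integral_scale _ C0); [|by move=> y; rewrite mulr_ge0 ?powR_ge0|].
      by rewrite [leRHS]EFinM lee_wpmul2l ?lee_fin//; exact: integral_far.
    apply: measurable_funM; last exact: measurable_powR_comp.
    by apply: measurable_natb; apply: measurable_fun_ler.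
  have [iH lowH] := antisymmetric_form (measurable_split_kernel m a S g r e x0 mv) mphi mh phi0 h0
    (mulr_ge0 C0 Kt) (split_kernel_anti m a S g r e x0 v)
    (fun x y px => split_kernel_bound S e y m1 a0 g0 r0 vM (phir x px)) hK phiL (inner e e0 er).
  apply: (le_trans lowH); apply: le_integral => //.
    apply: (le_integrable measurableT _ _ iW); first exact/measurable_EFinP.
    by move=> z _; rewrite !abse_EFin lee_fin normrM normr_nat ler_piMl// lern1 leq_b1.
  move=> [x y] _; rewrite lee_fin /split_kernel /W/= -mulrA ler_wpM2l//.
  case: ltP => h; last by rewrite le_eqVlt; apply/orP; left; apply/eqP; ring.
  suff K : Jfun m (parab S g r x0 x - parab S g r x0 y) * (phi x - phi y) <=
      Jfun m (v x - v y) * (phi x - phi y).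
    have := ler_wpM2r (kern_ge0 a (x - y)) K.
    by move: (Jfun _ _) (Jfun _ _) (kern _ _) (phi x - phi y) => j1 j2 k D; clear; lra.
  have [E|E|E] := ltgtP (phi x) (phi y).
  - have := mono y x; rewrite distrC => /(_ h E) K.
    by apply: ler_wnM2r; [rewrite subr_le0 ltW|apply: Jfun_le => //; lra].
  - have K := mono x y h E.
    by apply: ler_wpM2r; [rewrite subr_ge0 ltW|exact: Jfun_le].
  - by rewrite E subrr !mulr0.
pose en (n : nat) : R := n.+1%:R^-1.
have en0 n : 0 < en n by rewrite invr_gt0.
have encvg : en @ \oo --> (0 : R) by exact: cvg_harmonic.
have [_ _ cvgW] : [/\ (leb \x leb)%E.-integrable setT (EFin \o W),
    [sequence (\int[leb \x leb]_z `|((en n <= `|z.1 - z.2|)%R%:R * W z)%:E - (W z)%:E|)%E]_n @ \oo --> 0%E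
  & [sequence (\int[leb \x leb]_z ((en n <= `|z.1 - z.2|)%R%:R * W z)%:E)%E]_n @ \oo -->
    (\int[leb \x leb]_z (W z)%:E)%E].
  apply: (@dominated_convergence _ _ _ (leb \x leb)%E setT measurableT
     (fun n z => ((en n <= `|z.1 - z.2|)%R%:R * W z)%:E) (EFin \o W) (abse \o (EFin \o W))).
  - by move=> n; exact/measurable_EFinP.
  - exact/measurable_EFinP.
  - apply: aeW => z _; apply: cvg_near_cst.
    (* Off the diagonal the cutoff is eventually 1, and on the diagonal [W] vanishes, so convergence
       holds at every point. *)
    have [d0|d0] := eqVneq `|z.1 - z.2| 0.
      have Wz : W z = 0.
        move/eqP: d0; rewrite normr_eq0 subr_eq0 => /eqP e.
        by rewrite /W e !subrr mulr0 mul0r.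
      by apply: nearW => n; rewrite /= Wz mulr0.
    have dp : 0 < `|z.1 - z.2| by rewrite lt_neqAle eq_sym d0 normr_ge0.
    have /cvgrPdist_lt /(_ _ dp) := encvg.
    apply: filterS => n; rewrite sub0r normrN ger0_norm ?(ltW (en0 n))// => h.
    by rewrite /= (ltW h) mul1r.
  - exact: integrable_abse.
  - by apply: aeW => z n _; rewrite /= lee_fin normrM normr_nat ler_piMl// lern1 leq_b1.
rewrite -(cvg_lim _ cvgW)//; apply: lime_ge; first by apply/cvg_ex; exists (\int[leb \x leb]_z (W z)%:E)%E.
have /cvgrPdist_lt /(_ _ r20) := encvg; apply: filterS => n.
rewrite sub0r normrN ger0_norm ?(ltW (en0 n))// => h; exact: step.
Qed.
End form_lower_bound.

(** * The growth lemma *)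

Section growth.
Context (R : realType) (N : nat).
Local Notation X := 'rV[R]_N.
Local Notation leb := (lebesgue_rV R N).
Implicit Types (x y : X) (S g r : R) (v : X -> R).

(** The cutoff changes nothing within radius 6r: there v <= S, and the parabola is at least S off
    the ball. It only removes the region further out, where [v] may exceed S. *)
Definition barrier_excess S g r (x0 : X) v (x : X) : R :=
  Num.max (v x - parab S g r x0 x) 0 * (`|x - x0| < r)%R%:R.

Section barrier.
Variables (S g r : R) (x0 : X) (v : X -> R).
Hypotheses (g0 : 0 <= g) (r0 : 0 < r) (vS : forall y, `|y - x0| < 6 * r -> v y <= S).
Local Notation P := (parab S g r x0).
Local Notation phi := (barrier_excess S g r x0 v).

Lemma excess_ge0 x : 0 <= phi x.
Proof. by rewrite mulr_ge0// le_max lexx orbT. Qed.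

Lemma excess_neq0 x : phi x != 0 -> [/\ `|x - x0| < r, P x < v x & phi x = v x - P x].
Proof.
rewrite /barrier_excess; case: ltP => h; last by rewrite mulr0 eqxx.
rewrite mulr1; have [h2|h2] := leP (v x - P x) 0; first by rewrite eqxx.
by split=> //; rewrite -subr_gt0.
Qed.

Lemma excess_near x : `|x - x0| < 6 * r -> phi x = Num.max (v x - P x) 0.
Proof.
move=> h; rewrite /barrier_excess; case: ltP => h1; first by rewrite mulr1.
rewrite mulr0 max_r// subr_le0 (le_trans (vS h))//.
exact: parab_ge_outside.
Qed.

Lemma excess_le x : phi x <= g * (`|x - x0| < r)%R%:R.
Proof.
rewrite /barrier_excess; case: ltP => h; last by rewrite !mulr0.
rewrite !mulr1 ge_max g0 andbT.
have r0' := r0; have h6 : `|x - x0| < 6 * r by lra.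
by have := vS h6; have := parab_ge S r x0 x g0; lra.
Qed.

(** As phi x > phi y >= 0, phi x equals v x - P x, while phi y is at least v y - P y; the short
    distance keeps y within radius 6r. *)
Lemma excess_mono x y : `|x - y| < r *+ 2 -> phi y < phi x -> P x - P y <= v x - v y.
Proof.
have r0' := r0; move=> d yx; have px : phi x != 0 by rewrite gt_eqF// (le_lt_trans (excess_ge0 y)).
have [xr xP xE] := excess_neq0 px.
have y6 : `|y - x0| < 6 * r.
  have : `|y - x0| <= `|y - x| + `|x - x0| by rewrite -[y - x0](subrKA x) ler_normD.
  by move: d; rewrite [`|y - x|]distrC mulr2n; lra.
move: yx; rewrite xE (excess_near y6) gt_max => /andP[h _]; lra.
Qed.

(** The factor 7 bounds |x - x0| + |y - x0| by r + 6r. For y further out phi y = 0 and |x - y| >=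
    5r, so the Lipschitz term alone exceeds phi x <= g. *)
Lemma excess_lip x y : (1 <= N)%N -> `|x - x0| < r ->
  `|phi x - phi y| <= `|v x - v y| + 7 * N%:R * g / r * `|x - y|.
Proof.
move=> N1 xr; have N1' : 1 <= N%:R :> R by rewrite ler1n.
have g0' := g0; have r0' := r0; have x6 : `|x - x0| < 6 * r by lra.
have [y6|y6] := ltP `|y - x0| (6 * r).
  rewrite !excess_near//.
  have L : `|P x - P y| <= 7 * N%:R * g / r * `|x - y|.
    apply: (le_trans (parab_lip _ _ _ _ _ g0)).
    have b0 : 0 <= g / r ^+ 2 * (N%:R * `|x - y|).
      by rewrite mulr_ge0 ?divr_ge0 ?sqr_ge0// mulr_ge0.
    have xy7 : `|x - x0| + `|y - x0| <= 7 * r by lra.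
    have := ler_wpM2l b0 xy7; rewrite -!mulrA => h; apply: (le_trans h).
    by rewrite le_eqVlt; apply/orP; left; apply/eqP; field; rewrite gt_eqF.
  have T : `|(v x - P x) - (v y - P y)| <= `|v x - v y| + `|P x - P y|.
    have -> : (v x - P x) - (v y - P y) = (v x - v y) - (P x - P y) by ring.
    exact: ler_normB.
  apply: (@le_trans _ _ `|(v x - P x) - (v y - P y)|); last by lra.
  move: (v x - P x) (v y - P y) => A B.
  have [hA|hA] := leP A 0; have [hB|hB] := leP B 0.
  - by rewrite subrr normr0.
  - by rewrite sub0r normrN gtr0_norm// distrC ger0_norm; lra.
  - by rewrite subr0 gtr0_norm// ger0_norm; lra.
  - by [].
have -> : phi y = 0.
  by rewrite /barrier_excess ltNge (le_trans _ y6) ?mulr0//; lra.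
rewrite subr0 ger0_norm ?excess_ge0//.
have := excess_le x; rewrite xr mulr1 => h; apply: (le_trans h).
apply: (@le_trans _ _ (7 * N%:R * g / r * `|x - y|)); last by rewrite lerDr.
have d : 5 * r <= `|x - y|.
  have : `|y - x0| <= `|y - x| + `|x - x0| by rewrite -[y - x0](subrKA x) ler_normD.
  by rewrite [`|y - x|]distrC; lra.
have c0 : 0 <= 7 * N%:R * g / r by rewrite divr_ge0 ?(ltW r0)// mulr_ge0.
apply: le_trans (ler_wpM2l c0 d).
have -> : 7 * N%:R * g / r * (5 * r) = 35 * (N%:R * g) by field; rewrite gt_eqF.
have : 1 * g <= N%:R * g by rewrite ler_wpM2r.
by lra.
Qed.

Lemma measurable_excess : measurable_fun setT v -> measurable_fun setT phi.
Proof.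
move=> mv; apply: measurable_funM.
  apply: measurable_maxr => //; apply: measurable_funB => //; exact: measurable_parab.
apply: measurable_natb; apply: measurable_fun_ltr => //.
by under eq_fun do rewrite distrC; exact: measurable_rV_distr.
Qed.

Lemma integral_excess : measurable_fun setT v ->
  exists2 L : R, 0 <= L & (\int[leb]_x (phi x)%:E = L%:E)%E.
Proof.
move=> mv; have mphi := measurable_excess mv.
have I0 : (0 <= \int[leb]_x (phi x)%:E)%E.
  by apply: integral_ge0 => x _; rewrite lee_fin excess_ge0.
have Ifin : (\int[leb]_x (phi x)%:E < +oo)%E.
  have mB := measurable_rV_ball x0 r.
  apply: (@le_lt_trans _ _ (\int[leb]_x (g * \1_[set x : X | `|x - x0| < r] x)%:E)%E).
    apply: ge0_integral_le => //.
    - exact: excess_ge0.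
    - move=> x; rewrite indicE; have [h|h] := boolP (`|x - x0| < r).
        by rewrite mem_set// (le_trans (excess_le x))// h.
      by rewrite (le_trans (excess_le x))// (negbTE h) mulr0 mulr_ge0.
    - by apply: measurable_funM => //; exact: measurable_indic.
  rewrite (ge0_integral_scale _ g0); [|by move=> y; rewrite indicE|exact: measurable_indic].
  rewrite integral_indic// setIT; apply: lte_mul_pinfty => //.
  by apply: (@le_lt_trans _ _ ((r *+ 2) ^+ N)%:E); [rewrite -(lebesgue_rV_ball x0 r0)|exact: ltry].
exists (fine (\int[leb]_x (phi x)%:E)%E); first exact: fine_ge0.
by rewrite fineK// ge0_fin_numE.
Qed.

End barrier.

Variables (s p q : R).
Hypotheses (N1 : (1 <= N)%N) (s0 : 0 < s) (s1 : s < 1) (q2 : 2 < q) (qp : q <= p).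
Hypothesis (spN : s * p < N%:R).

(** Let L be the integral of the excess. The p-form is at least 2 B L with B = c om^(p - 1) r^(-sp),
    the q-form is nonnegative and the right-hand side is at most F L. Since F < B this forces L =
    0. *)
Lemma growth_pointwise : exists c ga : R, [/\ 0 < c, 0 < ga, ga <= 4^-1 &
  forall v (f : X -> R) (x0 : X) (S om eta M F r : R),
    weak_eq s p q f v -> measurable_fun setT f -> (forall y, `|v y| <= M) ->
    0 < r -> 0 < om -> 0 <= eta -> eta * (p - 1) <= s * q / 2 ->
    (forall y, `|y - x0| < 6 * r -> v y <= S) ->
    (forall y, 6 * r <= `|y - x0| -> v y <= S + ga * om * (`|y - x0| / r) `^ eta) ->
    (((6 * r) ^+ N / 2)%:E <= leb ([set y | (v y <= S - om / 2)%R] `&`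
         [set y | (r * 3 <= `|y - x0| < r * 6)%R]))%E ->
    0 <= F -> {ae leb, forall y, `|y - x0| < r -> `|f y| <= F} ->
    F < c * om `^ (p - 1) * r `^ (- (s * p)) ->
    {ae leb, forall y, `|y - x0| < r -> v y <= parab S (ga * om) r x0 y}].
Proof.
have s1' := s1; have q2' := q2; have qp' := qp.
have p2 : 2 < p by exact: lt_le_trans qp.
have [p0 q0 p1 q1] : [/\ 0 < p, 0 < q, 1 < p & 1 < q] by split; lra.
have sqN : s * q < N%:R by apply: le_lt_trans spN; rewrite ler_wpM2l// ltW.
have sp0 : 0 < s * p by rewrite mulr_gt0.
have sq0 : 0 < s * q by rewrite mulr_gt0.
have sqsp : s * q <= s * p by rewrite ler_wpM2l// ltW.
have spp : s * p < p by rewrite gtr_pMl.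
have sqq : s * q < q by rewrite gtr_pMl.
have [cp [gp [cp0 gp0 gp4 Hp]]] := inner_lower N1 (ltW p2) sp0 spp.
have [cq [gq [cq0 gq0 gq4 Hq]]] := inner_lower N1 (ltW q2) sq0 sqq.
exists cp, (Num.min gp gq); split => //.
- by rewrite lt_min gp0.
- by rewrite ge_min gp4.
set ga := Num.min gp gq.
have ga0 : 0 <= ga by rewrite le_min !ltW.
have gap : ga <= gp by rewrite ge_min lexx.
have gaq : ga <= gq by rewrite ge_min lexx orbT.
move=> v f x0 S om eta M F r [[vp vq] veq] mf vM r0 om0 eta0 etap vS vout hG F0 fF Fsmall.
have [mv _ _] := (spaceDP v s0 p0 spN).1 vp.
have g0 : 0 <= ga * om by apply: mulr_ge0 ga0 (ltW om0).
pose phi := barrier_excess S (ga * om) r x0 v.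
have phi0 x : 0 <= phi x by exact: excess_ge0.
have mphi : measurable_fun setT phi by exact: measurable_excess.
have [L L0 phiL] := integral_excess g0 r0 vS mv.
have bump m : 0 < m -> s * m < N%:R -> spaceD s m v -> spaceD s m phi.
  move=> m0 smN vm.
  apply: (@spaceD_bump R N s m v phi x0 r (ga * om) (7 * N%:R * (ga * om) / r) _ m0 smN vm mphi r0 g0).
  - by rewrite s0.
  - by rewrite divr_ge0 ?(ltW r0)// mulr_ge0.
  - by move=> x; rewrite ger0_norm//; exact: excess_le.
  - by move=> x y; exact: excess_lip.
have phiW : spaceW s p q phi by split; exact: bump.
(* The growth bound is recentred from [x0] to [x]: at long range |y - x0| <= 2 |x - y|, which is the
   source of the factor 2. *)
have vfar x y : `|x - x0| < r -> r *+ 2 <= `|x - y| ->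
    v y <= S + ga * om * (2 * `|x - y| / r) `^ eta.
  move=> xr; rewrite mulr2n => xy.
  have [y6|y6] := ltP `|y - x0| (6 * r).
    by rewrite (le_trans (vS _ y6))// lerDl mulr_ge0 ?powR_ge0.
  rewrite (le_trans (vout _ y6))// lerD2l ler_wpM2l//.
  have ri : 0 <= r^-1 by rewrite invr_ge0 ltW.
  apply: (ge0_ler_powR eta0); rewrite ?nnegrE ?mulr_ge0// ler_wpM2r//.
  have : `|y - x0| <= `|y - x| + `|x - x0| by rewrite -[y - x0](subrKA x) ler_normD.
  by rewrite [`|y - x|]distrC; lra.
have core m c gm : 1 < m -> 0 < s * m -> spaceD s m v -> s * m < N%:R -> ga <= gm -> 0 < c ->
  eta * (m - 1) <= s * m / 2 ->
  (forall (v : X -> R) (x0 x : X) (S om ga eta M r e : R),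
     measurable_fun setT v -> (forall y, `|v y| <= M) ->
     0 < r -> 0 < om -> 0 <= ga -> ga <= gm -> 0 <= eta -> eta * (m - 1) <= s * m / 2 ->
     0 < e -> e < r *+ 2 ->
     `|x - x0| < r -> S - ga * om <= v x ->
     (forall y, r *+ 2 <= `|x - y| -> v y <= S + ga * om * (2 * `|x - y| / r) `^ eta) ->
     (((6 * r) ^+ N / 2)%:E <= leb ([set y | (v y <= S - om / 2)%R] `&`
         [set y | (r * 3 <= `|y - x0| < r * 6)%R]))%E ->
     ((c * om `^ (m - 1) * r `^ (- (s * m)))%:E <=
       \int[leb]_y (split_kernel m (s * m) S (ga * om) r e x0 v (x, y))%:E)%E) ->
  ((2 * (c * om `^ (m - 1) * r `^ (- (s * m))) * L)%:E <= weak_form s m v phi)%E.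
  move=> m1 sm0 vm smN gam c0 etam inner; rewrite weak_formE.
  have m0 : 0 < m := lt_trans ltr01 m1.
  apply: (@form_lower R N m (s * m) _ v phi x0 S (ga * om) M r L m1 sm0 r0 g0 mv vM mphi phi0).
  - by move=> x /excess_neq0[].
  - by move=> x y; exact: excess_mono.
  - exact: phiL.
  - exact: (integrable_weak s0 m1 smN vm (bump m m0 smN vm)).
  - move=> e e0 er x px; have [xr xP _] := excess_neq0 px.
    apply: (inner v x0 x S om ga eta M r e) => //.
    + by rewrite (le_trans _ (ltW xP))// parab_ge.
    + by move=> y; exact: vfar.
(* One tail exponent serves both operators: q <= p gives the condition for q, and sq <= sp the one
   for p. *)
have etaq : eta * (q - 1) <= s * q / 2.
  by apply: le_trans etap; rewrite ler_wpM2l//; lra.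
have etap' : eta * (p - 1) <= s * p / 2 by apply: (le_trans etap); lra.
have lowp := core p cp gp p1 sp0 vp spN gap cp0 etap' Hp.
have lowq := core q cq gq q1 sq0 vq sqN gaq cq0 etaq Hq.
have up : (\int[leb]_x (f x * phi x)%:E <= (F * L)%:E)%E.
  apply: (le_trans (lee_abs _)).
  apply: (le_trans (le_abse_integral _ measurableT _)).
    by apply/measurable_EFinP; exact: measurable_funM.
  rewrite EFinM -phiL -ge0_integral_scale//.
  apply: ae_ge0_le_integral => //.
  - by apply: measurableT_comp => //; apply/measurable_EFinP; exact: measurable_funM.
  - by move=> x _; rewrite lee_fin mulr_ge0.
  - by apply/measurable_EFinP; exact: measurable_funM.
  - apply: filterS fF => x hx _; rewrite abse_EFin lee_fin normrM (ger0_norm (phi0 x)).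
    have [px|px] := eqVneq (phi x) 0; first by rewrite -[X in _ <= _ * X]/(phi x) px !mulr0.
    by have [xr _ _] := excess_neq0 px; exact: (ler_wpM2r (phi0 x) (hx xr)).
have := leeD lowp lowq; rewrite veq// => /le_trans /(_ up).
rewrite -EFinD lee_fin => K.
have W1 : 0 <= cq * om `^ (q - 1) * r `^ (- (s * q)).
  by apply: mulr_ge0 (powR_ge0 _ _); apply: mulr_ge0 (ltW cq0) (powR_ge0 _ _).
have L00 : L = 0.
  apply/eqP; rewrite eq_le L0 andbT leNgt; apply/negP => Lp.
  move: K W1 Fsmall F0 Lp.
  move: (cq * _ * _) (cp * _ * _) => A B K A0 FB F0 Lp.
  have : F * L < B * L by rewrite ltr_pM2r.
  have : 0 <= A * L by exact: mulr_ge0.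
  have : 0 <= B * L by apply: mulr_ge0 (ltW _) L0; exact: le_lt_trans FB.
  by move: K; rewrite -mulrA -(mulrA _ A); lra.
have mE : measurable_fun setT (EFin \o phi) by exact/measurable_EFinP.
have : (\int[leb]_x `|(EFin \o phi) x| = 0)%E.
  rewrite -[RHS]/(0%:E) -L00 -phiL; apply: eq_integral => x _.
  by rewrite /= ger0_norm.
move=> /(ae_eq_integral_abs leb measurableT mE).1; apply: filterS => y h yr.
have [//|Py] := leP (v y) (parab S (ga * om) r x0 y).
have : phi y = 0 by have := h I; case.
rewrite /phi /barrier_excess yr mulr1 max_l; last by rewrite subr_ge0 ltW.
by move=> /eqP; rewrite subr_eq0 => /eqP e; move: Py; rewrite e ltxx.
Qed.
End growth.

(** * Reduction of the oscillation on one scale *)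

Section oscillation.
Context (R : realType) (N : nat).
Local Notation X := 'rV[R]_N.
Local Notation leb := (lebesgue_rV R N).
Implicit Types (x y : X) (S g r : R) (v u f : X -> R).
Variables (s p q : R).
Hypotheses (N1 : (1 <= N)%N) (s0 : 0 < s) (s1 : s < 1) (q2 : 2 < q) (qp : q <= p).
Hypothesis (spN : s * p < N%:R).

Lemma measurable_sublevel v c : measurable_fun setT v -> measurable [set y | v y <= c].
Proof.
move=> mv; rewrite (_ : [set x | _] = setT `&` v @^-1` `]-oo, c]%classic); first exact: mv.
by apply/seteqP; split=> y /=; rewrite in_itv/=; [|case].
Qed.

(** Redefining [v] on the exceptional null set makes the hypotheses hold everywhere. The conclusion
    is on N |y - x0| <= r/2, where the Euclidean distance is at most r/2 and the parabola has risen
    by only a quarter of its depth. *)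
Lemma growth_ae : exists c ga : R, [/\ 0 < c, 0 < ga, ga <= 4^-1 &
  forall v f (x0 : X) (S om eta M F r : R),
    weak_eq s p q f v -> measurable_fun setT f ->
    0 < r -> 0 < om -> 0 <= eta -> eta * (p - 1) <= s * q / 2 ->
    {ae leb, forall y, [/\ `|v y| <= M, `|y - x0| < 6 * r -> v y <= S &
      6 * r <= `|y - x0| -> v y <= S + ga * om * (`|y - x0| / r) `^ eta]} ->
    (((6 * r) ^+ N / 2)%:E <= leb ([set y | (v y <= S - om / 2)%R] `&`
         [set y | (r * 3 <= `|y - x0| < r * 6)%R]))%E ->
    0 <= F -> {ae leb, forall y, `|y - x0| < r -> `|f y| <= F} ->
    F < c * om `^ (p - 1) * r `^ (- (s * p)) ->
    {ae leb, forall y, N%:R * `|y - x0| <= r / 2 -> v y <= S - ga * om / 2}].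
Proof.
have s1' := s1; have q2' := q2; have qp' := qp.
have p2 : 2 < p by exact: lt_le_trans qp.
have [p0 q0] : 0 < p /\ 0 < q by split; lra.
have sqN : s * q < N%:R by apply: le_lt_trans spN; rewrite ler_wpM2l// ltW.
have [c [ga [c0 ga0 ga4 H]]] := growth_pointwise N1 s0 s1 q2 qp spN.
exists c, ga; split=> // v f x0 S om eta M F r vw mf r0 om0 eta0 etap hv hG F0 fF Fs.
have [mv _ _] := (spaceDP v s0 p0 spN).1 vw.1.1.
case: hv => A [mA A0] hA.
(* Any value below [S] satisfies all the upper bounds required of [v]. *)
pose t0 := Num.min (- M) S.
pose v' y := \1_(~` A) y * v y + \1_A y * t0.
have v'in y : A y -> v' y = t0.
  move=> Ay; by rewrite /v' !indicE in_setC (mem_set Ay)/= mul0r mul1r add0r.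
have v'out y : ~ A y -> v' y = v y.
  by move=> Ay; rewrite /v' !indicE in_setC (memNset Ay)/= mul0r mul1r addr0.
have mv' : measurable_fun setT v'.
  have mi (B : set X) : measurable B -> measurable_fun setT (\1_B : X -> R).
    by move=> mB; exact: measurable_indic.
  apply: measurable_funD; apply: measurable_funM => //; apply: mi => //.
  exact: measurableC.
have vv' : {ae leb, forall y, v y = v' y}.
  by exists A; split=> // y /= h; apply: contrapT => nA; apply: h; rewrite v'out.
have vw' := weak_eq_ae s0 p0 q0 spN sqN mv' vv' vw.
have hv y : ~ A y -> [/\ `|v y| <= M, `|y - x0| < 6 * r -> v y <= S &
      6 * r <= `|y - x0| -> v y <= S + ga * om * (`|y - x0| / r) `^ eta].
  by move=> nA; apply: contrapT => h; apply: nA; exact: hA.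
have t0S : t0 <= S by rewrite ge_min lexx orbT.
have go0 y : 0 <= ga * om * (`|y - x0| / r) `^ eta.
  by rewrite mulr_ge0 ?powR_ge0// mulr_ge0 ?ltW.
have pv : {ae leb, forall y, `|y - x0| < r -> v' y <= parab S (ga * om) r x0 y}.
  apply: (H v' f x0 S om eta (Num.max M `|t0|) F r vw' mf _ r0 om0 eta0 etap _ _ _ F0 fF Fs).
  - move=> y; have [Ay|nA] := pselect (A y).
      by rewrite v'in// le_max lexx orbT.
    by have [h _ _] := hv y nA; rewrite v'out// le_max h.
  - move=> y y6; have [Ay|nA] := pselect (A y); first by rewrite v'in.
    by have [_ h _] := hv y nA; rewrite v'out// h.
  - move=> y y6; have [Ay|nA] := pselect (A y).
      by rewrite v'in// (le_trans t0S)// lerDl.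
    by have [_ _ h] := hv y nA; rewrite v'out// h.
  - apply: (le_trans hG).
    have mQ : measurable [set y : X | r * 3 <= `|y - x0| < r * 6].
      have r30 : 0 < r * 3 by rewrite mulr_gt0.
      have [] := annulus_measure x0 N1 r30.
      by rewrite (_ : r * 3 *+ 2 = r * 6)// -mulr_natr -mulrA -natrM.
    have m1 := measurable_sublevel (S - om / 2) mv.
    have m2 := measurable_sublevel (S - om / 2) mv'.
    set B := [set y | v' y <= _] `&` _.
    have mB : measurable B by exact: measurableI.
    apply: (@le_trans _ _ (leb (B `|` A))).
      apply: le_measure; rewrite ?inE; [exact: measurableI|exact: measurableU|].
      move=> y [/= h1 h2]; have [Ay|nA] := pselect (A y); [by right|left].
      by split=> //=; rewrite v'out.
    apply: (le_trans (measureU2 _ _ _)) => //.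
    by rewrite [X in (_ + X <= _)%E]A0 adde0.
apply: filterS2 pv vv' => y h1 h2 hy; rewrite h2.
have N0 : 1 <= N%:R :> R by rewrite ler1n.
have yr : `|y - x0| < r.
  have : 1 * `|y - x0| <= N%:R * `|y - x0| by rewrite ler_wpM2r.
  by lra.
apply: (le_trans (h1 yr)); apply: parab_le_inside => //.
by rewrite mulr_ge0 ?ltW.
Qed.

(** Two-sided, so that it gives the growth hypotheses for u and for - u at once. The factor 6 is
    there because the growth lemma is applied with r = rho / 6. *)
Definition trapped (ga eta : R) u (x0 : X) (rho om m : R) : Prop :=
  {ae leb, forall y, [/\ `|y - x0| < rho -> m <= u y <= m + om &
   rho <= `|y - x0| ->
     m - ga * om * (6 * `|y - x0| / rho) `^ eta <= u y <=
     m + om + ga * om * (6 * `|y - x0| / rho) `^ eta]}.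

Lemma trapped_shrink (ga eta mu tau : R) u x0 (rho om m m' : R) :
  0 < ga -> 0 <= eta -> 1 < mu -> 1 <= tau -> 0 < rho -> 0 < om ->
  tau <= 1 + ga -> tau * (1 + ga) <= 1 + ga * mu `^ eta ->
  m <= m' -> m' + om / tau <= m + om ->
  trapped ga eta u x0 rho om m ->
  {ae leb, forall y, `|y - x0| < rho / mu -> m' <= u y <= m' + om / tau} ->
  trapped ga eta u x0 (rho / mu) (om / tau) m'.
Proof.
move=> ga0 eta0 mu1 tau1 rho0 om0 tga tmu mm' m'm T T'.
have mu0 : 0 < mu by apply: lt_trans mu1.
have tau0 : 0 < tau by exact: lt_le_trans tau1.
have rhomu : rho / mu <= rho by rewrite ler_pdivrMr// ler_peMr// ltW.
have : 0 < om / tau by rewrite divr_gt0.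
have : om = tau * (om / tau) by rewrite mulrC divfK// gt_eqF.
move: (om / tau) m'm T' => om' m'm T' omE om'0.
apply: filterS2 T T' => y [h1 h2] h3; split=> // hy.
set z := 6 * `|y - x0| / rho.
have zE : 6 * `|y - x0| / (rho / mu) = z * mu.
  by rewrite /z; field; rewrite !gt_eqF.
have z0 : 0 <= z by rewrite divr_ge0 ?(ltW rho0)// mulr_ge0.
have zmu : 1 <= z * mu.
  rewrite -zE ler_pdivlMr ?divr_gt0// mul1r; have := normr_ge0 (y - x0).
  by move: hy; lra.
rewrite zE.
have W : om - om' <= ga * om' * (z * mu) `^ eta /\ (rho <= `|y - x0| ->
    om - om' + ga * om * z `^ eta <= ga * om' * (z * mu) `^ eta).
  split.
    have zm : 1 <= (z * mu) `^ eta by rewrite -[leLHS](powRr0 (z * mu)) ler_powR.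
    have gz := ler_wpM2l (ltW ga0) zm.
    have tz : tau - 1 <= ga * (z * mu) `^ eta by lra.
    have := ler_wpM2l (ltW om'0) tz; rewrite omE; lra.
  move=> hy2; have z1 : 1 <= z.
    by rewrite ler_pdivlMr// mul1r; have := normr_ge0 (y - x0); lra.
  have ze : 1 <= z `^ eta by rewrite -[leLHS](powRr0 z) ler_powR.
  rewrite (powRM _ z0 (ltW mu0)) omE.
  have -> : tau * om' - om' + ga * (tau * om') * z `^ eta =
    om' * (tau - 1 + ga * tau * z `^ eta) by ring.
  have -> : ga * om' * (z `^ eta * mu `^ eta) = om' * (ga * mu `^ eta * z `^ eta) by ring.
  rewrite ler_wpM2l ?(ltW om'0)//.
  have : (tau - 1) * 1 <= (tau - 1) * z `^ eta by rewrite ler_wpM2l// subr_ge0.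
  have : (tau * (1 + ga) - 1) * z `^ eta <= ga * mu `^ eta * z `^ eta.
    by rewrite ler_wpM2r ?powR_ge0//; lra.
  by lra.
have [W1 W2] := W.
have [yr|yr] := ltP `|y - x0| rho.
  have /andP[h4 h5] := h1 yr.
  by apply/andP; split; lra.
have /andP[h4 h5] := h2 yr; have W3 := W2 yr.
rewrite -/z in h4 h5.
by apply/andP; split; lra.
Qed.

Lemma trapped_step : exists c ga : R, [/\ 0 < c, 0 < ga, ga <= 4^-1 &
  forall u f (x0 : X) (M F eta mu tau rho om m : R),
    weak_eq s p q f u -> measurable_fun setT f -> {ae leb, forall y, `|u y| <= M} ->
    0 <= eta -> eta * (p - 1) <= s * q / 2 ->
    12 * N%:R <= mu -> 1 <= tau -> 0 < rho -> 0 < om ->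
    tau <= 1 + ga -> tau * (1 + ga) <= 1 + ga * mu `^ eta -> tau * (1 - ga / 2) <= 1 ->
    0 <= F -> {ae leb, forall y, `|y - x0| < rho -> `|f y| <= F} ->
    F < c * om `^ (p - 1) * (rho / 6) `^ (- (s * p)) ->
    trapped ga eta u x0 rho om m ->
    exists m', trapped ga eta u x0 (rho / mu) (om / tau) m'].
Proof.
have s1' := s1; have q2' := q2; have qp' := qp.
have p2 : 2 < p by exact: lt_le_trans qp.
have [p0 q0] : 0 < p /\ 0 < q by split; lra.
have sqN : s * q < N%:R by apply: le_lt_trans spN; rewrite ler_wpM2l// ltW.
have N0 : 1 <= N%:R :> R by rewrite ler1n.
have [c [ga [c0 ga0 ga4 H]]] := growth_ae.
exists c, ga; split=> // u f x0 M F eta mu tau rho om m uw mf uM eta0 etap mu12 tau1 rho0 om0.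
move=> tga tmu tga2 F0 fF Fs T.
have [mu_ _ _] := (spaceDP u s0 p0 spN).1 uw.1.1.
have mu1 : 1 < mu by lra.
have mu0 : 0 < mu by lra.
have tau0 : 0 < tau by lra.
set r := rho / 6; have r0 : 0 < r by rewrite divr_gt0.
have r6 : 6 * r = rho by rewrite /r mulrC divfK.
have fFr : {ae leb, forall y, `|y - x0| < r -> `|f y| <= F}.
  by apply: filterS fF => y h yr; apply: h; lra.
(* Origin of 12 N <= mu: the new ball must fit into N |y - x0| <= r/2 = rho/12. *)
have shrink y : `|y - x0| < rho / mu -> N%:R * `|y - x0| <= r / 2.
  rewrite ltr_pdivlMr// => h.
  have : `|y - x0| * (12 * N%:R) <= `|y - x0| * mu by rewrite ler_wpM2l.
  by lra.
(* The growth lemma lowers the oscillation to om (1 - ga/2); [tau] is small enough for om / tau to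
   contain it. *)
have omt : om * (1 - ga / 2) <= om / tau.
  by rewrite ler_pdivlMr// -mulrA ler_piMr ?(ltW om0)// mulrC.
set Q := [set y : X | r * 3 <= `|y - x0| < r * 6].
have r30 : 0 < r * 3 by rewrite mulr_gt0.
have [mQ hQ] : measurable Q /\ (((6 * r) ^+ N)%:E <= leb Q)%E.
  have e : r * 3 *+ 2 = r * 6 by rewrite mulr2n; ring.
  by have := annulus_measure x0 N1 r30; rewrite e /Q (mulrC 6 r).
have zr y : `|y - x0| / r = 6 * `|y - x0| / rho.
  by rewrite /r invf_div mulrA (mulrC 6).
pose A1 := [set y | u y <= m + om / 2] `&` Q.
pose A2 := [set y | - u y <= - m - om / 2] `&` Q.
have mnu : measurable_fun setT (fun y => - u y) by exact: measurableT_comp.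
have mA1 : measurable A1 by apply: measurableI => //; exact: measurable_sublevel.
have mA2 : measurable A2 by apply: measurableI => //; exact: (measurable_sublevel _ mnu).
have half : (((6 * r) ^+ N / 2)%:E <= leb A1)%E \/ (((6 * r) ^+ N / 2)%:E <= leb A2)%E.
  apply/orP; rewrite -[_ || _]negbK negb_or -!ltNge; apply/negP => /andP[a1 a2].
  have : (leb Q <= leb A1 + leb A2)%E.
    apply: (@le_trans _ _ (leb (A1 `|` A2))); last exact: measureU2.
    apply: le_measure; rewrite ?inE//; first exact: measurableU.
    move=> y yQ; have [h|h] := leP (u y) (m + om / 2); [left|right]; split=> //=; lra.
  move=> /(le_trans hQ); rewrite leNgt => /negP; apply.
  rewrite [X in (_ < X)%E](_ : _ = ((6 * r) ^+ N / 2)%:E + ((6 * r) ^+ N / 2)%:E)%E.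
    exact: lteD.
  by rewrite -EFinD; congr EFin; field.
have nT : {ae leb, forall y, [/\ `|u y| <= M, `|y - x0| < rho -> m <= u y <= m + om &
   rho <= `|y - x0| ->
     m - ga * om * (6 * `|y - x0| / rho) `^ eta <= u y <=
     m + om + ga * om * (6 * `|y - x0| / rho) `^ eta]}.
  by apply: filterS2 T uM => y [].
have [hA|hA] := half.
  exists m; apply: (trapped_shrink ga0 eta0 mu1 tau1 rho0 om0 tga tmu _ _ T) => //.
    by rewrite lerD2l ler_pdivrMr// ler_peMr// ltW.
  have K := H u f x0 (m + om) om eta M F r uw mf r0 om0 eta0 etap.
  have {}K : {ae leb, forall y, N%:R * `|y - x0| <= r / 2 -> u y <= m + om - ga * om / 2}.
    apply: K => //.
      apply: filterS nT => y [h1 h2 h3]; rewrite r6 zr; split=> // hy.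
        by have /andP[] := h2 hy.
      by have /andP[] := h3 hy.
    by rewrite (_ : m + om - om / 2 = m + om / 2)//; field.
  apply: filterS2 K T => y h1 [h2 _] hy.
  have yr : `|y - x0| < rho by rewrite (lt_le_trans hy)// ler_pdivrMr// ler_peMr// ltW.
  by have := h1 (shrink y hy); have /andP[-> _] := h2 yr; lra.
(* Here [u] is large on half of the annulus, so the upper end of the interval is kept and the lower
   end rises. *)
exists (m + om - om / tau).
apply: (trapped_shrink ga0 eta0 mu1 tau1 rho0 om0 tga tmu _ _ T).
- rewrite -addrA lerDl subr_ge0 ler_pdivrMr// ler_peMr// ltW//.
- by rewrite subrK.
have uw' := weak_eq_opp s0 p0 q0 spN sqN uw.
have mf' : measurable_fun setT (fun y => - f y) by exact: measurableT_comp.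
have K := H (fun y => - u y) (fun y => - f y) x0 (- m) om eta M F r uw' mf' r0 om0 eta0 etap.
have {}K : {ae leb, forall y, N%:R * `|y - x0| <= r / 2 -> - u y <= - m - ga * om / 2}.
  apply: K => //.
    apply: filterS nT => y [h1 h2 h3]; rewrite r6 zr normrN; split=> // hy.
      by have /andP[] := h2 hy; lra.
    by have /andP[] := h3 hy; lra.
  by apply: filterS fFr => y h hy; rewrite normrN h.
apply: filterS2 K T => y h1 [h2 _] hy.
have yr : `|y - x0| < rho by rewrite (lt_le_trans hy)// ler_pdivrMr// ler_peMr// ltW.
by have := h1 (shrink y hy); have /andP[_ h4] := h2 yr; rewrite subrK h4; lra.
Qed.
End oscillation.

(** * Oscillation decay *)

Section decay.
Context (R : realType) (N : nat).
Local Notation X := 'rV[R]_N.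
Local Notation leb := (lebesgue_rV R N).
Variables (s p q : R).
Hypotheses (N1 : (1 <= N)%N) (s0 : 0 < s) (s1 : s < 1) (q2 : 2 < q) (qp : q <= p).
Hypothesis (spN : s * p < N%:R).

(** Keeps the smallness of the source through all scales: om^(p - 1) rho^(-sp) is multiplied by
    mu^(sp) / tau^(p - 1) >= 1 at each step. *)
Lemma scaled_source (W tau mu sp p1 : R) j : 0 <= W -> 0 < tau -> 0 < mu -> 0 <= sp ->
  tau `^ p1 <= mu `^ sp ->
  W `^ p1 <= (W / tau ^+ j) `^ p1 * (mu ^- j / 6) `^ (- sp).
Proof.
move=> W0 tau0 mu0 sp0 tm.
have a0 : 0 < tau `^ p1 by exact: powR_gt0.
have b0 : 0 < mu `^ sp by exact: powR_gt0.
have t1 : 0 <= tau ^- j by rewrite invr_ge0 exprn_ge0 ?ltW.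
have t2 : 0 <= mu ^- j by rewrite invr_ge0 exprn_ge0 ?ltW.
have s6 : 0 <= 6^-1 :> R by rewrite invr_ge0.
rewrite (powRM _ W0 t1) (powRM _ t2 s6) (powR_invX _ _ (ltW tau0)).
rewrite (powRN (mu ^- j)) (powR_invX _ _ (ltW mu0)) invrK.
have -> : (6^-1) `^ (- sp) = 6 `^ sp :> R.
  by rewrite -powR_inv1// -powRrM mulrNN mul1r.
have h6 : 1 <= 6 `^ sp :> R by rewrite -[leLHS](powRr0 6) ler_powR// ler1n.
have hj : 1 <= (tau `^ p1) ^- j * (mu `^ sp) ^+ j.
  rewrite mulrC ler_pdivlMr ?exprn_gt0// mul1r.
  by apply: lerXn2r => //; rewrite nnegrE ltW.
have W1 : 0 <= W `^ p1 by exact: powR_ge0.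
have h16 : 1 <= (tau `^ p1) ^- j * (mu `^ sp) ^+ j * 6 `^ sp.
  by rewrite -[leLHS]mulr1 ler_pM.
have := ler_wpM2l W1 h16; rewrite mulr1 => h; apply: (le_trans h).
by rewrite le_eqVlt; apply/orP; left; apply/eqP; ring.
Qed.

Lemma oscillation_decay (amax : R) : 0 < amax -> exists alpha mu : R,
  [/\ 0 < alpha, alpha <= amax, 1 < mu &
  forall (u f : X -> R) (M F : R), weak_eq s p q f u -> measurable_fun setT f ->
    {ae leb, forall y, `|u y| <= M} -> 0 <= F ->
    exists2 W : R, 0 <= W & forall x0 : X,
      {ae leb, forall y, `|y - x0| < 1 -> `|f y| <= F} -> forall j,
      exists m, {ae leb, forall y, `|y - x0| < mu ^- j -> m <= u y <= m + W / (mu `^ alpha) ^+ j}].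
Proof.
move=> amax0.
have s1' := s1; have q2' := q2; have qp' := qp; have s0' := s0.
have p2 : 2 < p by exact: lt_le_trans qp.
have [p0 q0] : 0 < p /\ 0 < q by split; lra.
have N0 : 1 <= N%:R :> R by rewrite ler1n.
have p10 : 0 < p - 1 by lra.
have sp0 : 0 < s * p by rewrite mulr_gt0.
have [c [ga [c0 ga0 ga4 step]]] := trapped_step N1 s0 s1 q2 qp spN.
pose mu : R := 12 * N%:R; have mu1 : 1 < mu by rewrite /mu; lra.
have mu0 : 0 < mu by exact: lt_trans mu1.
pose eta := s * q / 2 / (p - 1).
have eta0 : 0 < eta by rewrite !divr_gt0// mulr_gt0.
have etap : eta * (p - 1) <= s * q / 2 by rewrite divfK// gt_eqF.
have b1 : 1 < mu `^ eta.
  by rewrite -[ltLHS](powRr0 mu) /powR gt_eqF// ltr_expR mul0r mulr_gt0// ln_gt0.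
(* The three entries are the three upper bounds on [tau] demanded by [trapped_step]; each exceeds 1,
   so some [tau] above 1 is allowed. *)
pose T := Num.min (1 + ga) (Num.min ((1 + ga * mu `^ eta) / (1 + ga)) (1 - ga / 2)^-1).
have ga1 : 0 < 1 + ga by lra.
have ga2 : 0 < 1 - ga / 2 by lra.
have T1 : 1 < T.
  rewrite !lt_min; apply/and3P; split; first lra.
    rewrite ltr_pdivlMr// mul1r ltrD2l; move: (mu `^ eta) b1 => b b1.
    by rewrite ltr_pMr.
  by rewrite invf_gt1//; lra.
have T0 : 0 < T by exact: lt_trans T1.
have lmu : 0 < ln mu by exact: ln_gt0.
(* The bound sp / (p - 1) keeps the source small under rescaling, and ln T / ln mu makes mu^alpha at
   most T. Any smaller exponent also works, hence the freedom to impose [amax]. *)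
pose alpha := Num.min amax (Num.min (s * p / (p - 1)) (ln T / ln mu)).
have alpha0 : 0 < alpha.
  by rewrite !lt_min amax0 !divr_gt0// ln_gt0.
pose tau := mu `^ alpha.
have tau0 : 0 < tau by exact: powR_gt0.
have tau1 : 1 <= tau by rewrite -[leLHS](powRr0 mu) ler_powR// ltW.
have tauT : tau <= T.
  rewrite -ler_ln ?posrE// ln_powR -ler_pdivlMr//.
  by rewrite /alpha ge_min [X in _ || X]ge_min lexx !orbT.
have [t1 t2 t3] : [/\ tau <= 1 + ga, tau * (1 + ga) <= 1 + ga * mu `^ eta & tau * (1 - ga / 2) <= 1].
  move: tauT; rewrite !le_min => /and3P[h1 h2 h3]; split=> //.
    by rewrite -ler_pdivlMr.
  by rewrite -ler_pdivlMr// mul1r.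
have tmu : tau `^ (p - 1) <= mu `^ (s * p).
  rewrite /tau -powRrM ler_powR// ?(ltW mu1)// -ler_pdivlMr//.
  by rewrite /alpha ge_min [X in _ || X]ge_min lexx orbT.
exists alpha, mu; split=> //; first by rewrite ge_min lexx.
move=> u f M F uw mf uM F0.
(* The first term traps u at scale 1, the 1 makes W positive, and the last term gives F < c W^(p -
   1). *)
pose W := 2 * `|M| + 1 + ((F + 1) / c) `^ (p - 1)^-1.
have k0 : 0 <= ((F + 1) / c) `^ (p - 1)^-1 by exact: powR_ge0.
have W0 : 0 < W by rewrite /W; have := normr_ge0 M; move: (_ `^ _) k0 => k k0; lra.
have Fc0 : 0 <= (F + 1) / c by rewrite divr_ge0 ?(ltW c0)// addr_ge0.
have FW : F < c * W `^ (p - 1).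
  have : (F + 1) / c <= W `^ (p - 1).
    have e : (F + 1) / c = (((F + 1) / c) `^ (p - 1)^-1) `^ (p - 1).
      by rewrite -powRrM mulVf ?gt_eqF// powRr1.
    rewrite [leLHS]e.
    apply: (ge0_ler_powR (ltW p10)); rewrite ?nnegrE ?(ltW W0)//.
    by rewrite /W lerDr addr_ge0// mulr_ge0.
  by rewrite ler_pdivrMr// mulrC; move: (_ * _) => k; lra.
exists W; first exact: ltW.
move=> x0 fF j.
suff [m hm] : exists m, trapped ga eta u x0 (mu ^- j) (W / tau ^+ j) m.
  by exists m; apply: filterS hm => y [].
elim: j => [|j [m IH]].
  exists (- `|M|); rewrite !expr0 invr1 mulr1.
  apply: filterS uM => y uy.
  have h1 : - `|M| <= u y <= - `|M| + W.
    have := ler_norm M; move: uy; rewrite ler_norml => /andP[h1 h2] h3.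
    by apply/andP; split; rewrite /W; move: (_ `^ _) k0 => k k0; lra.
  split=> // _; have /andP[h2 h3] := h1.
  have z0 : 0 <= ga * W * (6 * `|y - x0| / 1) `^ eta.
    by apply: mulr_ge0 (powR_ge0 _ _); apply: mulr_ge0; exact: ltW.
  by apply/andP; split; move: (_ * _ `^ _) z0 => z z0; lra.
have mj : 0 < mu ^- j by rewrite invr_gt0 exprn_gt0.
have Wj : 0 < W / tau ^+ j by rewrite divr_gt0// exprn_gt0.
have fFj : {ae leb, forall y, `|y - x0| < mu ^- j -> `|f y| <= F}.
  apply: filterS fF => y h hy; apply: h; rewrite (lt_le_trans hy)// invf_le1 ?exprn_gt0//.
  by rewrite exprn_ege1// ltW.
have Fj : F < c * (W / tau ^+ j) `^ (p - 1) * (mu ^- j / 6) `^ (- (s * p)).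
  rewrite (lt_le_trans FW)// -mulrA ler_wpM2l ?(ltW c0)//.
  exact: scaled_source (ltW W0) tau0 mu0 (ltW sp0) tmu.
have [m' hm'] := step u f x0 M F eta mu tau (mu ^- j) (W / tau ^+ j) m uw mf uM (ltW eta0) etap
  (lexx _) tau1 mj Wj t1 t2 t3 F0 fFj Fj IH.
exists m'; move: hm'; rewrite !exprSr.
by rewrite (invfM (mu ^+ j)) (invfM (tau ^+ j)) mulrA.
Qed.
End decay.

(** * The Hölder representative *)

Section representative.
Context (R : realType) (N : nat).
Local Notation X := 'rV[R]_N.
Local Notation leb := (lebesgue_rV R N).
Implicit Types (x y c : X) (u : X -> R).

(* The essential lower limit of u at x. *)
Definition lower_rep u x : R :=
  sup [set t | exists2 r : R, 0 < r & {ae leb, forall y, `|y - x| < r -> t <= u y}].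

Lemma ae_ball_witness (P : X -> Prop) x (r : R) : 0 < r -> {ae leb, forall y, P y} ->
  exists2 y, `|y - x| < r & P y.
Proof.
move=> r0 [A [mA A0 hA]]; apply: contrapT => h.
have BA : [set y : X | `|y - x| < r] `<=` A.
  by move=> y /= hy; apply: hA => Py; apply: h; exists y.
have : (leb [set y : X | (`|y - x| < r)%R] <= leb A)%E.
  by apply: le_measure; rewrite ?inE//; exact: measurable_rV_ball.
rewrite [X in (_ <= X)%E]A0 [X in (X <= _)%E](_ : _ = ((r *+ 2) ^+ N)%:E); last first.
  exact: lebesgue_rV_ball.
by rewrite lee_fin leNgt exprn_gt0// pmulrn_lgt0.
Qed.

(** Turns almost everywhere bounds into bounds at every point of the open ball: [m] belongs to the
    set defining the supremum, and no element exceeds [m + om] because small balls have positive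
    measure. *)
Lemma lower_rep_bounds u x0 (rho m om : R) :
  {ae leb, forall y, `|y - x0| < rho -> m <= u y <= m + om} ->
  forall x, `|x - x0| < rho -> m <= lower_rep u x <= m + om.
Proof.
move=> h x xr; have d0 : 0 < rho - `|x - x0| by rewrite subr_gt0.
have near y : `|y - x| < rho - `|x - x0| -> `|y - x0| < rho.
  move=> hy; have : `|y - x0| <= `|y - x| + `|x - x0| by rewrite -[y - x0](subrKA x) ler_normD.
  lra.
set E := [set t | exists2 r : R, 0 < r & {ae leb, forall y, `|y - x| < r -> t <= u y}].
have Em : E m.
  exists (rho - `|x - x0|) => //; apply: filterS h => y hy yx.
  by have /andP[] := hy (near y yx).
have ubE : ubound E (m + om).
  move=> t [r r0 ht].
  have r10 : 0 < Num.min r (rho - `|x - x0|) by rewrite lt_min r0.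
  have hh : {ae leb, forall y, (`|y - x0| < rho -> m <= u y <= m + om) /\ (`|y - x| < r -> t <= u y)}.
    by apply: filterS2 h ht => y h1 h2; split.
  have [y yy [h1 h2]] := ae_ball_witness x r10 hh.
  move: yy; rewrite lt_min => /andP[yr yx].
  by have /andP[_] := h1 (near y yx); apply: le_trans (h2 yr).
apply/andP; split.
  by apply: ub_le_sup => //; exists (m + om).
by apply: ge_sup => //; exists m.
Qed.

Lemma grid_point x (e : R) : 0 < e -> exists (k : nat) (z : 'rV[int]_N),
  `|x - \row_i ((z ord0 i)%:~R / k.+1%:R)| < e.
Proof.
move=> e0; pose k := Num.truncn e^-1; pose z : 'rV[int]_N := \row_i Num.floor (k.+1%:R * x ord0 i).
have k0 : 0 < k.+1%:R :> R by rewrite ltr0n.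
exists k, z; apply/(rV_norm_ltP _ e0) => i; rewrite !mxE.
set t := x ord0 i; have /andP[h1 h2] := floor_itv (k.+1%:R * t).
have -> : t - (Num.floor (k.+1%:R * t))%:~R / k.+1%:R =
    (k.+1%:R * t - (Num.floor (k.+1%:R * t))%:~R) / k.+1%:R by field; rewrite gt_eqF.
rewrite ger0_norm; last by rewrite divr_ge0// subr_ge0.
rewrite (@lt_le_trans _ _ (k.+1%:R^-1))//.
  rewrite -[ltRHS]mul1r ltr_pM2r ?invr_gt0//; move: h2; rewrite intrD1; lra.
rewrite invf_ple ?posrE//; exact/ltW/truncnS_gt.
Qed.

(** Each oscillation bound has an exceptional null set that depends on its centre, so only the
    countably many rational grid centres are used. At a remaining point, u and [lower_rep u] lie in
    common intervals whose lengths tend to 0. *)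
Lemma ae_lower_rep u (W : nat -> R) (mu tau : R) : 1 < mu -> 1 < tau ->
  (forall T x0 j, `|x0| <= T%:R -> exists m,
     {ae leb, forall y, `|y - x0| < mu ^- j -> m <= u y <= m + W T / tau ^+ j}) ->
  {ae leb, forall x, u x = lower_rep u x}.
Proof.
move=> mu1 tau1 osc; have mu0 : 0 < mu by exact: lt_trans mu1.
have tau0 : 0 < tau by exact: lt_trans tau1.
pose D := (nat * nat * nat * 'rV[int]_N)%type.
pose centre (d : D) : X := \row_i ((d.2 ord0 i)%:~R / d.1.2.+1%:R).
pose P (d : D) (y : X) := `|centre d| <= d.1.1.1%:R -> `|y - centre d| < mu ^- d.1.1.2 ->
  `|u y - lower_rep u y| <= W d.1.1.1 / tau ^+ d.1.1.2.
have aeP (d : D) : {ae leb, forall y, P d y}.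
  have [cT|cT] := boolP (`|centre d| <= d.1.1.1%:R); last first.
    by apply: aeW => y; rewrite /P (negbTE cT).
  have [m hm] := osc d.1.1.1 (centre d) d.1.1.2 cT.
  have rep := lower_rep_bounds hm.
  apply: filterS hm => y hy _ yc.
  have /andP[a1 a2] := hy yc; have /andP[b1 b2] := rep y yc.
  by rewrite ler_distl; apply/andP; split; lra.
have aeall : {ae leb, forall y, forall n : nat, forall d : D, unpickle n = Some d -> P d y}.
  apply: ae_foralln => n; case: (unpickle n) => [d|]; last by apply: aeW => y d.
  by apply: filterS (aeP d) => y h d' [<-].
apply: filterS aeall => y h; apply/eqP; rewrite -subr_eq0 -normr_le0.
(* One unit more than |y|, so that grid centres within distance 1 of y are still admissible. *)
pose T := (Num.truncn `|y|).+2.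
have yT : `|y| + 1 <= T%:R by rewrite /T -natr1 lerD2r ltW// truncnS_gt.
have small j : `|u y - lower_rep u y| <= W T / tau ^+ j.
  have e0 : 0 < Num.min 1 (mu ^- j) by rewrite lt_min ltr01 invr_gt0 exprn_gt0.
  have [k [z]] := grid_point y e0; rewrite lt_min => /andP[y1 yj].
  apply: (h (pickle ((T, j, k, z) : D)) (T, j, k, z)) => //.
    exact: pickleK.
  rewrite (le_trans _ yT)// -[leLHS](normrN) /centre/=.
  set cc := \row_i _; have : `|- cc| <= `|y - cc| + `|y|.
    by rewrite -(normrN y) (le_trans _ (ler_normD _ _))// addrAC subrr add0r.
  by move: y1; rewrite -/cc; lra.
apply/ler_addgt0Pr => e e0; rewrite add0r.
have lim : geometric (W T) tau^-1 @ \oo --> (0 : R).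
  by apply: cvg_geometric; rewrite gtr0_norm ?invr_gt0// invf_lt1.
have /cvgrPdist_lt /(_ _ e0)[n _ /(_ n (leqnn n))] := lim.
rewrite sub0r normrN /geometric/= exprVn => hn.
exact: le_trans (small n) (le_trans (ler_norm _) (ltW hn)).
Qed.

Lemma geometric_bracket (mu d : R) : 1 < mu -> 0 < d -> d < 1 ->
  exists j, d < mu ^- j /\ mu ^- j.+1 <= d.
Proof.
move=> mu1 d0 d1; have mu0 : 0 < mu by exact: lt_trans mu1.
have ex : exists n, mu ^- n <= d.
  have lim : geometric 1 mu^-1 @ \oo --> (0 : R).
    by apply: cvg_geometric; rewrite gtr0_norm ?invr_gt0// invf_lt1.
  have /cvgrPdist_lt /(_ _ d0)[n _ /(_ n (leqnn n))] := lim.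
  rewrite sub0r normrN /geometric/= mul1r exprVn => hn.
  by exists n; exact: le_trans (ler_norm _) (ltW hn).
case: (ex_minnP ex) => -[|n] hn nmin.
  by move: hn; rewrite expr0 invr1 leNgt d1.
by exists n; split=> //; rewrite ltNge; apply/negP => /nmin; rewrite ltnn.
Qed.

(** For mu^(-j-1) <= |x - y| < mu^(-j) both points lie in the ball of scale j around x, where the
    oscillation is W / tau^j = W tau tau^(-j-1) <= W tau |x - y|^alpha. For |x - y| >= 1 the bound
    [M] is enough. *)
Lemma lower_rep_holder u (alpha mu M W : R) (K : set X) :
  0 < alpha -> 1 < mu -> 0 <= M -> 0 <= W ->
  {ae leb, forall y, 0 <= u y <= M} ->
  (forall x0, K x0 -> forall j, exists m,
     {ae leb, forall y, `|y - x0| < mu ^- j -> m <= u y <= m + W / (mu `^ alpha) ^+ j}) ->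
  (exists M' : R, forall x, K x -> `|lower_rep u x| <= M') /\
  (exists C : R, forall x y, K x -> K y -> x != y ->
     `|lower_rep u x - lower_rep u y| / enorm (x - y) `^ alpha <= C).
Proof.
move=> a0 mu1 M0 W0 uM osc; have mu0 : 0 < mu by exact: lt_trans mu1.
have rep x : 0 <= lower_rep u x <= M.
  have h : {ae leb, forall y, `|y - x| < 1 -> 0 <= u y <= 0 + M}.
    by apply: filterS uM => y h _; rewrite add0r.
  by have := lower_rep_bounds h; move=> /(_ x); rewrite subrr normr0 ltr01 add0r; exact.
split.
  by exists M => x _; have /andP[h1 h2] := rep x; rewrite ger0_norm.
set tau := mu `^ alpha; have tau0 : 0 < tau by exact: powR_gt0.
exists (M + W * tau) => x y Kx Ky xy.
have d0 : 0 < `|x - y| by rewrite normr_gt0 subr_eq0.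
have de : `|x - y| `^ alpha <= enorm (x - y) `^ alpha.
  by apply: (ge0_ler_powR (ltW a0)); rewrite ?nnegrE ?enorm_ge0 ?le_enorm.
have da0 : 0 < `|x - y| `^ alpha by exact: powR_gt0.
have ea0 := lt_le_trans da0 de.
rewrite ler_pdivrMr// (@le_trans _ _ ((M + W * tau) * `|x - y| `^ alpha))//; last first.
  by rewrite ler_wpM2l// addr_ge0// mulr_ge0// ltW.
have Wt : 0 <= W * tau by rewrite mulr_ge0// ltW.
have [d1|d1] := leP 1 `|x - y|.
  have /andP[x1 x2] := rep x; have /andP[y1 y2] := rep y.
  apply: (@le_trans _ _ M); first by rewrite ler_distl; apply/andP; split; lra.
  have da1 : 1 <= `|x - y| `^ alpha by rewrite -[leLHS](powRr0 `|x - y|) ler_powR// ltW.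
  have := ler_wpM2l M0 da1; have := ler_wpM2l Wt da1.
  rewrite mulrDl; move: Wt; lra.
have [j [j1 j2]] := geometric_bracket mu1 d0 d1.
have [m hm] := osc x Kx j; have hr := lower_rep_bounds hm.
have mj : 0 < mu ^- j by rewrite invr_gt0 exprn_gt0.
have /andP[x1 x2] : m <= lower_rep u x <= m + W / tau ^+ j by apply: hr; rewrite subrr normr0.
have /andP[y1 y2] : m <= lower_rep u y <= m + W / tau ^+ j by apply: hr; rewrite distrC.
apply: (@le_trans _ _ (W / tau ^+ j)).
  by rewrite ler_distl; apply/andP; split; lra.
have tj : tau ^- j.+1 <= `|x - y| `^ alpha.
  rewrite /tau -powR_invX ?(ltW mu0)//.
  by apply: (ge0_ler_powR (ltW a0)); rewrite ?nnegrE// invr_ge0 exprn_ge0// ltW.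
have -> : W / tau ^+ j = W * tau * tau ^- j.+1.
  by rewrite exprS; field; rewrite expf_neq0 ?gt_eqF.
have := ler_wpM2l Wt tj; move=> h; apply: (le_trans h).
by rewrite ler_wpM2r ?(ltW da0)// lerDr.
Qed.

Lemma lebesgue_rV_gt0 : (0 < leb setT)%E.
Proof.
apply: (@lt_le_trans _ _ (leb [set y : X | (`|y - 0| < 1)%R])).
  rewrite [X in (_ < X)%E](_ : _ = ((1 *+ 2) ^+ N)%:E); last exact: lebesgue_rV_ball.
  by rewrite lte_fin exprn_gt0// pmulrn_lgt0.
by apply: le_measure; rewrite ?inE//; exact: measurable_rV_ball.
Qed.

Lemma Lfun_oo_bounded u (M : R) : measurable_fun setT u ->
  {ae leb, forall x, `|u x| <= M} -> u \in Lfun leb +oo%E.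
Proof.
move=> mu uM; apply/andP; rewrite !inE; split=> //=.
rewrite /finite_norm unlock lebesgue_rV_gt0.
apply: (@le_lt_trans _ _ M%:E); last exact: ltry.
by apply/ess_supP; apply: filterS uM => x h; rewrite /= lee_fin.
Qed.

Lemma Linfty_loc_bound f (T : R) : Linfty_loc f ->
  exists2 F : R, 0 <= F & {ae leb, forall x, `|x| <= T -> `|f x| <= F}.
Proof.
move=> fL; pose K := [set x : X | `|x| <= T].
have cK : compact K.
  apply: bounded_closed_compact.
    exists T; split; first exact: num_real.
    by move=> t Tt x /= h; rewrite (le_trans h)// ltW.
  rewrite (_ : K = (fun x : X => `|x|) @^-1` [set t : R | t <= T]); last by [].
  apply: closed_comp; last exact: closed_le.
  by move=> x _; exact: norm_continuous.
have /andP[_] := fL K cK; rewrite inE /= /finite_norm unlock lebesgue_rV_gt0 => hfin.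
have ess := ess_sup_ge leb (abse \o (EFin \o (f \* \1_K))).
set E := ess_sup _ _ in hfin ess.
exists (Num.max 0 (fine E)); first by rewrite le_max lexx.
apply: filterS ess => x /= hx xT.
rewrite indicE mem_set//= mulr1 in hx.
have Efin : E \is a fin_num.
  by rewrite ge0_fin_numE// (le_trans _ hx)// lee_fin.
by rewrite le_max; apply/orP; right; rewrite -lee_fin fineK.
Qed.

End representative.

(** For p = q the interval prescribed for [alpha] is empty, so its upper end is imposed only when q
    < p; [alpha < 1] is asserted in every case. *)
Theorem theorem1p1 (R : realType) (N : nat) (s p q theta : R)
    (f u : 'rV[R]_N -> R) :
  (1 <= N)%N -> 0 < s -> s < 1 -> 2 < q -> q <= p -> s * p < N%:R ->
  N%:R / (s * p) < theta ->
  f \in Lfun (lebesgue_rV R N)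
          (critical_exponent N s p / (critical_exponent N s p - 1))%:E ->
  f \in Lfun (lebesgue_rV R N) theta%:E ->
  weak_solution s p q f u ->
  u \in Lfun (lebesgue_rV R N) +oo%E /\
  (Linfty_loc f ->
   exists alpha : R,
     [/\ 0 < alpha, alpha < 1,
         q < p -> alpha < s * (p - q) / (p - 1) &
         holder_loc alpha u]).
Proof.
move=> N1 s0 s1 q2 qp spN thN _ fL sol.
have [uW upos ueq] := sol.
have p0 : 0 < p by lra.
have N0 : 0 < N%:R :> R by rewrite ltr0n.
have th0 : 0 < theta by rewrite (lt_trans _ thN)// divr_gt0// mulr_gt0.
have [mf _] := (LfunrP f th0).1 fL.
have [mu _ _] := (spaceDP u s0 p0 spN).1 uW.1.
have [M M0 uM] := weak_solution_bounded N1 s0 q2 qp spN thN fL sol.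
have absM : {ae lebesgue_rV R N, forall x, `|u x| <= M}.
  by apply: filterS uM => x /andP[h1 h2]; rewrite ger0_norm.
split; first exact: Lfun_oo_bounded absM.
move=> floc.
(* A target strictly below both bounds; the decay lemma then delivers an exponent that does not
   exceed it. *)
have [amax [amax0 amax1 amaxpq]] : exists amax : R,
    [/\ 0 < amax, amax < 1 & q < p -> amax < s * (p - q) / (p - 1)].
  have [pq|pq] := ltP q p; last first.
    by exists 2^-1; split; [lra|lra|move=> qp'; lra].
  have b0 : 0 < s * (p - q) / (p - 1) by rewrite divr_gt0 ?mulr_gt0//; lra.
  exists (Num.min 2^-1 (s * (p - q) / (p - 1) / 2)); split.
  - by rewrite lt_min; apply/andP; split; lra.
  - by rewrite gt_min; apply/orP; left; lra.
  - by move=> _; rewrite gt_min; apply/orP; right; lra.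
have [alpha [mm [a0 aM mm1 decay]]] := oscillation_decay N1 s0 s1 q2 qp spN amax0.
exists alpha; split=> //.
- exact: le_lt_trans amax1.
- by move=> pq; exact: le_lt_trans (amaxpq pq).
have uw : weak_eq s p q f u by split.
(* [f] is only locally bounded, so W depends on the size T of the centres; a unit ball around such a
   centre stays within radius T + 1. *)
have osc T : exists2 W : R, 0 <= W & forall x0 : 'rV[R]_N, `|x0| <= T -> forall j, exists m,
    {ae lebesgue_rV R N, forall y, `|y - x0| < mm ^- j -> m <= u y <= m + W / (mm `^ alpha) ^+ j}.
  have [F F0 fF] := Linfty_loc_bound (T + 1) floc.
  have [W W0 hW] := decay u f M F uw mf absM F0.
  exists W => // x0 x0T j; apply: hW; apply: filterS fF => y h yx; apply: h.
  have : `|y| <= `|y - x0| + `|x0| by rewrite -{1}[y](subrK x0) ler_normD.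
  by lra.
exists (lower_rep u).
  have oscN T : {W : R | forall x0 : 'rV[R]_N, `|x0| <= T%:R -> forall j, exists m,
    {ae lebesgue_rV R N, forall y, `|y - x0| < mm ^- j -> m <= u y <= m + W / (mm `^ alpha) ^+ j}}.
    by apply: cid; have [W _ hW] := osc T%:R; exists W.
  apply: (@ae_lower_rep R N u (fun T => sval (oscN T)) mm (mm `^ alpha)) => //.
    by rewrite -[ltLHS](powRr0 mm) /powR gt_eqF ?(lt_trans _ mm1)// ltr_expR mul0r mulr_gt0// ln_gt0.
  by move=> T x0 j x0T; exact: (svalP (oscN T)).
move=> K cK.
have [T KT] : exists T : R, forall x, K x -> `|x| <= T.
  have [T [_ hT]] := compact_bounded cK.
  by exists (T + 1) => x Kx; apply: (hT (T + 1)) => //; rewrite ltrDl.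
have [W W0 hW] := osc T.
apply: (@lower_rep_holder R N u alpha mm M W K a0 mm1 (ltW M0) W0 uM).
by move=> x0 Kx0; apply: hW; exact: KT.
Qed.
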